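(* There is an absolute constant $K>0$ such that the following holds. Let $\mu$ be a non-negative locally finite Borel measure on $\mathbb C$ such that $$ \int_{\{|\zeta|\ge1\}}\frac{d\mu(\zeta)}{|\zeta|^2}<\infty , $$ and such that the principal value integral $$ \lim_{\varepsilon\to0}\int_{\{\varepsilon\le|\zeta|\le1\}}\frac{d\mu(\zeta)}{\zeta} $$ exists and is finite. Let $$ u(z)=\lim_{\varepsilon\to0}\int_{|\zeta|>\varepsilon}H(z/\zeta)\,d\mu(\zeta). $$ Then $$ \sup_{0<r<\infty}\frac{M(r,u)}{r}\le K\left\{\int_0^\infty\frac{\delta(t)}{t^2}\,dt+\limsup_{r\to0}\frac{\mu(r)}{r}\right\}, $$ where $\delta(r)=\mathfrak n(r)+u^-(r)+u^-(-r)$ and $\mathfrak n$ is the Levin--Tsuji counting function of $\mu$.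
   Context: Notation: $H(z)=\log|1-z|+\operatorname{Re}(z)$ for $z\in\mathbb C$ (with $H(1)=-\infty$). $M(r,u)=\max_{|z|\le r}u(z)$; $u^-=\max(0,-u)$; $\mu(r)=\mu(\{|z|\le r\})$. The Levin--Tsuji counting function is $\mathfrak n(r)=\mu\big(\{z:|\operatorname{Im}(1/z)|\ge 1/r\}\big)=\mu(\{|z-ir/2|\le r/2\})+\mu(\{|z+ir/2|\le r/2\})$. The right-hand side is allowed to equal $+\infty$ (in which case there is nothing to prove). *)

(* Defs.v *)
From HB Require Import structures.
From mathcomp Require Import all_boot all_order all_algebra.
From mathcomp Require Import all_classical all_reals all_analysis.
From mathcomp.real_closed Require Import complex.

Set Implicit Arguments.
Unset Strict Implicit.
Unset Printing Implicit Defensive.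

Import Order.TTheory GRing.Theory Num.Theory.
Import numFieldNormedType.Exports.

Local Open Scope classical_set_scope.
Local Open Scope ring_scope.

(* The complex numbers with their Borel sets; the topology is the one that the
   modulus induces on R[i], which the library attaches to the alias R[i]^o. *)
Definition borelC (R : realType) : measurableType _ :=
  g_sigma_algebraType (@open (R[i]^o)).

(* Real-valued modulus: `|z| on R[i] takes its values in R[i]. *)
Definition modC (R : realType) (z : R[i]) : R := ComplexField.Normc.normc z.

Definition locally_finite (R : realType) (mu : {measure set (borelC R) -> \bar R}) :=
  forall z : R[i]^o, exists U : set R[i]^o,
    [/\ open U, U z & (mu U < +oo)%E].

Definition disc_mass (R : realType) (mu : {measure set (borelC R) -> \bar R})
    (r : R) : \bar R :=
  mu [set z : borelC R | modC z <= r].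

(* The coordinates are integrated separately; this is the complex integral when
   f is integrable on D, which is the case for 1/z on any annulus of positive
   inner radius if mu is locally finite. *)
Definition integralC (R : realType) (mu : {measure set (borelC R) -> \bar R})
    (D : set (borelC R)) (f : R[i] -> R[i]) : R[i] :=
  (Rintegral mu D (fun z => complex.Re (f z)) +i*
   Rintegral mu D (fun z => complex.Im (f z)))%C.

Definition pv_truncated (R : realType) (mu : {measure set (borelC R) -> \bar R})
    (eps : R) : R[i]^o :=
  integralC mu [set z : borelC R | eps <= modC z <= 1] (fun z => z^-1).

(* log|1 - z| + Re z. Here lne 0 = -oo, so the value at 1 is -oo. *)
Definition kernelH (R : realType) (z : R[i]) : \bar R :=
  (lne (modC (1 - z)%R)%:E + (complex.Re z)%:E)%E.

(* The limit is taken in \bar R. The mass at the origin plays no role. *)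
Definition potential (R : realType) (mu : {measure set (borelC R) -> \bar R})
    (z : R[i]) : \bar R :=
  lim ((\int[mu]_(w in [set w : borelC R | (eps < modC w)%R])
            kernelH (z / w)%R)%E @[eps --> (0 : R)^'+]).

(* A supremum in \bar R, which is the maximum whenever that is attained. *)
Definition max_on_disc (R : realType) (u : R[i] -> \bar R) (r : R) : \bar R :=
  ereal_sup [set u z | z in [set z : R[i] | modC z <= r]].

(* The union of the closed discs of radius r/2 centred at i r/2 and - i r/2.
   Since 0^-1 = 0, their common point, the origin, is left out. *)
Definition levin_tsuji (R : realType) (mu : {measure set (borelC R) -> \bar R})
    (r : R) : \bar R :=
  mu [set z : borelC R | r^-1 <= `|complex.Im ((z : R[i])^-1)|].

(* f^\- is the negative part max(-f, 0). *)
Definition delta (R : realType) (mu : {measure set (borelC R) -> \bar R})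
    (r : R) : \bar R :=
  (levin_tsuji mu r + (potential mu)^\- (r%:C)%C
     + (potential mu)^\- ((- r)%R%:C)%C)%E.

(* Main.v *)
Require Import Defs.
From HB Require Import structures.
From mathcomp Require Import all_boot all_order all_algebra.
From mathcomp Require Import finmap.
From mathcomp Require Import all_classical all_reals all_analysis.
From mathcomp Require Import measurable_realfun.
From mathcomp.real_closed Require Import complex.
From mathcomp Require Import ring lra.

Set Implicit Arguments.
Unset Strict Implicit.
Unset Printing Implicit Defensive.

Import Order.TTheory GRing.Theory Num.Theory.
Import numFieldNormedType.Exports.

Local Open Scope classical_set_scope.
Local Open Scope ring_scope.

(* Put H(v) = log|1 - v| + Re v, w = 1/zeta and |z| = r. For 0 < eta < r/2 there
   is a positive measure nu on eta <= |x| <= r, with density at most 26 r / x^2,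
   such that for every w
     H(z w) + int H(x w) dnu(x) <= 295 r |Im w| + 24 (r/eta) psi(eta Re w).
   The part 24 r dx / x^2 of nu contributes -24 psi(r Re w), which absorbs the
   logarithmic growth of H(z w); the rest lives on r/2 <= |x| <= r, on the side
   opposite to Re z, and cancels the linear term Re z Re w. Integrating over
   |zeta| > eps with respect to mu bounds the truncated potential u_eps(z) by
     26 r int u_eps^-(x) dx / x^2 + 295 r int |Im (1/zeta)| dmu + error,
   and int |Im (1/zeta)| dmu <= 2 int n(t) / t^2 dt. If mu(t) <= L t for small t,
   the error is O(r L) as eta -> 0; together with the principal value this also
   makes u_eps converge to u uniformly on eta <= |x| <= r as eps -> 0. *)

(** * Logarithmic inequalities *)

(** The obstacle is the value -oo: H has logarithmic poles, and the integral of its negative part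
    against mu may be infinite, so integrals cannot be rearranged freely. A bound H <= X is
    therefore carried as H^+ <= H^- + X, so that Tonelli is applied to nonnegative functions only,
    and a term is cancelled only once it is known to be finite. The positive parts are finite
    because H(v) <= |v|^2 / 2 for every v. The point that cancels Re z Re w is averaged over an
    interval because u^- is controlled only in the mean. Origin of the constants: 24 = 3 * 8, for
    three logarithms ln(1 + r|w|), each bounded through 8 psi; 26 = 24 + 2, the 2 coming from the
    one-sided part of nu; 295 = 7 + 24 * 12; the factor 2 of the angular integral turns 295 into
    590; the small discs contribute 24 (8 + 24) r L = 768 r L, and 768, the larger of the two, is
    K. *)

Section RealLemmas.
Variable R : realType.
Implicit Types s t x y a b : R.

Lemma ln_le_subr1 x : 0 < x -> ln x <= x - 1.
Proof.
move=> x0; have -> : x = 1 + (x - 1) by ring.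
by rewrite (le_trans (le_ln1Dx _))//; lra.
Qed.

Lemma ln_ge_1subV x : 0 < x -> 1 - x^-1 <= ln x.
Proof.
move=> x0; have := @ln_le_subr1 x^-1; rewrite invr_gt0 => /(_ x0).
by rewrite lnV ?posrE//; lra.
Qed.

Lemma ln_mono x y : 0 < x -> x <= y -> ln x <= ln y.
Proof. by move=> x0 xy; rewrite ler_ln ?posrE// (lt_le_trans x0). Qed.

Lemma lnX2 x : 0 < x -> ln (x ^+ 2) = 2 * ln x.
Proof. by move=> x0; rewrite lnXn// mulr2n; lra. Qed.

Lemma ln_sqrtE x : 0 < x -> ln x = 2 * ln (Num.sqrt x).
Proof.
by move=> x0; rewrite -lnX2 ?sqrtr_gt0// sqr_sqrtr// ltW.
Qed.

Lemma ln1D_le_sqrt x : 0 <= x -> ln (1 + x) <= 2 * Num.sqrt x.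
Proof.
move=> x0; set v := Num.sqrt x; have v0 : 0 <= v by exact: sqrtr_ge0.
have -> : x = v ^+ 2 by rewrite sqr_sqrtr.
apply: (@le_trans _ _ (ln ((1 + v) ^+ 2))).
  by apply: ln_mono; nra.
by rewrite lnX2 ?ler_pM2l//; [apply: le_ln1Dx; lra|lra].
Qed.

Lemma ln1D_add x y : 0 <= x -> 0 <= y -> ln (1 + x + y) <= ln (1 + x) + y.
Proof.
move=> x0 y0; apply: (@le_trans _ _ (ln ((1 + x) * (1 + y)))).
  by apply: ln_mono; nra.
rewrite lnM ?posrE; [|lra|lra]; rewrite lerD2l; apply: le_ln1Dx; lra.
Qed.

(* Up to O(|Im w|), -psi (t Re w) / t is a primitive of (H (t w) + H (- t w)) / t^2. *)
Definition psi s := (1 + s) * ln `|1 + s| + (1 - s) * ln `|1 - s|.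

Lemma psiN s : psi (- s) = psi s.
Proof. by rewrite /psi opprK addrC. Qed.

Lemma psi_abs s : psi `|s| = psi s.
Proof. by case: (ger0P s) => // _; rewrite psiN. Qed.

Let xlnx_bound s : s <= 1 -> (1 - s) * ln `|1 - s| <= (1 - s) * - s.
Proof.
rewrite le_eqVlt => /predU1P[->|s1]; first by rewrite subrr !mul0r.
rewrite gtr0_norm ?subr_gt0// ler_pM2l ?subr_gt0//.
by rewrite (le_trans (ln_le_subr1 _)) ?subr_gt0//; lra.
Qed.

(** Both terms follow from [ln x <= x - 1]; in the sum of the bounds [(1 + s) * s] and
    [(1 - s) * - s] the linear parts cancel. *)
Lemma psi_le_sqr s : `|s| <= 1 -> psi s <= 2 * s ^+ 2.
Proof.
rewrite -psi_abs -(real_normK (num_real s)); move: (normr_ge0 s).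
move: `|s| => {}s s0 s1; rewrite /psi ger0_norm; last lra.
have := xlnx_bound s1; have := @le_ln1Dx _ s.
move=> /(_ ltac:(lra)) h1 h2.
have : (1 + s) * ln (1 + s) <= (1 + s) * s by rewrite ler_pM2l//; lra.
by lra.
Qed.

(** Isolates the logarithmic growth: the second summand is nonnegative and at most 2. *)
Lemma psi_gt1E s : 1 < s ->
  psi s = 2 * ln (1 + s) + (s - 1) * (ln (1 + s) - ln (s - 1)).
Proof.
move=> s1; rewrite /psi ger0_norm; last lra.
by rewrite ltr0_norm; last lra; rewrite opprB; ring.
Qed.

Lemma psi_ge_ln s : 1 <= `|s| -> 2 * ln (1 + `|s|) <= psi s.
Proof.
rewrite -psi_abs; move: (normr_ge0 s); move: `|s| => {}s s0.
rewrite le_eqVlt => /predU1P[<-|s1].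
  by rewrite /psi subrr mul0r ger0_norm; lra.
rewrite psi_gt1E// lerDl mulr_ge0//; first lra.
by rewrite subr_ge0 ln_mono; lra.
Qed.

Lemma psi_ge_sqr s : `|s| <= 1 -> s ^+ 2 / 4 <= psi s.
Proof.
rewrite -psi_abs -(real_normK (num_real s)); move: (normr_ge0 s).
move: `|s| => {}s s0; rewrite le_eqVlt => /predU1P[->|s1].
  rewrite /psi subrr mul0r ger0_norm; last lra.
  have := @ln_ge_1subV 2; have -> : 1 + 1 = 2 :> R by lra.
  by move=> /(_ ltac:(lra)); lra.
rewrite /psi ger0_norm; last lra.
rewrite gtr0_norm; last lra.
have h1 : s <= (1 + s) * ln (1 + s).
  have := @ln_ge_1subV (1 + s) ltac:(lra).
  rewrite -(@ler_pM2l _ (1 + s)); last lra.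
  by rewrite mulrBr divff; [lra|rewrite gt_eqF//; lra].
suff h2 : - s + s ^+ 2 / 4 <= (1 - s) * ln (1 - s) by lra.
(* The bound [ln x >= 1 - 1 / x] at x = 1 - s gives only -s, which cancels against [h1]. Applied to
   the square root v it gives 2 v^2 - 2 v, which exceeds -s + s^2 / 4 by (1 - v)^2 (4 - (1 + v)^2) /
   4. *)
pose v := Num.sqrt (1 - s).
have v0 : 0 < v by rewrite sqrtr_gt0; lra.
have vE : v ^+ 2 = 1 - s by rewrite sqr_sqrtr//; lra.
have v1 : v <= 1 by rewrite leNgt; apply/negP => v1; nra.
have -> : s = 1 - v ^+ 2 by lra.
have -> : 1 - (1 - v ^+ 2) = v ^+ 2 by lra.
rewrite lnX2//.
have : v ^+ 2 * (1 - v^-1) <= v ^+ 2 * ln v.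
  by rewrite ler_pM2l ?exprn_gt0// ln_ge_1subV.
rewrite mulrBr mulr1 expr2 mulfK ?gt_eqF//.
have : 0 <= (1 - v) ^+ 2 * (4 - (1 + v) ^+ 2) by rewrite mulr_ge0 ?sqr_ge0//; nra.
by nra.
Qed.

Lemma psi_ge0 s : 0 <= psi s.
Proof.
have [s1|s1] := leP `|s| 1.
  by rewrite (le_trans _ (psi_ge_sqr s1))// divr_ge0// sqr_ge0.
by rewrite (le_trans _ (psi_ge_ln (ltW s1)))// mulr_ge0// ln_ge0// lerDl.
Qed.

(** The exponent 1/2 is meant for the discs near the origin: when mu(t) <= L t, the function
    |zeta|^(-1/2) is integrable there, while |zeta|^(-1) need not be. *)
Lemma psi_le_sqrt s : psi s <= 6 * Num.sqrt `|s|.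
Proof.
have [s1|] := leP `|s| 1.
  rewrite (le_trans (psi_le_sqr s1))// -(real_normK (num_real s)).
  move: s1 (normr_ge0 s); move: `|s| => {}s s1 s0.
  set v := Num.sqrt s; have v0 : 0 <= v by exact: sqrtr_ge0.
  have sE : s = v ^+ 2 by rewrite sqr_sqrtr.
  have v1 : v <= 1 by rewrite leNgt; apply/negP => v1; nra.
  have : s ^+ 2 <= v; last by lra.
  have : v ^+ 2 <= v by nra.
  rewrite -sE => sv; nra.
rewrite -psi_abs; move: `|s| => {}s s1.
rewrite psi_gt1E//.
have h1 : (s - 1) * (ln (1 + s) - ln (s - 1)) <= 2.
  rewrite -ln_div ?posrE; [|lra|lra].
  have : (s - 1) * ln ((1 + s) / (s - 1)) <= (s - 1) * ((1 + s) / (s - 1) - 1).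
    rewrite ler_pM2l; last lra.
    by apply: ln_le_subr1; apply: divr_gt0; lra.
  move/le_trans; apply.
  by rewrite mulrBr mulrCA divff ?gt_eqF//; lra.
have h2 := @ln1D_le_sqrt s ltac:(lra).
have : 1 <= Num.sqrt s by rewrite -sqrtr1 ler_wsqrtr// ltW.
by lra.
Qed.

(** The difference is s / 2 times ln (1 + y^2) with y = b / |s|, and 1 + y^2 <= (1 + y)^2 gives ln
    (1 + y^2) <= 2 y. Smoothing the logarithm thus costs b uniformly in s. *)
Lemma xln_perturb s b : 0 < b ->
  `|s * (ln (s ^+ 2 + b ^+ 2) / 2) - s * ln `|s| | <= b.
Proof.
move=> b0; have [->|s0] := eqVneq s 0; first by rewrite !mul0r subrr normr0 ltW.
have ns0 : 0 < `|s| by rewrite normr_gt0.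
have s20 : 0 < s ^+ 2 by rewrite exprn_even_gt0.
have -> : ln (s ^+ 2 + b ^+ 2) = 2 * ln `|s| + ln (1 + (b / `|s|) ^+ 2).
  rewrite -lnX2// (real_normK (num_real s)) -lnM ?posrE//; last first.
    by rewrite ltr_pwDl ?sqr_ge0.
  by rewrite exprMn exprVn (real_normK (num_real s)) mulrDr mulr1 mulrCA mulfV ?mulr1// gt_eqF.
have -> : s * ((2 * ln `|s| + ln (1 + (b / `|s|) ^+ 2)) / 2) - s * ln `|s| =
  s * (ln (1 + (b / `|s|) ^+ 2) / 2) by field.
have bs : 0 < b / `|s| by exact: divr_gt0.
have L0 : 0 <= ln (1 + (b / `|s|) ^+ 2) by rewrite ln_ge0// lerDl sqr_ge0.
rewrite normrM [X in _ * X]ger0_norm ?divr_ge0//.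
suff : ln (1 + (b / `|s|) ^+ 2) / 2 <= b / `|s|.
  by rewrite -(ler_pM2l ns0) [X in _ <= X -> _]mulrC divfK ?gt_eqF.
rewrite ler_pdivrMr//; apply: (@le_trans _ _ (ln ((1 + b / `|s|) ^+ 2))).
  by apply: ln_mono; [rewrite ltr_pwDl ?sqr_ge0|nra].
rewrite lnX2; last lra.
by have := @le_ln1Dx _ (b / `|s|) ltac:(lra); lra.
Qed.

End RealLemmas.

(** * A primitive of the kernel *)

Section KernelPrimitive.
Variable R : realType.
Implicit Types (f g F : R -> R) (s t x y a b : R).

Lemma is_derive_integral f F a b : a < b ->
  (forall t, a <= t <= b -> is_derive t 1 F (f t)) ->
  (forall t, a <= t <= b -> derivable f t 1) ->
  (\int[lebesgue_measure]_(t in `[a, b]) (f t)%:E = (F b - F a)%:E)%E.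
Proof.
move=> ab dF df.
have cF t : a <= t <= b -> {for t, continuous F}.
  by move=> tab; apply/differentiable_continuous/derivable1_diffP; case: (dF _ tab).
rewrite (continuous_FTC2 ab (F := F)) ?EFinB//.
- apply: derivable_within_continuous => t; rewrite in_itv/= => tab.
  exact: df.
- split.
  + move=> t; rewrite in_itv/= => /andP[at_ tb].
    by case: (dF t) => //; rewrite !ltW.
  + by apply: cvg_at_right_filter; apply: cF; rewrite lexx ltW.
  + by apply: cvg_at_left_filter; apply: cF; rewrite lexx ltW.
- move=> t; rewrite in_itv/= => /andP[at_ tb].
  by rewrite derive1E; apply: derive_val; apply: dF; rewrite !ltW.
Qed.

Let derivD f g t x y : is_derive t 1 f x -> is_derive t 1 g y ->
  is_derive t 1 (fun u => f u + g u) (x + y).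
Proof. exact: is_deriveD. Qed.

Let derivB f g t x y : is_derive t 1 f x -> is_derive t 1 g y ->
  is_derive t 1 (fun u => f u - g u) (x - y).
Proof. exact: is_deriveB. Qed.

Let derivM f g t x y : is_derive t 1 f x -> is_derive t 1 g y ->
  is_derive t 1 (fun u => f u * g u) (f t * y + g t * x).
Proof. exact: is_deriveM. Qed.

Let deriv_id t : is_derive t 1 (fun u : R => u) 1.
Proof. exact: is_derive_id. Qed.

Let deriv_cst t a : is_derive t 1 (fun u : R => a) 0.
Proof. exact: is_derive_cst. Qed.

Let derivV f t x : f t != 0 -> is_derive t 1 f x ->
  is_derive t 1 (fun u => (f u)^-1) (- (f t) ^- 2 * x).
Proof. exact: is_deriveV. Qed.

Let deriv_ln f t x : 0 < f t -> is_derive t 1 f x ->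
  is_derive t 1 (fun u => ln (f u)) ((f t)^-1 * x).
Proof. by move=> ft dft; apply: is_derive1_comp; exact: is_derive1_ln. Qed.

Let deriv_atan f t x : is_derive t 1 f x ->
  is_derive t 1 (fun u => atan (f u)) ((1 + f t ^+ 2)^-1 * x).
Proof. by move=> dft; apply: is_derive1_comp. Qed.

(* H (t w) at w = a + i b. *)
Definition Hre a b t := ln ((1 - t * a) ^+ 2 + (t * b) ^+ 2) / 2 + t * a.

(** Integration by parts with a - 1 / t as primitive of 1 / t^2: if q is the argument of the
    logarithm, the product rule leaves a / t - b^2 / q. The first term is the linear term of [Hre]
    over t^2, and the arctangent removes the second. *)
Definition Hprim a b t :=
  (a - t^-1) * (ln ((1 - t * a) ^+ 2 + (t * b) ^+ 2) / 2)
  - b * atan ((t^-1 - a) / b).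

Lemma dist1_gt0 a b t : 0 < t -> 0 < b -> 0 < (1 - t * a) ^+ 2 + (t * b) ^+ 2.
Proof. by move=> t0 b0; rewrite ltr_wpDl ?sqr_ge0// exprn_gt0// mulr_gt0. Qed.

Let deriv_dist1 a b t : is_derive t 1 (fun u => (1 - u * a) ^+ 2 + (u * b) ^+ 2)
  (- (2 * a * (1 - t * a)) + 2 * b * (t * b)).
Proof.
have d1 : is_derive t 1 (fun u : R => 1 - u * a) (0 - (t * 0 + a * 1)).
  by apply: derivB => //; apply: derivM.
have d2 : is_derive t 1 (fun u : R => u * b) (t * 0 + b * 1).
  by apply: derivM.
have := derivD (derivM d1 d1) (derivM d2 d2).
by move=> d; apply: is_derive_eq d _; ring.
Qed.

Let deriv_lnq a b t : 0 < t -> 0 < b ->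
  is_derive t 1 (fun u => ln ((1 - u * a) ^+ 2 + (u * b) ^+ 2))
  (((1 - t * a) ^+ 2 + (t * b) ^+ 2)^-1 *
   (- (2 * a * (1 - t * a)) + 2 * b * (t * b))).
Proof.
move=> t0 b0.
apply: (@deriv_ln (fun u => (1 - u * a) ^+ 2 + (u * b) ^+ 2)); first exact: dist1_gt0.
exact: deriv_dist1.
Qed.

Lemma derivable_Hre a b t : 0 < t -> 0 < b ->
  derivable (fun u : R => u ^- 2 * Hre a b u) t 1.
Proof.
move=> t0 b0.
have d1 := derivM (deriv_lnq a t0 b0) (deriv_cst t 2^-1).
have d2 := derivD d1 (derivM (deriv_id t) (deriv_cst t a)).
have d3 : is_derive t 1 (fun u : R => (u ^+ 2)^-1) (- (t ^+ 2) ^- 2 * (t * 1 + t * 1)).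
  by apply: (@derivV (fun u => u ^+ 2) t _ _ (derivM (deriv_id t) (deriv_id t))); rewrite expf_neq0// gt_eqF.
by case: (derivM d3 d2).
Qed.

Lemma is_derive_Hprim a b t : 0 < t -> 0 < b ->
  is_derive t 1 (Hprim a b) (t ^- 2 * Hre a b t).
Proof.
move=> t0 b0; have q0 := dist1_gt0 a t0 b0.
have tn0 : t != 0 by rewrite gt_eqF.
have bn0 : b != 0 by rewrite gt_eqF.
have d1 := derivM (deriv_lnq a t0 b0) (deriv_cst t 2^-1).
have dV : is_derive t 1 (fun u : R => u^-1) (- t ^- 2 * 1).
  exact: (@derivV id).
have d2 := derivB (deriv_cst t a) dV.
have d3 := deriv_atan (derivM (derivB dV (deriv_cst t a)) (deriv_cst t b^-1)).
have d := derivB (derivM d2 d1) (derivM (deriv_cst t b) d3).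
apply: is_derive_eq d _; rewrite /Hre.
set q := _ + (t * b) ^+ 2 in q0 *.
have E : 1 + ((t^-1 - a) / b) ^+ 2 = q / (t * b) ^+ 2.
  by rewrite /q; field; rewrite tn0 bn0.
rewrite E invf_div.
set L := ln q; rewrite /q; field; rewrite -/q tn0 bn0/= -[X in X != 0]/q.
by rewrite gt_eqF.
Qed.

Lemma pi_half_le2 : pi / 2 <= 2 :> R.
Proof. by have := pihalf_lt2 R; lra. Qed.

(** As b tends to 0 the two logarithmic terms become -psi (t a) / t. The error 6 b consists of b for
    each smoothed logarithm ([xln_perturb] divided by t) and 2 b for each arctangent, since pi / 2
    <= 2. *)
Lemma Hprim_sym_bound a b t : 0 < t -> 0 < b ->
  `|Hprim a b t + Hprim (- a) b t + t^-1 * psi (t * a)| <= 6 * b.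
Proof.
move=> t0 b0; have tn0 : t != 0 by rewrite gt_eqF.
have tb0 : 0 < t * b by rewrite mulr_gt0.
have at_ s : `|b * atan s| <= 2 * b.
  rewrite normrM gtr0_norm// mulrC ler_pM2r// ler_norml.
  have := atan_gtNpi2 s; have := atan_ltpi2 s; have := pi_half_le2.
  by move=> ? ? ?; apply/andP; split; lra.
have := xln_perturb (1 - t * a) tb0.
have := xln_perturb (1 + t * a) tb0.
have := at_ ((t^-1 - a) / b); have := at_ ((t^-1 + a) / b).
rewrite /Hprim /psi !mulrN !opprK.
set A1 := b * _; set A2 := b * _.
set L1 := ln _; set L2 := ln _; set M1 := ln _; set M2 := ln _.
move=> h1 h2 h3 h4.
have -> : (a - t^-1) * (M1 / 2) - A2 + ((- a - t^-1) * (L1 / 2) - A1)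
   + t^-1 * ((1 + t * a) * L2 + (1 - t * a) * M2) =
  - t^-1 * ((1 - t * a) * (M1 / 2) - (1 - t * a) * M2)
  - t^-1 * ((1 + t * a) * (L1 / 2) - (1 + t * a) * L2) - A1 - A2.
  by field.
have h s : `|s| <= t * b -> `|t^-1 * s| <= b.
  move=> sb; rewrite normrM gtr0_norm ?invr_gt0//.
  by rewrite -(ler_pM2l t0) mulrA divff// mul1r.
move: h3 h4 => /h h3 /h h4.
rewrite mulNr; move: h1 h2 h3 h4; rewrite !ler_norml.
by do 4 move=> /andP[? ?]; apply/andP; split; lra.
Qed.

End KernelPrimitive.

(** * The kernel on the complex plane *)

Section Kernel.
Variable R : realType.
Implicit Types (x y t a b : R) (z v w : R[i]) (k : \bar R).

Local Notation Re := (@complex.Re R).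
Local Notation Im := (@complex.Im R).

Lemma modCE z : modC z = Num.sqrt (Re z ^+ 2 + Im z ^+ 2).
Proof. by case: z. Qed.

Lemma modC_ge0 z : 0 <= modC z.
Proof. by rewrite modCE sqrtr_ge0. Qed.

Lemma modC_sqr z : modC z ^+ 2 = Re z ^+ 2 + Im z ^+ 2.
Proof. by rewrite modCE sqr_sqrtr// addr_ge0// sqr_ge0. Qed.

Lemma modC_eq0 z : (modC z == 0) = (z == 0).
Proof.
apply/eqP/eqP => [|->]; first exact: ComplexField.Normc.eq0_normc.
exact: ComplexField.Normc.normc0.
Qed.

Lemma modC_gt0 z : (0 < modC z) = (z != 0).
Proof. by rewrite lt_neqAle modC_ge0 andbT eq_sym modC_eq0. Qed.

Lemma modCM z w : modC (z * w) = modC z * modC w.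
Proof. exact: ComplexField.Normc.normcM. Qed.

Lemma modCV z : modC z^-1 = (modC z)^-1.
Proof. exact: ComplexField.Normc.normcV. Qed.

Lemma modCN z : modC (- z) = modC z.
Proof. exact: normcN. Qed.

Lemma modCD z w : modC (z + w) <= modC z + modC w.
Proof. exact: le_normcD. Qed.

Lemma modC1 : modC (1 : R[i]) = 1.
Proof. exact: ComplexField.Normc.normc1. Qed.

Lemma modC_real x : modC (x%:C)%C = `|x|.
Proof. by rewrite modCE/= expr0n/= addr0 sqrtr_sqr. Qed.

Lemma Re_le_modC z : `|Re z| <= modC z.
Proof. by rewrite modCE -sqrtr_sqr ler_wsqrtr// lerDl sqr_ge0. Qed.

Lemma Im_le_modC z : `|Im z| <= modC z.
Proof. by rewrite modCE -sqrtr_sqr ler_wsqrtr// lerDr sqr_ge0. Qed.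

Lemma modC_le_ReIm z : modC z <= `|Re z| + `|Im z|.
Proof.
rewrite modCE -[leRHS]ger0_norm ?addr_ge0// -sqrtr_sqr ler_wsqrtr//.
rewrite sqrrD !real_normK ?num_real//.
have : 0 <= `|Re z| * `|Im z| by rewrite mulr_ge0.
lra.
Qed.

Lemma complex_ReM z w : Re (z * w) = Re z * Re w - Im z * Im w.
Proof. by case: z; case: w. Qed.

Lemma complex_ImM z w : Im (z * w) = Re z * Im w + Im z * Re w.
Proof. by case: z => ? ?; case: w => ? ? /=. Qed.

Lemma modC1B_sqr v : modC (1 - v) ^+ 2 = 1 - 2 * Re v + modC v ^+ 2.
Proof. by rewrite !modC_sqr; case: v => x y /=; ring. Qed.

Lemma kernelH_le v x : 0 < x -> modC (1 - v) <= x ->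
  (kernelH v <= (ln x + Re v)%:E)%E.
Proof.
move=> x0 vx; rewrite /kernelH EFinD leeD2r//=.
by case: ifPn => [_|]; rewrite ?leNye// -ltNge => v0; rewrite lee_fin ln_mono.
Qed.

Lemma kernelH_neq1 v : v != 1 -> kernelH v = (ln (modC (1 - v)) + Re v)%:E.
Proof.
move=> v1; rewrite /kernelH lne_EFin// modC_gt0 subr_eq0.
by rewrite eq_sym.
Qed.

(** From [ln y <= y - 1] at y = |1 - v|^2 = 1 - 2 Re v + |v|^2: the term Re v of H cancels the
    linear part exactly, so the bound is global. *)
Lemma kernelH_le_sqr v : (kernelH v <= (modC v ^+ 2 / 2)%:E)%E.
Proof.
have [->|v1] := eqVneq v 1.
  by rewrite /kernelH subrr [modC 0]ComplexField.Normc.normc0/= lexx leNye.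
have m0 : 0 < modC (1 - v) by rewrite modC_gt0 subr_eq0 eq_sym.
rewrite kernelH_neq1// lee_fin.
have := modC1B_sqr v; have := @ln_le_subr1 _ (modC (1 - v) ^+ 2).
by rewrite exprn_gt0// lnX2// => /(_ isT); lra.
Qed.

Lemma kernelH_le_ln v : (kernelH v <= (ln (1 + modC v) + Re v)%:E)%E.
Proof.
apply: kernelH_le; first by have := modC_ge0 v; lra.
by rewrite (le_trans (modCD _ _))// modCN modC1.
Qed.

Lemma kernelH_le_Hre t w b : 0 < t -> 0 < b -> `|Im w| <= b ->
  (kernelH ((t%:C)%C * w)%R <= (Hre (Re w) b t)%:E)%E.
Proof.
move=> t0 b0 wb; set q := (1 - t * Re w) ^+ 2 + (t * b) ^+ 2.
have q0 : 0 < q by exact: dist1_gt0.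
have -> : Hre (Re w) b t = ln (Num.sqrt q) + Re ((t%:C)%C * w).
  by rewrite /Hre -/q (ln_sqrtE q0) complex_ReM/=; lra.
apply: kernelH_le; first by rewrite sqrtr_gt0.
have ReE : Re (1 - (t%:C)%C * w) = 1 - t * Re w.
  by case: {+}w => x y /=; rewrite mul0r subr0.
have ImE : Im (1 - (t%:C)%C * w) = - (t * Im w).
  by case: {+}w => x y /=; rewrite mul0r addr0 sub0r.
rewrite modCE ReE ImE ler_wsqrtr// /q sqrrN lerD2l !exprMn.
rewrite ler_pM2l ?exprn_gt0//.
by rewrite -(real_normK (num_real (Im w))) lerXn2r// nnegrE ltW.
Qed.

Definition posH v := maxe (kernelH v) 0%E.
Definition negH v := maxe (- kernelH v)%E 0%E.

Lemma posH_ge0 v : (0 <= posH v)%E.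
Proof. by rewrite /posH le_max lexx orbT. Qed.

Lemma negH_ge0 v : (0 <= negH v)%E.
Proof. by rewrite /negH le_max lexx orbT. Qed.

(** For k = -oo the right-hand side is +oo, so the inequality survives at the poles; x may be
    negative. In this form a bound can be integrated without subtracting infinite quantities. *)
Lemma maxe_le_add k x : (k <= x%:E -> maxe k 0 <= maxe (- k) 0 + x%:E)%E.
Proof.
case: k => [k|//|_].
  rewrite -EFinN -!EFin_max -EFinD !lee_fin.
  by rewrite /Num.max; do 2 case: ifPn; lra.
by rewrite [X in (_ <= X + _)%E]max_l/= ?leey// addye// leey.
Qed.

Lemma posH_le_add v x : (kernelH v <= x%:E -> posH v <= negH v + x%:E)%E.
Proof. exact: maxe_le_add. Qed.

Lemma posH_le_sqr v : (posH v <= (modC v ^+ 2 / 2)%:E)%E.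
Proof. by rewrite /posH ge_max kernelH_le_sqr lee_fin divr_ge0// sqr_ge0. Qed.

Lemma measurable_lneE : measurable_fun [set: R] (fun x : R => lne x%:E).
Proof.
rewrite /lne; apply: measurable_fun_ifT => //.
  exact: measurable_fun_ler.
by apply/measurable_EFinP; exact: measurable_ln.
Qed.

Lemma measurable_sqrt : measurable_fun [set: R] (@Num.sqrt R).
Proof. by apply: continuous_measurable_fun; exact: sqrt_continuous. Qed.

Lemma measurable_kernelH d (T : measurableType d) (f g : T -> R) :
  measurable_fun [set: T] f -> measurable_fun [set: T] g ->
  measurable_fun [set: T] (fun u => kernelH (f u +i* g u)%C).
Proof.
move=> mf mg; apply: emeasurable_funD; last exact/measurable_EFinP.
apply: (@measurableT_comp _ _ _ _ _ _ (fun x : R => lne x%:E)).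
  exact: measurable_lneE.
rewrite (_ : (fun u => _) =
  (fun u => Num.sqrt ((1 - f u) ^+ 2 + (0 - g u) ^+ 2))) //.
apply: measurableT_comp; first exact: measurable_sqrt.
by apply: measurable_funD; apply: measurable_funX; apply: measurable_funB.
Qed.

End Kernel.

(** * Borel sets of the complex plane *)

Section Borel.
Variable R : realType.
Implicit Types (x y t a b r : R) (z v w : R[i]).

Local Notation Re := (@complex.Re R).
Local Notation Im := (@complex.Im R).

Lemma normE_modC (z : R[i]^o) : `|z| = (modC z)%:C%C.
Proof. by []. Qed.

Lemma gt0_complexE (e : R[i]) : 0 < e -> exists2 d : R, 0 < d & e = (d%:C)%C.
Proof.
case: e => d f; rewrite ltcE/= => /andP[/eqP -> d0]; by exists d.
Qed.

Lemma open_modC (A : set R[i]^o) :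
  (forall z, A z -> exists2 d, 0 < d & forall w, modC (z - w) < d -> A w) ->
  open A.
Proof.
move=> h; rewrite openE => z Az; have [d d0 dA] := h z Az.
apply/nbhs_ballP; exists (d%:C)%C => /=; first by rewrite ltcE/= eqxx.
by move=> w; rewrite -ball_normE/= normE_modC ltcR; exact: dA.
Qed.

Lemma open_Lip_preimage (f : R[i] -> R) (O : set R) :
  (forall z w, `|f z - f w| <= modC (z - w)) -> open O ->
  open (f @^-1` O : set R[i]^o).
Proof.
move=> lf oO; apply: open_modC => z Oz.
have /nbhs_ballP[d d0 dO] : nbhs (f z) O by apply: open_nbhs_nbhs.
exists d => // w zw; apply: dO; rewrite -ball_normE/=.
exact: le_lt_trans zw.
Qed.

Lemma measurable_Lip (f : R[i] -> R) :
  (forall z w, `|f z - f w| <= modC (z - w)) ->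
  measurable_fun [set: borelC R] (f : borelC R -> R).
Proof.
move=> lf; apply: (measurability _ (RGenOpens.measurableE R)).
move=> _ [_ [a [b ->] <-]]; rewrite setTI.
apply: sub_sigma_algebra; apply: open_Lip_preimage => //.
Qed.

Lemma measurable_Re : measurable_fun [set: borelC R] (Re : borelC R -> R).
Proof.
apply: measurable_Lip => z w; rewrite (le_trans _ (Re_le_modC _))//.
by case: z; case: w.
Qed.

Lemma measurable_Im : measurable_fun [set: borelC R] (Im : borelC R -> R).
Proof.
apply: measurable_Lip => z w; rewrite (le_trans _ (Im_le_modC _))//.
by case: z; case: w.
Qed.

Lemma measurable_modC : measurable_fun [set: borelC R] (@modC R : borelC R -> R).
Proof.
apply: measurable_Lip => z w; rewrite ler_norml; apply/andP; split.
  have := modCD (w - z) z; rewrite subrK -(modCN (w - z)) opprB; lra.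
have := modCD (z - w) w; rewrite subrK; lra.
Qed.

Lemma measurable_invR : measurable_fun [set: R] (fun x : R => x^-1).
Proof.
have -> : (fun x : R => x^-1) = (fun x => if x == 0 then 0 else x^-1).
  by apply/funext => x; case: eqP => // ->; rewrite invr0.
apply: measurable_fun_if => //.
- exact: measurable_fun_eqr.
- apply: open_continuous_measurable_fun; last first.
    move=> x; rewrite inE/= => -[_ /negbT x0].
    by apply: inv_continuous.
  rewrite setTI (_ : _ @^-1` _ = ~` [set 0]).
    exact/closed_openC/closed_eq.
  by apply/seteqP; split=> x /=; [move=> /negbT/eqP|move/eqP/negbTE].
Qed.

Lemma measurable_Re_inv :
  measurable_fun [set: borelC R] (fun z : borelC R => Re (z : R[i])^-1 : R).
Proof.
rewrite (_ : (fun _ => _) = (fun z => Re z * (modC z ^+ 2)^-1)).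
  apply: measurable_funM; first exact: measurable_Re.
  apply: (measurableT_comp measurable_invR).
  by apply: measurable_funX; exact: measurable_modC.
by apply/funext => z; rewrite modC_sqr; case: z.
Qed.

Lemma measurable_Im_inv :
  measurable_fun [set: borelC R] (fun z : borelC R => Im (z : R[i])^-1 : R).
Proof.
rewrite (_ : (fun _ => _) = (fun z => (0 - Im z) * (modC z ^+ 2)^-1)).
  apply: measurable_funM; first by apply: measurable_funB => //; exact: measurable_Im.
  apply: (measurableT_comp measurable_invR).
  by apply: measurable_funX; exact: measurable_modC.
by apply/funext => z; rewrite modC_sqr; case: z => x y/=; rewrite sub0r mulNr.
Qed.

Lemma measurable_modC_set (P : set R) : measurable P ->
  measurable [set z : borelC R | P (modC z)].
Proof. by move=> mP; rewrite -[X in measurable X]setTI; exact: measurable_modC. Qed.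

Lemma measurable_disc r : measurable [set z : borelC R | modC z <= r].
Proof.
apply: (@measurable_modC_set [set x | x <= r]).
by rewrite -set_itvNyc; exact: measurable_itv.
Qed.

Lemma measurable_codisc r : measurable [set z : borelC R | r < modC z].
Proof.
apply: (@measurable_modC_set [set x | r < x]).
by rewrite -set_itvoy; exact: measurable_itv.
Qed.

Lemma measurable_modC_itvoc r x : measurable [set z : borelC R | r < modC z <= x].
Proof.
apply: (@measurable_modC_set [set y | r < y <= x]).
by rewrite -set_itvoc; exact: measurable_itv.
Qed.

Lemma compact_square r :
  compact [set z : R[i]^o | `|Re z| <= r /\ `|Im z| <= r].
Proof.
pose f (p : R * R) : R[i]^o := (p.1 +i* p.2)%C.
have -> : [set z : R[i]^o | `|Re z| <= r /\ `|Im z| <= r] =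
    f @` (`[- r, r] `*` `[- r, r]).
  apply/seteqP; split=> [[x y]/= [xr yr]|_ [[x y] /= [+ +] <-]].
    by exists (x, y) => //=; rewrite !in_itv/= -!ler_norml.
  by rewrite !in_itv/= -!ler_norml.
apply: continuous_compact; last by apply: compact_setX; exact: segment_compact.
apply: continuous_subspaceT => p; apply/cvgrPdist_lt => e /gt0_complexE[d d0 ->].
have d20 : 0 < d / 2 by rewrite divr_gt0.
apply/(@nbhs_ballP R (R * R)%type p); exists (d / 2) => //= q [q1 q2].
rewrite normE_modC ltcR (le_lt_trans (modC_le_ReIm _))//=.
rewrite [ltRHS](splitr d) ltrD//.
Qed.

Variable mu : {measure set (borelC R) -> \bar R}.
Hypothesis mu_lf : locally_finite mu.

(** Compactness of a square containing the disc: finitely many open sets of finite mass cover it. *)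
Lemma disc_mass_fin r : (disc_mass mu r < +oo)%E.
Proof.
have /choice[U Uz] := mu_lf.
have := @compact_square r; rewrite compact_cover.
move=> /(_ R[i]^o setT U)[z _|z _|D _ KD]; first by case: (Uz z).
  by exists z => //; case: (Uz z).
have mU z : measurable (U z : set (borelC R)).
  by apply: sub_sigma_algebra; case: (Uz z).
suff h : measurable (\big[setU/set0]_(z <- D) U z : set (borelC R)) /\
    (mu (\big[setU/set0]_(z <- D) U z) < +oo)%E.
  apply: le_lt_trans h.2; apply: le_measure; rewrite ?inE.
  - exact: measurable_disc.
  - exact: h.1.
  - move=> z /= zr; rewrite -bigcup_fset; apply: KD => /=.
    by split; rewrite (le_trans _ zr)// ?Re_le_modC ?Im_le_modC.
elim: (enum_fset D) => [|z s [ms fs]].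
  by rewrite big_nil measure0 ltry.
rewrite big_cons; split; first exact: measurableU.
have := @measureU2 _ _ _ mu _ _ (mU z) ms; move/le_lt_trans; apply.
by rewrite lte_add_pinfty//; case: (Uz z).
Qed.

Lemma sigma_finite_lf : sigma_finite [set: borelC R] mu.
Proof.
exists (fun n => [set z : borelC R | modC z <= n%:R]).
  apply/esym/seteqP; split=> // z _.
  exists (Num.bound (modC z)) => //=.
  by rewrite ltW// archi_boundP// modC_ge0.
move=> n; split; first exact: measurable_disc.
exact: disc_mass_fin.
Qed.

End Borel.

(** * Tonelli on rectangles and comparison of integrals *)

Section Tonelli.
Context d1 d2 (T1 : measurableType d1) (T2 : measurableType d2) (R : realType).
Variables (m1 : {sigma_finite_measure set T1 -> \bar R})
  (m2 : {sigma_finite_measure set T2 -> \bar R}).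
Variables (D1 : set T1) (D2 : set T2) (f : T1 * T2 -> \bar R).
Hypotheses (mD1 : measurable D1) (mD2 : measurable D2).
Hypothesis f0 : forall x, (0 <= f x)%E.
Hypothesis mf : measurable_fun setT f.

Let g := f \_ (D1 `*` D2).

Let mg : measurable_fun setT g.
Proof.
apply/(measurable_restrictT _ _).1; first exact: measurableX.
exact: measurable_funTS.
Qed.

Let g0 x : (0 <= g x)%E.
Proof. by rewrite /g /patch; case: ifP. Qed.

Lemma tonelli_setX :
  (\int[m1]_(x in D1) \int[m2]_(y in D2) f (x, y) =
   \int[m2]_(y in D2) \int[m1]_(x in D1) f (x, y))%E.
Proof.
have gg : (\int[m1]_x \int[m2]_y g (x, y) = \int[m2]_y \int[m1]_x g (x, y))%E.
  exact: fubini_tonelli.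
rewrite [LHS]integral_mkcond [RHS]integral_mkcond.
apply: (eq_trans _ (eq_trans gg _)).
- apply: eq_integral => x _; rewrite /patch/=; case: ifPn => xD.
    rewrite [LHS]integral_mkcond; apply: eq_integral => y _.
    by rewrite /g /patch in_setX xD.
  by apply/esym/integral0_eq => y _; rewrite /g /patch in_setX (negbTE xD).
- apply: eq_integral => y _; rewrite /patch/=; case: ifPn => yD.
    rewrite [RHS]integral_mkcond; apply: eq_integral => x _.
    by rewrite /g /patch in_setX yD andbT.
  by apply: integral0_eq => x _; rewrite /g /patch in_setX (negbTE yD) andbF.
Qed.

End Tonelli.

Section MeasurableSection.
Context d1 d2 (T1 : measurableType d1) (T2 : measurableType d2) (R : realType).
Variables (m2 : {sigma_finite_measure set T2 -> \bar R}).

Lemma measurable_fun_integral_section (D2 : set T2) (f : T1 * T2 -> \bar R) :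
  measurable D2 -> (forall x, (0 <= f x)%E) -> measurable_fun setT f ->
  measurable_fun setT (fun x => (\int[m2]_(y in D2) f (x, y))%E).
Proof.
move=> mD2 f0 mf.
have mg : measurable_fun setT (f \_ (setT `*` D2)).
  apply/(measurable_restrictT _ _).1; first exact: measurableX.
  exact: measurable_funTS.
have g0 x : (0 <= (f \_ (setT `*` D2)) x)%E by rewrite /patch; case: ifP.
have := @measurable_fun_fubini_tonelli_F _ _ _ _ _ m2 _ mg g0.
rewrite /fubini_F; congr measurable_fun; apply/funext => x.
rewrite [RHS]integral_mkcond; apply: eq_integral => y _.
by rewrite /patch in_setX in_setT.
Qed.

End MeasurableSection.

Section IntegralComparison.
Context d (T : measurableType d) (R : realType) (mu : {measure set T -> \bar R}).
Local Open Scope ereal_scope.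

(** Here f may change sign and the integral of N may be infinite. As the integral of f is a real
    number, its negative part has a finite integral; adding that to both sides leaves P + f^- <= N +
    f^+ between nonnegative functions. *)
Lemma ge0_integral_le_add (D : set T) (P N : T -> \bar R) (f : T -> R) (V : R) :
  measurable D ->
  (forall t, D t -> 0 <= P t) -> measurable_fun D P ->
  (forall t, D t -> 0 <= N t) -> measurable_fun D N ->
  measurable_fun D f ->
  (forall t, D t -> P t <= N t + (f t)%:E) ->
  \int[mu]_(t in D) (f t)%:E = V%:E ->
  \int[mu]_(t in D) P t <= \int[mu]_(t in D) N t + V%:E.
Proof.
move=> mD P0 mP N0 mN mf PN; have mfE : measurable_fun D (EFin \o f).
  exact/measurable_EFinP.
rewrite integralE => fV.
set fp := \int[mu]_(x in D) _ in fV; set fm := \int[mu]_(x in D) _ in fV.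
have fp0 : 0 <= fp by apply: integral_ge0.
have fm0 : 0 <= fm by apply: integral_ge0.
have fmfin : fm \is a fin_num.
  rewrite ge0_fin_numE// ltey; apply/eqP => fmy.
  by move: fV; rewrite fmy addeNy.
have fpE : fp = fm + V%:E by rewrite -fV addeC subeK.
rewrite -(leeD2rE _ _ fmfin).
rewrite [leRHS](_ : _ = \int[mu]_(t in D) N t + fp); last first.
  by rewrite fpE [X in _ = _ + X]addeC addeA.
have mfp : measurable_fun D (fun t => (EFin \o f)^\+ t) by exact: measurable_funepos.
have mfm : measurable_fun D (fun t => (EFin \o f)^\- t) by exact: measurable_funeneg.
rewrite -ge0_integralD//; [|by []..].
rewrite -ge0_integralD//.
apply: ge0_le_integral => //.
- by move=> t Dt; rewrite adde_ge0// P0.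
- exact: emeasurable_funD.
- exact: emeasurable_funD.
move=> t Dt; have := PN t Dt; rewrite funeposE funenegE/= -!EFin_max.
move=> /(@leeD2r _ (Num.max (- f t) 0)%R%:E)/le_trans; apply.
rewrite -addeA leeD2l// -EFinD lee_fin /Num.max.
by do 2 case: ifPn; lra.
Qed.

End IntegralComparison.

(** * The kernel inequality *)

Section KernelInequality.
Variable R : realType.
Implicit Types (x y t a b r : R) (z v w : R[i]).

Local Notation Re := (@complex.Re R).
Local Notation Im := (@complex.Im R).
Local Notation leb := (@lebesgue_measure R).

Lemma realM_complex t w : (t%:C)%C * w = (t * Re w +i* (t * Im w))%C.
Proof. by case: w => a b /=; apply/eqP; rewrite eq_complex/= !mul0r subr0 addr0 !eqxx. Qed.

Lemma Re_realM t w : Re ((t%:C)%C * w) = t * Re w.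
Proof. by rewrite realM_complex. Qed.

Lemma modC_realM t w : modC ((t%:C)%C * w) = `|t| * modC w.
Proof. by rewrite modCM modC_real. Qed.

Lemma combine_parts (P N P' N' : \bar R) (c X Y B : R) :
  (0 <= N)%E -> (0 <= N')%E -> 0 <= c ->
  (P <= N + X%:E)%E -> (P' <= N' + Y%:E)%E -> X + c * Y <= B ->
  (P + c%:E * P' <= N + c%:E * N' + B%:E)%E.
Proof.
move=> N0 N'0 c0 PX PY B_.
have h : (c%:E * P' <= c%:E * N' + (c * Y)%:E)%E.
  by rewrite EFinM -muleDr// ?lee_wpmul2l// ?lee_fin// fin_num_adde_defl.
apply: (le_trans (leeD PX h)).
rewrite addeACA -EFinD leeD2l// lee_fin//.
Qed.

(* For large w the real point e x, on the side opposite to Re z, compensates the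
   linear term of H(z w); for small w both kernels are quadratically small. *)
Lemma kernel_pointwise z w r x e : modC z = r -> 0 < r ->
  r / 2 <= x <= r -> e * `|Re z| = - Re z -> `|e| = 1 ->
  (posH (z * w)%R + (`|Re z| / x)%:E * posH ((e * x)%:C%C * w)%R <=
   negH (z * w)%R + (`|Re z| / x)%:E * negH ((e * x)%:C%C * w)%R
   + (24 * psi (r * Re w) + 7 * (r * `|Im w|))%:E)%E.
Proof.
move=> zr r0 xz ez e1.
have [xr1 xr2] : r / 2 <= x /\ x <= r by move/andP: xz.
have x0 : 0 < x by rewrite (lt_le_trans _ xr1)// divr_gt0.
have c0 : 0 <= `|Re z| / x by rewrite divr_ge0// ltW.
have pr : `|Re z| <= r by rewrite -zr Re_le_modC.
have qr : `|Im z| <= r by rewrite -zr Im_le_modC.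
have mx : modC ((e * x)%:C%C * w) = x * modC w.
  by rewrite modC_realM normrM e1 mul1r gtr0_norm.
have mz : modC (z * w) = r * modC w by rewrite modCM zr.
have W0 := modC_ge0 w; set W := modC w in W0 mx mz.
have Wsqr : W ^+ 2 = Re w ^+ 2 + Im w ^+ 2 by rewrite modC_sqr.
have Wle : W <= `|Re w| + `|Im w| by exact: modC_le_ReIm.
have WRe : `|Re w| <= W by exact: Re_le_modC.
have WIm : `|Im w| <= W by exact: Im_le_modC.
have b0 : 0 <= r * `|Im w| by rewrite mulr_ge0// ltW.
have a0 : 0 <= r * `|Re w| by rewrite mulr_ge0// ltW.
have psiE : psi (r * `|Re w|) = psi (r * Re w).
  by rewrite -[RHS]psi_abs normrM (gtr0_norm r0).
rewrite -psiE; set A := r * `|Re w| in a0 psiE *; set B := r * `|Im w| in b0 *.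
have rWle : r * W <= A + B by rewrite /A /B -mulrDr ler_pM2l.
have AW : A <= r * W by rewrite /A ler_pM2l.
have BW : B <= r * W by rewrite /B ler_pM2l.
have c2 : `|Re z| / x <= 2.
  by rewrite ler_pdivrMr//; lra.
have nA : `|A| = A by rewrite ger0_norm.
have := @psi_ge_sqr _ A; have := @psi_ge_ln _ A; have := psi_ge0 A.
rewrite nA; set psA := psi A => ps0 ps_ln ps_sqr.
(* For r |w| <= 1 the two quadratic bounds add up to at most A^2 + B^2, where A^2 <= 4 psi A and B^2
   <= B. *)
have [rW1|rW1] := leP (r * W) 1.
  apply: combine_parts (posH_le_add (kernelH_le_sqr _)) (posH_le_add (kernelH_le_sqr _)) _;
    rewrite ?negH_ge0//.
  rewrite mx mz.
  have -> : (r * W) ^+ 2 = A ^+ 2 + B ^+ 2.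
    by rewrite exprMn Wsqr mulrDr /A /B !exprMn !real_normK ?num_real.
  have h2 : `|Re z| / x * ((x * W) ^+ 2 / 2) <= (A ^+ 2 + B ^+ 2) / 2.
    have -> : `|Re z| / x * ((x * W) ^+ 2 / 2) = (`|Re z| * x) * W ^+ 2 / 2.
      by field; rewrite gt_eqF.
    have -> : A ^+ 2 + B ^+ 2 = (r * r) * W ^+ 2.
      by rewrite Wsqr mulrDr /A /B !exprMn !real_normK ?num_real// expr2.
    rewrite ler_pM2r ?invr_gt0// ler_wpM2r ?sqr_ge0// ler_pM// ltW//.
  have A1 : A <= 1 by exact: le_trans rW1.
  have B1 : B <= 1 by exact: le_trans rW1.
  have : B ^+ 2 <= B by nra.
  have := ps_sqr A1; lra.
apply: combine_parts (posH_le_add (kernelH_le_ln _)) (posH_le_add (kernelH_le_ln _)) _;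
  rewrite ?negH_ge0//.
rewrite mx mz Re_realM complex_ReM.
(* The weight |Re z| / x makes the real part of the compensating kernel equal to - Re z Re w. *)
have -> : `|Re z| / x * (ln (1 + x * W) + e * x * Re w) =
    `|Re z| / x * ln (1 + x * W) - Re z * Re w.
  transitivity (`|Re z| / x * ln (1 + x * W) + (e * `|Re z|) * Re w).
    by field; rewrite gt_eqF.
  by rewrite ez mulNr.
have lnx : ln (1 + x * W) <= ln (1 + r * W).
  have := mulr_ge0 (ltW x0) W0.
  by move=> ?; apply: ln_mono; [lra|rewrite lerD2l ler_wpM2r].
have lnx0 : 0 <= ln (1 + x * W) by rewrite ln_ge0// lerDl mulr_ge0// ltW.
have lnr : ln (1 + r * W) <= ln (1 + A) + B.
  apply: le_trans (ln1D_add a0 b0); apply: ln_mono; first by lra.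
  by rewrite -addrA lerD2l.
have h1 : `|Re z| / x * ln (1 + x * W) <= 2 * ln (1 + r * W).
  by rewrite ler_pM.
have h2 : - (Im z * Im w) <= B.
  rewrite (le_trans (ler_norm _))// normrN normrM /B.
  by rewrite ler_wpM2r.
(* Three logarithms remain, one from H(z w) and two from |Re z| / x <= 2, each at most ln (1 + A) +
   B; with [h2] the total is 3 ln (1 + A) + 4 B. Hence 24 = 3 * 8 and 7 = 3 + 4. When A < 1/2, the
   assumption r |w| > 1 forces B > 1/2, which exceeds ln (1 + A). *)
have h3 : ln (1 + A) <= 8 * psA + B; last lra.
have [A1|A1] := leP 1 A; first by have := ps_ln A1; lra.
have lnA := @le_ln1Dx _ A ltac:(lra).
have [A2|A2] := leP (1 / 2) A; last by lra.
by have := ps_sqr (ltW A1); nra.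
Qed.

End KernelInequality.

Section KernelInequality.
Variable R : realType.
Implicit Types (x y t a b r : R) (z v w : R[i]).

Local Notation Re := (@complex.Re R).
Local Notation Im := (@complex.Im R).
Local Notation leb := (@lebesgue_measure R).

Lemma measurable_posH_line (w : R[i]) (e : R) :
  measurable_fun [set: R] (fun t : R => posH ((e * t)%:C%C * w)%R).
Proof.
rewrite (_ : (fun _ => _) = (fun t : R => maxe (kernelH ((e * t * Re w)%R +i* (e * t * Im w)%R)%C) 0%E)).
  apply: measurable_maxe => //; apply: measurable_kernelH.
    by apply: measurable_funM => //; apply: measurable_funM.
  by apply: measurable_funM => //; apply: measurable_funM.
by apply/funext => t; rewrite /posH realM_complex.
Qed.

Lemma measurable_negH_line (w : R[i]) (e : R) :
  measurable_fun [set: R] (fun t : R => negH ((e * t)%:C%C * w)%R).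
Proof.
rewrite (_ : (fun _ => _) = (fun t : R => maxe (- kernelH ((e * t * Re w)%R +i* (e * t * Im w)%R)%C)%E 0%E)).
  apply: measurable_maxe => //; apply: measurableT_comp => //; apply: measurable_kernelH.
    by apply: measurable_funM => //; apply: measurable_funM.
  by apply: measurable_funM => //; apply: measurable_funM.
by apply/funext => t; rewrite /negH realM_complex.
Qed.

(** For h = H the linear terms at t w and - t w cancel. Writing [1 * t] and [-1 * t] makes both
    points instances of the line c t on which measurability is proved. *)
Definition symH (h : R[i] -> \bar R) (w : R[i]) (t : R) : \bar R :=
  (h ((1 * t)%:C%C * w)%R + h ((-1 * t)%:C%C * w)%R)%E.

Lemma measurable_symH (h : R[i] -> \bar R) w :
  (forall e, measurable_fun [set: R] (fun t : R => h ((e * t)%:C%C * w)%R)) ->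
  measurable_fun [set: R] (symH h w).
Proof. by move=> mh; apply: emeasurable_funD; exact: mh. Qed.

Lemma measurable_invsqr : measurable_fun [set: R] (fun t : R => t ^- 2).
Proof.
by apply: (measurableT_comp (@measurable_invR R)); exact: measurable_funX.
Qed.

(** [Hprim_sym_bound] at both end points: the primitive is -psi (t Re w) / t up to 6 b at each,
    hence 12 |Im w| as b decreases to |Im w|. The psi term at y is the gain that will absorb the
    logarithm of H(z w); the one at x is an error. *)
Lemma kernel_integral w x y : 0 < x -> x < y ->
  (\int[leb]_(t in `[x, y]) ((t ^- 2)%:E * symH (@posH R) w t)
    + (y^-1 * psi (y * Re w))%:E
   <= \int[leb]_(t in `[x, y]) ((t ^- 2)%:E * symH (@negH R) w t)
    + (x^-1 * psi (x * Re w) + 12 * `|Im w|)%:E)%E.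
Proof.
move=> x0 xy; apply/lee_addgt0Pr => e e0.
(* Replacing |Im w| by b > 0 increases the kernel and removes its singularity. *)
pose b := `|Im w| + e / 12.
have b0 : 0 < b by rewrite /b ltr_wpDl// divr_gt0.
pose f t := t ^- 2 * Hre (Re w) b t + t ^- 2 * Hre (- Re w) b t.
pose S t := Hprim (Re w) b t + Hprim (- Re w) b t.
have If : (\int[leb]_(t in `[x, y]) (f t)%:E = (S y - S x)%:E)%E.
  apply: is_derive_integral => // t /andP[xt _].
    have t0 := lt_le_trans x0 xt.
    by apply: (@is_deriveD _ _ _ (Hprim _ _) (Hprim _ _)); exact: is_derive_Hprim.
  have t0 := lt_le_trans x0 xt.
  by apply: (@derivableD _ _ _ (fun t : R => t ^- 2 * Hre (Re w) b t)
    (fun t : R => t ^- 2 * Hre (- Re w) b t)); exact: derivable_Hre.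
have mH a : measurable_fun [set: R] (fun t => t ^- 2 * Hre a b t).
  apply: measurable_funM; first exact: measurable_invsqr.
  apply: measurable_funD; last exact: measurable_funM.
  apply: measurable_funM => //.
  apply: (measurableT_comp (@measurable_ln R)).
  by apply: measurable_funD; apply: measurable_funX;
    [apply: measurable_funB => //|]; exact: measurable_funM.
have key : (\int[leb]_(t in `[x, y]) ((t ^- 2)%:E * symH (@posH R) w t) <=
    \int[leb]_(t in `[x, y]) ((t ^- 2)%:E * symH (@negH R) w t) + (S y - S x)%:E)%E.
  apply: (@ge0_integral_le_add _ _ R lebesgue_measure `[x, y]%classic _ _ f (S y - S x)) => //.
  - move=> t _; rewrite mule_ge0// ?lee_fin ?invr_ge0 ?sqr_ge0// adde_ge0// posH_ge0//.
  - apply: measurable_funTS; apply: emeasurable_funM.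
      by apply/measurable_EFinP; exact: measurable_invsqr.
    by apply: measurable_symH => ?; exact: measurable_posH_line.
  - move=> t _; rewrite mule_ge0// ?lee_fin ?invr_ge0 ?sqr_ge0// adde_ge0// negH_ge0//.
  - apply: measurable_funTS; apply: emeasurable_funM.
      by apply/measurable_EFinP; exact: measurable_invsqr.
    by apply: measurable_symH => ?; exact: measurable_negH_line.
  - by apply: measurable_funTS; apply: measurable_funD; exact: mH.
  - move=> t /=; rewrite in_itv/= => /andP[xt _].
    have t0 := lt_le_trans x0 xt.
    have wb : `|Im w| <= b by rewrite lerDl ltW// divr_gt0.
    rewrite /f -mulrDr EFinM -muleDr//; last by rewrite fin_num_adde_defl.
    rewrite lee_wpmul2l// ?lee_fin ?invr_ge0 ?sqr_ge0//.
    rewrite /symH EFinD addeACA mul1r mulN1r; apply: leeD; apply: posH_le_add.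
      exact: kernelH_le_Hre.
    have -> : ((- t)%:C)%C * w = (t%:C)%C * - w.
      by rewrite mulrN -mulNr rmorphN.
    have := @kernelH_le_Hre _ t (- w) b t0 b0.
    have -> : Re (- w) = - Re w by case: (w).
    have -> : Im (- w) = - Im w by case: (w).
    by rewrite normrN; exact.
move: key; set IP := integral _ _ _; set IN := integral _ _ _.
move: IP IN => IP IN key.
apply: le_trans (leeD2r _ key) _.
rewrite -addeA -EFinD -addeA leeD2l// lee_fin.
have y0 := lt_trans x0 xy.
have := Hprim_sym_bound (Re w) y0 b0; have := Hprim_sym_bound (Re w) x0 b0.
rewrite -/(S x) -/(S y) !ler_norml => /andP[? ?] /andP[? ?].
have bE : 12 * b = 12 * `|Im w| + e by rewrite /b; field.
by lra.
Qed.

End KernelInequality.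

(** * The kernel inequality with the measure nu *)

Section WeightedKernel.
Variables (R : realType) (z : R[i]) (r eta e : R).

Local Notation Re := (@complex.Re R).
Local Notation Im := (@complex.Im R).
Local Notation leb := (@lebesgue_measure R).
Local Notation I := (`[eta, r]%classic : set R).

Hypotheses (zr : modC z = r) (r0 : 0 < r) (eta0 : 0 < eta) (eta_r : eta < r / 2).
Hypotheses (ez : e * `|Re z| = - Re z) (e1 : `|e| = 1).

(* Used for t <= r only, where it is the uniform density on [r/2, r]. *)
Definition half_density (t : R) : R := 2 / r * \1_(`[r / 2, +oo[%classic) t.

Lemma half_density_ge0 t : 0 <= half_density t.
Proof. by rewrite mulr_ge0// divr_ge0// ltW. Qed.

Lemma half_density_le t : 0 < t -> half_density t <= 2 / r.
Proof.
move=> t0; rewrite /half_density indicE.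
by case: (_ \in _); rewrite ?mulr1// mulr0 divr_ge0// ltW.
Qed.

Lemma measurable_half_density : measurable_fun [set: R] half_density.
Proof. by apply: measurable_funM => //; exact: measurable_indic. Qed.

Lemma integral_half_density : (\int[leb]_(t in I) (half_density t)%:E = 1)%E.
Proof.
under eq_integral do rewrite EFinM.
rewrite ge0_integralZl_EFin//; last 2 first.
- by apply: measurable_funTS; apply/measurable_EFinP; exact: measurable_indic.
- by rewrite divr_ge0// ltW.
rewrite integral_indic//.
have -> : `[r / 2, +oo[ `&` I = `[r / 2, r]%classic.
  apply/seteqP; split=> t /=; rewrite !in_itv/= ?andbT.
    by move=> [-> /andP[]].
  by move=> /andP[rt tr]; rewrite rt tr (le_trans (ltW eta_r) rt).
rewrite /= lebesgue_measure_itv/= lte_fin ifT; last by rewrite ltr_pdivrMr// ltr_pMr// ltr1n.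
by rewrite -EFinD -EFinM; congr EFin; field; rewrite gt_eqF.
Qed.

(** The integrand of h (x w) against nu, folded onto t = |x|: density 24 r / t^2 at both signs, and
    a one-sided part at e t, where e is the sign opposite to Re z. The factor |Re z| / t is the
    weight of [kernel_pointwise]. *)
Definition weighted (h : R[i] -> \bar R) (w : R[i]) (t : R) : \bar R :=
  ((24 * r * t ^- 2)%:E * symH h w t +
   (`|Re z| * t^-1 * half_density t)%:E * h ((e * t)%:C%C * w)%R)%E.

Section Parts.
Variable h : R[i] -> \bar R.
Hypothesis h0 : forall v, (0 <= h v)%E.
Hypothesis mh : forall w c, measurable_fun [set: R] (fun t : R => h ((c * t)%:C%C * w)%R).

Lemma symH_ge0 w t : (0 <= symH h w t)%E.
Proof. by rewrite adde_ge0. Qed.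

Lemma measurable_weighted1 w :
  measurable_fun [set: R] (fun t : R => ((24 * r * t ^- 2)%:E * symH h w t)%E).
Proof.
apply: emeasurable_funM; last by apply: measurable_symH => c; exact: mh.
by apply/measurable_EFinP; apply: measurable_funM => //; exact: measurable_invsqr.
Qed.

Lemma measurable_weighted2 w : measurable_fun [set: R]
  (fun t : R => ((`|Re z| * t^-1 * half_density t)%:E * h ((e * t)%:C%C * w)%R)%E).
Proof.
apply: emeasurable_funM; last exact: mh.
apply/measurable_EFinP; apply: measurable_funM; last exact: measurable_half_density.
by apply: measurable_funM => //; exact: measurable_invR.
Qed.

Lemma weighted1_ge0 w t : (0 <= (24 * r * t ^- 2)%:E * symH h w t)%E.
Proof.
by rewrite mule_ge0 ?symH_ge0// lee_fin !mulr_ge0// ?invr_ge0 ?sqr_ge0// ltW.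
Qed.

Lemma weighted2_ge0 w t : I t ->
  (0 <= (`|Re z| * t^-1 * half_density t)%:E * h ((e * t)%:C%C * w)%R)%E.
Proof.
rewrite /= in_itv/= => /andP[te _].
apply: mule_ge0 => //; rewrite lee_fin.
apply: mulr_ge0; last exact: half_density_ge0.
apply: mulr_ge0 => //; rewrite invr_ge0; exact: le_trans (ltW eta0) te.
Qed.

Lemma weighted_ge0 w t : I t -> (0 <= weighted h w t)%E.
Proof. by move=> It; rewrite adde_ge0 ?weighted1_ge0 ?weighted2_ge0. Qed.

Lemma integral_weighted w :
  (\int[leb]_(t in I) weighted h w t =
   (24 * r)%:E * (\int[leb]_(t in I) ((t ^- 2)%:E * symH h w t)) +
   \int[leb]_(t in I) ((`|Re z| * t^-1 * half_density t)%:E * h ((e * t)%:C%C * w)%R))%E.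
Proof.
rewrite ge0_integralD//; last 4 first.
- by move=> t _; exact: weighted1_ge0.
- by apply: measurable_funTS; exact: measurable_weighted1.
- by move=> t; exact: weighted2_ge0.
- by apply: measurable_funTS; exact: measurable_weighted2.
congr (_ + _)%E; rewrite -ge0_integralZl_EFin//.
- by apply: eq_integral => t _; rewrite EFinM muleA.
- by move=> t _; rewrite mule_ge0 ?symH_ge0// lee_fin invr_ge0 sqr_ge0.
- apply: measurable_funTS; apply: emeasurable_funM; last by apply: measurable_symH => c; exact: mh.
  by apply/measurable_EFinP; exact: measurable_invsqr.
- by rewrite mulr_ge0// ltW.
Qed.

Lemma integral_half_density_cst (k : \bar R) : (0 <= k)%E ->
  (\int[leb]_(t in I) ((half_density t)%:E * k) = k)%E.
Proof.
move=> k0; rewrite ge0_integralZr ?integral_half_density ?mul1e//.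
- by apply/measurable_funTS/measurable_EFinP; exact: measurable_half_density.
- by move=> t _; rewrite lee_fin half_density_ge0.
Qed.

End Parts.

(** [kernel_pointwise] averaged over the uniform probability on [r/2, r]. Averaging replaces the
    single compensating point by a measure with bounded density. *)
Lemma kernel_average w :
  (posH (z * w)%R + \int[leb]_(t in I)
      ((`|Re z| * t^-1 * half_density t)%:E * posH ((e * t)%:C%C * w)%R)
   <= negH (z * w)%R + \int[leb]_(t in I)
      ((`|Re z| * t^-1 * half_density t)%:E * negH ((e * t)%:C%C * w)%R)
   + (24 * psi (r * Re w) + 7 * (r * `|Im w|))%:E)%E.
Proof.
set B := 24 * _ + _.
have B0 : 0 <= B.
  by rewrite addr_ge0// mulr_ge0// ?psi_ge0// mulr_ge0// ltW.
have md : measurable_fun I (EFin \o half_density).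
  by apply/measurable_funTS/measurable_EFinP; exact: measurable_half_density.
have mk (k : \bar R) : measurable_fun I (fun t => ((half_density t)%:E * k)%E).
  exact: emeasurable_funM.
have mp : measurable_fun I (fun t : R =>
    ((`|Re z| * t^-1 * half_density t)%:E * posH ((e * t)%:C%C * w)%R)%E).
  apply: measurable_funTS; apply: measurable_weighted2 => ? ?.
  exact: measurable_posH_line.
have mn : measurable_fun I (fun t : R =>
    ((`|Re z| * t^-1 * half_density t)%:E * negH ((e * t)%:C%C * w)%R)%E).
  apply: measurable_funTS; apply: measurable_weighted2 => ? ?.
  exact: measurable_negH_line.
have d0 t k : (0 <= k -> 0 <= (half_density t)%:E * k)%E.
  by move=> k0; rewrite mule_ge0// lee_fin half_density_ge0.
(* Terms independent of t are written as averages, so that the inequality can be checked under one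
   integral sign. *)
rewrite -[X in (X + _ <= _)%E]integral_half_density_cst ?posH_ge0//.
rewrite -[X in (_ <= X + _ + _)%E]integral_half_density_cst ?negH_ge0//.
rewrite -[X in (_ <= _ + X)%E]integral_half_density_cst ?lee_fin//.
have p0 t : I t -> (0 <= (`|Re z| * t^-1 * half_density t)%:E *
    posH ((e * t)%:C%C * w)%R)%E.
  by apply: weighted2_ge0; exact: posH_ge0.
have n0 t : I t -> (0 <= (`|Re z| * t^-1 * half_density t)%:E *
    negH ((e * t)%:C%C * w)%R)%E.
  by apply: weighted2_ge0; exact: negH_ge0.
have mI : measurable (I : set (measurableTypeR R)) by [].
have dp t : I t -> (0 <= (half_density t)%:E * posH (z * w)%R)%E.
  by move=> _; rewrite d0 ?posH_ge0.
have dn t : I t -> (0 <= (half_density t)%:E * negH (z * w)%R)%E.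
  by move=> _; rewrite d0 ?negH_ge0.
have dB t : I t -> (0 <= (half_density t)%:E * B%:E)%E.
  by move=> _; rewrite d0 ?lee_fin.
rewrite -(ge0_integralD leb mI dp (mk _) p0 mp) -(ge0_integralD leb mI dn (mk _) n0 mn).
rewrite -(ge0_integralD leb mI _ (emeasurable_funD (mk _) mn) dB (mk _)); last first.
  by move=> t It; apply: adde_ge0; [exact: dn|exact: n0].
apply: ge0_le_integral => //.
- by move=> t It; apply: adde_ge0; [exact: dp|exact: p0].
- exact: emeasurable_funD (mk _) mp.
- exact: emeasurable_funD (emeasurable_funD (mk _) mn) (mk _).
move=> t; rewrite /= in_itv/= => /andP[te tr].
have t0 := lt_le_trans eta0 te.
rewrite /half_density indicE; case: (boolP (t \in _)); last first.
  by move=> _; rewrite /= !mulr0 !mul0e !adde0.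
rewrite inE/= in_itv/= andbT => rt; rewrite mulr1.
have rt2 : r / 2 <= t <= r by rewrite rt.
have := kernel_pointwise w zr r0 rt2 ez e1; rewrite -/B.
have r20 : 0 <= 2 / r by rewrite divr_ge0// ltW.
move=> /(@lee_wpmul2l _ (2 / r)%:E); rewrite lee_fin => /(_ r20).
have c0 : 0 <= `|Re z| / t by rewrite divr_ge0// ltW.
have q0 : (0 <= (`|Re z| / t)%:E * posH ((e * t)%:C%C * w)%R)%E.
  by rewrite mule_ge0 ?posH_ge0.
have q1 : (0 <= (`|Re z| / t)%:E * negH ((e * t)%:C%C * w)%R)%E.
  by rewrite mule_ge0 ?negH_ge0.
rewrite !ge0_muleDr ?posH_ge0 ?negH_ge0// ?adde_ge0 ?negH_ge0//.
by rewrite ![(`|Re z| / t * _)]mulrC !EFinM !muleA.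
Qed.

(** [kernel_average] plus 24 r times [kernel_integral] over [eta, r]. The gain 24 psi (r Re w) of
    the latter cancels the same term of the former, and r |Im w| receives 7 + 24 * 12 = 295. *)
Lemma kernel_weighted w :
  (posH (z * w)%R + \int[leb]_(t in I) weighted (@posH R) w t
   <= negH (z * w)%R + \int[leb]_(t in I) weighted (@negH R) w t
   + (295 * (r * `|Im w|) + 24 * (r / eta) * psi (eta * Re w))%:E)%E.
Proof.
rewrite !integral_weighted; [|by move=> *; exact: negH_ge0|
  by move=> *; exact: measurable_negH_line|by move=> *; exact: posH_ge0|
  by move=> *; exact: measurable_posH_line].
have eta_r' : eta < r by rewrite (lt_trans eta_r)// ltr_pdivrMr// ltr_pMr// ltr1n.
have := kernel_integral w eta0 eta_r'.
have := kernel_average w.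
set A1 := integral _ _ _; set A2 := integral _ _ _.
set B1 := integral _ _ _; set B2 := integral _ _ _.
have B10 : (0 <= B1)%E.
  apply: integral_ge0 => t _; rewrite mule_ge0// ?symH_ge0// ?lee_fin ?invr_ge0 ?sqr_ge0//.
  by move=> v; exact: posH_ge0.
have B20 : (0 <= B2)%E.
  apply: integral_ge0 => t _; rewrite mule_ge0// ?symH_ge0// ?lee_fin ?invr_ge0 ?sqr_ge0//.
  by move=> v; exact: negH_ge0.
move: A1 A2 B1 B2 B10 B20 => A1 A2 B1 B2 B10 B20 hA hB.
have r240 : (0 <= (24 * r)%:E)%E by rewrite lee_fin mulr_ge0// ltW.
have := lee_wpmul2l r240 hB.
rewrite !muleDr//; try by rewrite fin_num_adde_defl.
rewrite -!EFinM => hB'.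
have := leeD hA hB'.
set P := posH _; set N := negH _.
set a := 24 * r * _; set b := 24 * r * _; set c := 24 * psi _ + _.
have bE : b = 24 * (r / eta) * psi (eta * Re w) + 288 * (r * `|Im w|).
  by rewrite /b; field; rewrite gt_eqF.
have aE : a = 24 * psi (r * Re w) by rewrite /a; field; rewrite gt_eqF.
have cE : c = a + 7 * (r * `|Im w|) by rewrite aE.
move: a b c aE bE cE => a b c _ bE cE.
move: ((24 * r)%:E * B1)%E ((24 * r)%:E * B2)%E => X1 X2.
have -> : (P + A1 + (X1 + a%:E) = (P + (X1 + A1)) + a%:E)%E.
  by rewrite addeA -(addeA P) (addeC A1).
have -> : (N + A2 + c%:E + (X2 + b%:E) = (N + (X2 + A2)) + (c + b)%:E)%E.
  by rewrite addeACA -(addeA N) (addeC A2) EFinD.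
move=> h; rewrite -(@leeD2rE _ a%:E)//; apply: (le_trans h).
rewrite -[X in (_ <= X)%E]addeA leeD2l// -EFinD lee_fin bE cE.
by lra.
Qed.

End WeightedKernel.

(** * Integration against the measure *)

Section TruncatedPotential.
Variable R : realType.
Local Notation Re := (@complex.Re R).
Local Notation Im := (@complex.Im R).
Local Notation leb := (@lebesgue_measure R).

(** Measurability is phrased through the two coordinates, so that one property serves both on the
    plane and on the product of the line with the plane. *)
Definition comp_measurable (h : R[i] -> \bar R) :=
  forall d (T : measurableType d) (f g : T -> R),
  measurable_fun [set: T] f -> measurable_fun [set: T] g ->
  measurable_fun [set: T] (fun u => h (f u +i* g u)%C).

Lemma comp_measurable_posH : comp_measurable (@posH R).
Proof. by move=> *; apply: measurable_maxe => //; exact: measurable_kernelH. Qed.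

Lemma comp_measurable_negH : comp_measurable (@negH R).
Proof.
move=> *; apply: measurable_maxe => //; apply: measurableT_comp => //.
exact: measurable_kernelH.
Qed.

Lemma mulC_complexE (z w : R[i]) :
  z * w = ((Re z * Re w - Im z * Im w) +i* (Re z * Im w + Im z * Re w))%C.
Proof. by case: z => ? ?; case: w. Qed.

Lemma measurable_kernel_mul h (z : R[i]) : comp_measurable h ->
  measurable_fun [set: borelC R] (fun w : borelC R => h (z / (w : R[i]))).
Proof.
move=> mh; under eq_fun do rewrite mulC_complexE.
apply: mh; [apply: measurable_funB|apply: measurable_funD];
  apply: measurable_funM => //; first [exact: measurable_Re_inv|exact: measurable_Im_inv].
Qed.

Lemma measurable_kernel_pair h (c : R) : comp_measurable h ->
  measurable_fun [set: measurableTypeR R * borelC R]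
    (fun p : measurableTypeR R * borelC R => h ((c * p.1)%:C%C / (p.2 : R[i]))).
Proof.
move=> mh; under eq_fun do rewrite realM_complex.
have m1 : measurable_fun [set: measurableTypeR R * borelC R]
    (fun p : measurableTypeR R * borelC R => c * p.1 : R).
  by apply: measurable_funM => //; exact: measurable_fst.
apply: mh; apply: measurable_funM => //.
  exact: (measurableT_comp (@measurable_Re_inv R) measurable_snd).
exact: (measurableT_comp (@measurable_Im_inv R) measurable_snd).
Qed.

Variable mu : {sigma_finite_measure set (borelC R) -> \bar R}.
Hypothesis mu_lf : locally_finite mu.
Hypothesis mu_tail : (\int[mu]_(z in [set z : borelC R | (1 <= modC z)%R])
          (modC z ^- 2)%R%:E < +oo)%E.

Local Notation D eps := ([set w : borelC R | (eps < modC w)%R]).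

Lemma measurable_modC_invsqr :
  measurable_fun [set: borelC R] (fun w : borelC R => (modC w ^- 2)%:E : \bar R).
Proof.
apply/measurable_EFinP; apply: (measurableT_comp (@measurable_invR R)).
by apply: measurable_funX; exact: measurable_modC.
Qed.

Lemma modC_invsqr_ge0 (w : R[i]) : (0 <= (modC w ^- 2)%:E :> \bar R)%E.
Proof. by rewrite lee_fin invr_ge0 sqr_ge0. Qed.

Definition sqmass (eps : R) : \bar R := (\int[mu]_(w in D eps) (modC w ^- 2)%:E)%E.

Lemma sqmass_ge0 eps : (0 <= sqmass eps)%E.
Proof. by apply: integral_ge0 => w _; exact: modC_invsqr_ge0. Qed.

(** The tail hypothesis covers |zeta| >= 1; on eps < |zeta| <= 1 the integrand is at most eps^(-2)
    and the mass is finite. *)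
Lemma sqmass_fin eps : 0 < eps -> (sqmass eps < +oo)%E.
Proof.
move=> e0; pose A := [set z : borelC R | 1 <= modC z].
have mA : measurable A.
  apply: (@measurable_modC_set _ [set x | 1 <= x]).
  by rewrite -set_itvcy; exact: measurable_itv.
pose B := [set w : borelC R | eps < modC w <= 1].
have mB : measurable B by exact: measurable_modC_itvoc.
have sub : D eps `<=` A `|` B.
  move=> w /= ew; have [w1|/ltW w1] := leP 1 (modC w); [by left|right].
  by rewrite /B/= ew.
have mm := measurable_modC_invsqr.
apply: (@le_lt_trans _ _ (\int[mu]_(w in A `|` B) (modC w ^- 2)%:E)%E).
  apply: ge0_subset_integral => //; first exact: measurable_codisc.
  - exact: measurableU.
  - exact: measurable_funTS.
  - by move=> w _; exact: modC_invsqr_ge0.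
have := @ge0_integral_setU _ _ _ mu A (B `\` A) mA (measurableD mB mA)
  (fun w => (modC w ^- 2)%:E) (measurable_funTS mm)
  (fun w _ => modC_invsqr_ge0 w).
rewrite setDE setUIr setUv setIT => ->; last first.
  by apply/disj_setPS => w [? []].
rewrite lte_add_pinfty//.
apply: (@le_lt_trans _ _ (\int[mu]_(w in B) (cst (eps ^- 2)%:E) w)%E).
  apply: (@le_trans _ _ (\int[mu]_(w in B) (modC w ^- 2)%:E)%E).
    apply: ge0_subset_integral => //.
    - by rewrite -setDE; exact: measurableD.
    - exact: measurable_funTS.
    - by move=> w _; exact: modC_invsqr_ge0.
  apply: ge0_le_integral => //.
  - by move=> w _; exact: modC_invsqr_ge0.
  - exact: measurable_funTS.
  - move=> w /= /andP[ew _]; rewrite lee_fin lef_pV2 ?posrE ?exprn_gt0// ?(lt_trans e0)//.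
    by rewrite lerXn2r ?nnegrE ?modC_ge0// ltW.
rewrite integral_cst// lte_mul_pinfty ?lee_fin ?invr_ge0 ?sqr_ge0//.
apply: le_lt_trans (disc_mass_fin mu_lf 1).
apply: le_measure; rewrite ?inE//; first exact: measurable_disc.
by move=> w /= /andP[].
Qed.

Definition partial (h : R[i] -> \bar R) (eps : R) (z : R[i]) : \bar R :=
  (\int[mu]_(w in D eps) h (z / (w : R[i]))%R)%E.

Definition truncated (eps : R) (z : R[i]) : \bar R := partial (@kernelH R) eps z.

Lemma partial_ge0 h eps z : (forall v, (0 <= h v)%E) -> (0 <= partial h eps z)%E.
Proof. by move=> h0; apply: integral_ge0. Qed.

Lemma truncatedE eps z :
  truncated eps z = (partial (@posH R) eps z - partial (@negH R) eps z)%E.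
Proof.
rewrite /truncated /partial integralE; congr (_ - _)%E.
  by apply: eq_integral => w _; rewrite funeposE.
by apply: eq_integral => w _; rewrite funenegE.
Qed.

Lemma partial_posH_le eps z : 0 < eps ->
  (partial (@posH R) eps z <= (modC z ^+ 2 / 2)%:E * sqmass eps)%E.
Proof.
move=> e0; rewrite /partial /sqmass -ge0_integralZl_EFin//; last 4 first.
- exact: measurable_codisc.
- by move=> w _; exact: modC_invsqr_ge0.
- by apply: measurable_funTS; exact: measurable_modC_invsqr.
- by rewrite divr_ge0// sqr_ge0.
apply: ge0_le_integral => //.
- exact: measurable_codisc.
- by move=> w _; exact: posH_ge0.
- apply: measurable_funTS; apply: measurable_kernel_mul; exact: comp_measurable_posH.
- apply: measurable_funTS; apply: emeasurable_funM => //.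
  exact: measurable_modC_invsqr.
- move=> w _; apply: (le_trans (posH_le_sqr _)).
  by rewrite -EFinM lee_fin modCM modCV exprMn exprVn mulrAC.
Qed.

Lemma partial_posH_fin eps z : 0 < eps -> (partial (@posH R) eps z < +oo)%E.
Proof.
move=> e0; apply: (le_lt_trans (partial_posH_le z e0)).
by rewrite lte_mul_pinfty ?lee_fin ?divr_ge0 ?sqr_ge0// sqmass_fin.
Qed.

(** Let P and N be the integrals of the positive and negative parts. As P is finite, u_eps = P - N
    gives N <= P + u_eps^-, also when N = +oo and u_eps = -oo. This is how u_eps^- enters the
    estimate. *)
Lemma partial_negH_le eps z : 0 < eps ->
  (partial (@negH R) eps z <=
   partial (@posH R) eps z + maxe (- truncated eps z) 0)%E.
Proof.
move=> e0; rewrite truncatedE; have := partial_posH_fin z e0.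
have := @partial_ge0 _ eps z (@posH_ge0 R).
have := @partial_ge0 _ eps z (@negH_ge0 R).
case: (partial (@posH R) eps z) => [p| |]// p0 n0 _.
case: (partial (@negH R) eps z) n0 => [n _|_|_]; last by rewrite leNye.
  by rewrite -EFinB -EFinN -EFin_max -EFinD lee_fin /Num.max; case: ifPn; lra.
by rewrite [X in (_ + X)%E]max_l/= ?leey// addey// leey.
Qed.

Lemma measurable_partial_line h c eps : (forall v, (0 <= h v)%E) ->
  comp_measurable h ->
  measurable_fun [set: R] (fun t : R => partial h eps (c * t)%:C%C).
Proof.
move=> h0 mh.
apply: (measurable_fun_integral_section mu (measurable_codisc eps) _
  (measurable_kernel_pair c mh)) => p; exact: h0.
Qed.

Definition truncated_neg (eps t : R) : \bar R :=
  (maxe (- truncated eps (1 * t)%:C%C) 0 + maxe (- truncated eps (-1 * t)%:C%C) 0)%E.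

Lemma measurable_truncated_line c eps :
  measurable_fun [set: R] (fun t : R => truncated eps (c * t)%:C%C).
Proof.
under eq_fun do rewrite truncatedE.
apply: emeasurable_funB; apply: measurable_partial_line; first exact: posH_ge0.
- exact: comp_measurable_posH.
- exact: negH_ge0.
- exact: comp_measurable_negH.
Qed.

Lemma measurable_truncated_neg eps : measurable_fun [set: R] (truncated_neg eps).
Proof.
by apply: emeasurable_funD; apply: measurable_maxe => //; apply: measurableT_comp => //;
  exact: measurable_truncated_line.
Qed.

Lemma truncated_neg_ge0 eps t : (0 <= truncated_neg eps t)%E.
Proof. by rewrite adde_ge0// le_max lexx orbT. Qed.

End TruncatedPotential.

(** * The kernel inequality integrated against mu *)

Section IntegratedInequality.
Variable R : realType.
Local Notation Re := (@complex.Re R).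
Local Notation Im := (@complex.Im R).
Local Notation leb := (@lebesgue_measure R).

Lemma measurable_psi : measurable_fun [set: R] (@psi R).
Proof.
have ml (f : R -> R) : measurable_fun setT f ->
    measurable_fun setT (fun s => ln `|f s|).
  move=> mf; apply: (measurableT_comp (@measurable_ln R)).
  exact: (measurableT_comp (@normr_measurable R setT)).
have m1 : measurable_fun [set: R] (fun s : R => 1 + s) by exact: measurable_funD.
have m2 : measurable_fun [set: R] (fun s : R => 1 - s) by exact: measurable_funB.
by apply: measurable_funD; apply: measurable_funM => //; exact: ml.
Qed.

Variable mu : {sigma_finite_measure set (borelC R) -> \bar R}.
Hypothesis mu_lf : locally_finite mu.
Hypothesis mu_tail : (\int[mu]_(z in [set z : borelC R | (1 <= modC z)%R])
          (modC z ^- 2)%R%:E < +oo)%E.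

Local Notation D eps := ([set w : borelC R | (eps < modC w)%R]).

Section Fixed.
Variables (z : R[i]) (r eta e eps : R).
Hypotheses (zr : modC z = r) (r0 : 0 < r) (eta0 : 0 < eta) (eta_r : eta < r / 2).
Hypotheses (ez : e * `|Re z| = - Re z) (e1 : e = 1 \/ e = -1).
Hypothesis eps0 : 0 < eps.
Local Notation I := (`[eta, r]%classic : set (measurableTypeR R)).
Local Notation mI := (measurable_itv `[eta, r]).
Local Notation mD := (measurable_codisc eps).

Lemma measurable_weighted_comp d (T : measurableType d) h (f : T -> R)
  (g : T -> borelC R) : comp_measurable h ->
  measurable_fun setT f -> measurable_fun setT g ->
  measurable_fun setT (fun u => weighted z r e h (g u : R[i])^-1 (f u)).
Proof.
move=> mh mf mg.
have mk c : measurable_fun setT (fun u => h ((c * f u)%:C%C / (g u : R[i]))).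
  have mc : measurable_fun setT (fun u => c * f u) by exact: measurable_funM.
  under eq_fun do rewrite realM_complex.
  apply: mh; apply: measurable_funM => //.
    exact: (measurableT_comp (@measurable_Re_inv R) mg).
  exact: (measurableT_comp (@measurable_Im_inv R) mg).
apply: emeasurable_funD; apply: emeasurable_funM => //.
- apply/measurable_EFinP; apply: measurable_funM => //.
  exact: (measurableT_comp (@measurable_invsqr R) mf).
- exact: emeasurable_funD.
- apply/measurable_EFinP; apply: measurable_funM; last first.
    exact: (measurableT_comp (measurable_half_density r) mf).
  apply: measurable_funM => //.
  exact: (measurableT_comp (@measurable_invR R) mf).
Qed.

Lemma e_norm1 : `|e| = 1.
Proof. by case: e1 => ->; rewrite ?normrN normr1. Qed.

Let w0 h (h0 : forall v, (0 <= h v)%E) w t : I t -> (0 <= weighted z r e h w t)%E.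
Proof. exact: weighted_ge0. Qed.

(* On I all weights are nonnegative, so there the truncation changes nothing. *)
Let wclip h (p : measurableTypeR R * borelC R) : \bar R :=
  maxe (weighted z r e h (p.2 : R[i])^-1 p.1) 0.

Let wclip_ge0 h p : (0 <= wclip h p)%E.
Proof. by rewrite /wclip le_max lexx orbT. Qed.

Let wclipE h (h0 : forall v, (0 <= h v)%E) t w : I t ->
  wclip h (t, w) = weighted z r e h ((w : R[i])^-1)%R t.
Proof. by move=> It; rewrite /wclip max_l// w0. Qed.

Let measurable_wclip h : comp_measurable h -> measurable_fun setT (wclip h).
Proof.
move=> mh; apply: measurable_maxe => //.
exact: measurable_weighted_comp.
Qed.

Lemma tonelli_weighted h : (forall v, (0 <= h v)%E) -> comp_measurable h ->
  (\int[mu]_(w in D eps) \int[leb]_(t in I) weighted z r e h ((w : R[i])^-1)%R t =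
   \int[leb]_(t in I) \int[mu]_(w in D eps) weighted z r e h ((w : R[i])^-1)%R t)%E.
Proof.
move=> h0 mh.
have := @tonelli_setX _ _ _ _ _ (leb : {sigma_finite_measure set _ -> \bar R}) mu I (D eps) (wclip h)
  mI mD (@wclip_ge0 h) (measurable_wclip mh).
move=> tt; transitivity (\int[mu]_(w in D eps) \int[leb]_(t in I) wclip h (t, w))%E.
  apply: eq_integral => w _; apply: eq_integral => t; rewrite inE => It.
  by rewrite wclipE.
rewrite -tt; apply: eq_integral => t; rewrite inE => It; apply: eq_integral => w _.
by rewrite wclipE.
Qed.

Lemma measurable_weighted_in1 h : (forall v, (0 <= h v)%E) -> comp_measurable h ->
  measurable_fun (D eps) (fun w : borelC R =>
    \int[leb]_(t in I) weighted z r e h ((w : R[i])^-1)%R t)%E.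
Proof.
move=> h0 mh; pose g (p : borelC R * measurableTypeR R) := wclip h (p.2, p.1).
have mg : measurable_fun setT g.
  apply: (measurableT_comp (measurable_wclip mh)).
  exact: (measurable_fun_pair measurable_snd measurable_fst).
have := @measurable_fun_integral_section _ _ _ _ _ (leb : {sigma_finite_measure set _ -> \bar R})
  I g mI (fun p => wclip_ge0 h (p.2, p.1)) mg.
move=> mm; apply: measurable_funTS; move: mm; congr measurable_fun.
apply/funext => w; apply: eq_integral => t; rewrite inE => It.
by rewrite /g/= wclipE.
Qed.

Lemma measurable_weighted_in2 h : (forall v, (0 <= h v)%E) -> comp_measurable h ->
  measurable_fun I (fun t : measurableTypeR R =>
    \int[mu]_(w in D eps) weighted z r e h ((w : R[i])^-1)%R t)%E.
Proof.
move=> h0 mh.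
have mm := @measurable_fun_integral_section _ _ _ _ _ mu
  (D eps) (wclip h) mD (wclip_ge0 h) (measurable_wclip mh).
apply: (@eq_measurable_fun _ _ _ _ _ (fun t => \int[mu]_(w in D eps) wclip h (t, w))%E).
  by move=> t; rewrite inE => It; apply: eq_integral => w _; rewrite wclipE.
exact: measurable_funTS.
Qed.

Lemma integral_weighted_mu h t : (forall v, (0 <= h v)%E) -> comp_measurable h ->
  I t ->
  (\int[mu]_(w in D eps) weighted z r e h ((w : R[i])^-1)%R t =
   (24 * r * t ^- 2)%:E * (partial mu h eps (1 * t)%:C%C + partial mu h eps (-1 * t)%:C%C)
   + (`|Re z| * t^-1 * half_density r t)%:E * partial mu h eps (e * t)%:C%C)%E.
Proof.
move=> h0 mh It; have t0 : 0 < t.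
  by move: It; rewrite /= in_itv/= => /andP[+ _]; exact: lt_le_trans.
have a0 : 0 <= 24 * r * t ^- 2 by rewrite !mulr_ge0// ?invr_ge0 ?sqr_ge0// ltW.
have b0 : 0 <= `|Re z| * t^-1 * half_density r t.
  apply: mulr_ge0; last exact: half_density_ge0.
  by rewrite mulr_ge0// invr_ge0 ltW.
have mk c : measurable_fun (D eps) (fun w : borelC R => h ((c * t)%:C%C / (w : R[i]))).
  by apply: measurable_funTS; exact: measurable_kernel_mul.
have m2 : measurable_fun (D eps) (fun w : borelC R => symH h ((w : R[i])^-1)%R t).
  exact: emeasurable_funD.
have s0 w : D eps w -> (0 <= symH h ((w : R[i])^-1)%R t)%E.
  by move=> _; exact: symH_ge0.
have k0 c w : D eps w -> (0 <= h ((c * t)%:C%C / (w : R[i]))%R)%E by [].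
have A1 w : D eps w -> (0 <= (24 * r * t ^- 2)%:E * symH h ((w : R[i])^-1)%R t)%E.
  by move=> Dw; apply: mule_ge0; [rewrite lee_fin|exact: s0].
have A2 w : D eps w ->
    (0 <= (`|Re z| * t^-1 * half_density r t)%:E * h ((e * t)%:C%C / (w : R[i]))%R)%E.
  by move=> Dw; apply: mule_ge0; [rewrite lee_fin|exact: h0].
rewrite /weighted (ge0_integralD mu mD A1 (measurable_funeM _ m2) A2 (measurable_funeM _ (mk e))).
rewrite (ge0_integralZl_EFin mu mD s0 m2 a0) (ge0_integralZl_EFin mu mD (k0 e) (mk e) b0).
by rewrite /symH (ge0_integralD mu mD (k0 1) (mk 1) (k0 (-1)) (mk (-1))).
Qed.

(** [partial_negH_le] at t, - t and e t. The one-sided weight is at most (r / t) (2 / r) <= 2 r /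
    t^2 because t <= r, and its point is one of t and - t; with the two-sided weight 24 r / t^2 this
    makes 26. *)
Lemma weighted_neg_le t : I t ->
  (\int[mu]_(w in D eps) weighted z r e (@negH R) ((w : R[i])^-1)%R t <=
   \int[mu]_(w in D eps) weighted z r e (@posH R) ((w : R[i])^-1)%R t
   + (26 * r * t ^- 2)%:E * truncated_neg mu eps t)%E.
Proof.
move=> It; have t0 : 0 < t.
  by move: It; rewrite /= in_itv/= => /andP[+ _]; exact: lt_le_trans.
have tr : t <= r by move: It; rewrite /= in_itv/= => /andP[].
rewrite !integral_weighted_mu//; try first [exact: negH_ge0|exact: posH_ge0|
  exact: comp_measurable_posH|exact: comp_measurable_negH].
have a0 : 0 <= 24 * r * t ^- 2 by rewrite !mulr_ge0// ?invr_ge0 ?sqr_ge0// ltW.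
have b0 : 0 <= `|Re z| * t^-1 * half_density r t.
  apply: mulr_ge0; last exact: half_density_ge0.
  by rewrite mulr_ge0// invr_ge0 ltW.
have b2 : `|Re z| * t^-1 * half_density r t <= 2 * r * t ^- 2.
  apply: (@le_trans _ _ (r * t^-1 * (2 / r))).
    apply: ler_pM; rewrite ?half_density_ge0 ?half_density_le//.
      by rewrite mulr_ge0// invr_ge0 ltW.
    by rewrite ler_pM2r ?invr_gt0// -zr Re_le_modC.
  have -> : r * t^-1 * (2 / r) = 2 * t^-1 by field; rewrite !gt_eqF.
  have -> : 2 * r * t ^- 2 = 2 * t^-1 * (r / t) by field; rewrite gt_eqF.
  by rewrite ler_peMr ?mulr_ge0 ?invr_ge0 ?(ltW t0)// ler_pdivlMr// mul1r.
have np c := partial_negH_le mu_lf mu_tail (c * t)%:C%C eps0.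
set p1 := partial _ (@posH R) _ (1 * t)%:C%C; set p2 := partial _ (@posH R) _ (-1 * t)%:C%C.
set p3 := partial _ (@posH R) _ (e * t)%:C%C.
have p10 : (0 <= p1)%E by exact: partial_ge0 (@posH_ge0 R).
have p20 : (0 <= p2)%E by exact: partial_ge0 (@posH_ge0 R).
have p30 : (0 <= p3)%E by exact: partial_ge0 (@posH_ge0 R).
pose v (c : R) : \bar R := (maxe (- truncated mu eps (c * t)%:C%C) 0)%E.
have v0 c : (0 <= v c)%E by rewrite /v le_max lexx orbT.
have tE : truncated_neg mu eps t = (v 1%R + v (-1)%R)%E by [].
have ve : (v e <= truncated_neg mu eps t)%E.
  by rewrite tE; case: e1 => ->; [rewrite leeDl|rewrite leeDr].
have := np 1; have := np (-1); have := np e; rewrite -/(v e) -/(v 1) -/(v (-1)) -/p1 -/p2 -/p3.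
move=> h3 h2 h1.
apply: (@le_trans _ _ ((24 * r * t ^- 2)%:E * ((p1 + v 1%R) + (p2 + v (-1)%R)) +
   (`|Re z| * t^-1 * half_density r t)%:E * (p3 + v e))%E).
  by apply: leeD; apply: lee_wpmul2l; rewrite ?lee_fin//; exact: leeD.
have T0 := truncated_neg_ge0 mu eps t.
rewrite (addeACA p1) -tE; set T := truncated_neg _ _ _ in T0 ve *.
clearbody p1 p2 p3 T.
set a := 24 * r * _ in a0 *; set b := _ * half_density _ _ in b0 b2 *.
rewrite [(a%:E * (_ + T))%E]ge0_muleDr ?adde_ge0// [(b%:E * (_ + _))%E]ge0_muleDr// addeACA.
rewrite leeD2l//.
have -> : 26 * r * t ^- 2 = a + 2 * r * t ^- 2 by rewrite /a; ring.
rewrite EFinD ge0_muleDl ?lee_fin//; last by rewrite (le_trans b0 b2).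
by rewrite leeD2l// lee_pmul// lee_fin.
Qed.

(** Needed to cancel this term from both sides of the integrated inequality. By H^+(v) <= |v|^2 / 2
    a factor t^2 compensates the density, so the inner integral is bounded on I. *)
Lemma weighted_pos_fin :
  (\int[leb]_(t in I) \int[mu]_(w in D eps) weighted z r e (@posH R) ((w : R[i])^-1)%R t < +oo)%E.
Proof.
have Mfin : sqmass mu eps \is a fin_num.
  by rewrite ge0_fin_numE ?sqmass_ge0// sqmass_fin.
pose M := fine (sqmass mu eps); have ME : sqmass mu eps = M%:E by rewrite fineK.
have M0 : 0 <= M by rewrite fine_ge0// sqmass_ge0.
pose C := 24 * r * M + r * M.
apply: (@le_lt_trans _ _ (\int[leb]_(t in I) (cst C%:E) t)%E); last first.
  rewrite integral_cst//= lebesgue_measure_itv/=.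
  by case: ifP => _; rewrite ?mule0 ?ltry// -EFinD -EFinM ltry.
apply: ge0_le_integral => //.
- by move=> t It; apply: integral_ge0 => w _; apply: w0 => //; exact: posH_ge0.
- apply: measurable_weighted_in2; first exact: posH_ge0.
  exact: comp_measurable_posH.
move=> t It; have t0 : 0 < t.
  by move: It; rewrite /= in_itv/= => /andP[+ _]; exact: lt_le_trans.
rewrite integral_weighted_mu//; try first [exact: posH_ge0|exact: comp_measurable_posH].
have a0 : 0 <= 24 * r * t ^- 2 by rewrite !mulr_ge0// ?invr_ge0 ?sqr_ge0// ltW.
have b0 : 0 <= `|Re z| * t^-1 * half_density r t.
  apply: mulr_ge0; last exact: half_density_ge0.
  by rewrite mulr_ge0// invr_ge0 ltW.
have tr : t <= r by move: It; rewrite /= in_itv/= => /andP[].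
have b2 : `|Re z| * t^-1 * half_density r t <= r * t^-1 * (2 / r).
  apply: ler_pM; rewrite ?half_density_ge0 ?half_density_le//.
    by rewrite mulr_ge0// invr_ge0 ltW.
  by rewrite ler_pM2r ?invr_gt0// -zr Re_le_modC.
have pc c : `|c| = 1 -> (partial mu (@posH R) eps (c * t)%:C%C <= (t ^+ 2 / 2 * M)%:E)%E.
  move=> c1; apply: le_trans (partial_posH_le mu _ eps0) _.
  by rewrite ME -EFinM modC_real normrM c1 mul1r real_normK ?num_real.
apply: (@le_trans _ _ ((24 * r * t ^- 2)%:E * ((t ^+ 2 / 2 * M)%:E + (t ^+ 2 / 2 * M)%:E)
  + (r * t^-1 * (2 / r))%:E * (t ^+ 2 / 2 * M)%:E)%E).
  apply: leeD.
    apply: lee_wpmul2l; first by rewrite lee_fin.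
    by apply: leeD; apply: pc; rewrite ?normrN normr1.
  apply: lee_pmul; rewrite ?lee_fin//; last exact: pc e_norm1.
  exact: partial_ge0 (@posH_ge0 R).
rewrite -[X in (_ * X + _)%E]EFinD -[X in (X + _)%E]EFinM -[X in (_ + X)%E]EFinM.
rewrite -EFinD lee_fin /C.
have -> : 24 * r * t ^- 2 * (t ^+ 2 / 2 * M + t ^+ 2 / 2 * M) = 24 * r * M.
  by field; rewrite gt_eqF.
have -> : r * t^-1 * (2 / r) * (t ^+ 2 / 2 * M) = t * M.
  by field; rewrite !gt_eqF.
by rewrite lerD2l ler_wpM2r.
Qed.

Definition error_term (w : R[i]) : R :=
  295 * (r * `|Im w|) + 24 * (r / eta) * psi (eta * Re w).

Lemma error_term_ge0 w : 0 <= error_term w.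
Proof.
apply: addr_ge0; first by apply: mulr_ge0; [exact: ler0n|rewrite mulr_ge0// ltW].
by apply: mulr_ge0; [rewrite mulr_ge0// divr_ge0// ltW|exact: psi_ge0].
Qed.

Lemma measurable_error_term :
  measurable_fun [set: borelC R] (fun w : borelC R => (error_term ((w : R[i])^-1)%R)%:E).
Proof.
apply/measurable_EFinP; apply: measurable_funD.
  apply: measurable_funM => //; apply: measurable_funM => //.
  apply: (measurableT_comp (@normr_measurable R setT)).
  exact: measurable_Im_inv.
apply: measurable_funM => //; apply: (measurableT_comp measurable_psi).
by apply: measurable_funM => //; exact: measurable_Re_inv.
Qed.

(** Let A and B be the double integrals of the positive and negative parts over nu and mu, and T the
    weighted integral of u_eps^-. Integrating [kernel_weighted] and applying Tonelli gives P + A <=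
    N + B + E, while B <= A + T by [weighted_neg_le]; A is finite and drops out. *)
Lemma integrated_inequality :
  (partial mu (@posH R) eps z <= partial mu (@negH R) eps z
   + (\int[leb]_(t in I) ((26 * r * t ^- 2)%:E * truncated_neg mu eps t)
      + \int[mu]_(w in D eps) (error_term ((w : R[i])^-1)%R)%:E))%E.
Proof.
have pos0 := @posH_ge0 R; have neg0 := @negH_ge0 R.
have mpos := @comp_measurable_posH R; have mneg := @comp_measurable_negH R.
have mp1 : measurable_fun (D eps) (fun w : borelC R => posH (z / (w : R[i]))).
  by apply: measurable_funTS; exact: measurable_kernel_mul.
have mn1 : measurable_fun (D eps) (fun w : borelC R => negH (z / (w : R[i]))).
  by apply: measurable_funTS; exact: measurable_kernel_mul.
have mp2 := measurable_weighted_in1 pos0 mpos.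
have mn2 := measurable_weighted_in1 neg0 mneg.
have mE : measurable_fun (D eps) (fun w : borelC R => (error_term ((w : R[i])^-1)%R)%:E).
  by apply: measurable_funTS; exact: measurable_error_term.
have E0 w : D eps w -> (0 <= (error_term ((w : R[i])^-1)%R)%:E)%E.
  by move=> _; rewrite lee_fin error_term_ge0.
have ip0 w : D eps w -> (0 <= \int[leb]_(t in I) weighted z r e (@posH R) ((w : R[i])^-1)%R t)%E.
  by move=> _; apply: integral_ge0 => t; exact: w0.
have in0 w : D eps w -> (0 <= \int[leb]_(t in I) weighted z r e (@negH R) ((w : R[i])^-1)%R t)%E.
  by move=> _; apply: integral_ge0 => t; exact: w0.
have p0 w : D eps w -> (0 <= posH (z / (w : R[i]))%R)%E by move=> _; exact: posH_ge0.
have n0 w : D eps w -> (0 <= negH (z / (w : R[i]))%R)%E by move=> _; exact: negH_ge0.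
have npn w : D eps w -> (0 <= negH (z / (w : R[i]))%R +
   \int[leb]_(t in I) weighted z r e (@negH R) ((w : R[i])^-1)%R t)%E.
  by move=> Dw; apply: adde_ge0; [exact: n0|exact: in0].
have S2 : (\int[mu]_(w in D eps) (posH (z / (w : R[i]))%R +
      \int[leb]_(t in I) weighted z r e (@posH R) ((w : R[i])^-1)%R t) <=
   \int[mu]_(w in D eps) (negH (z / (w : R[i]))%R +
      \int[leb]_(t in I) weighted z r e (@negH R) ((w : R[i])^-1)%R t +
      (error_term ((w : R[i])^-1)%R)%:E))%E.
  apply: ge0_le_integral; first exact: mD.
  - by move=> w Dw; apply: adde_ge0; [exact: p0|exact: ip0].
  - exact: emeasurable_funD.
  - by apply: emeasurable_funD => //; exact: emeasurable_funD.
  - by move=> w _; exact: (kernel_weighted zr r0 eta0 eta_r ez e_norm1).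
move: S2; rewrite (ge0_integralD mu mD p0 mp1 ip0 mp2).
rewrite (ge0_integralD mu mD npn (emeasurable_funD mn1 mn2) E0 mE).
rewrite (ge0_integralD mu mD n0 mn1 in0 mn2) !tonelli_weighted//.
rewrite -/(partial mu (@posH R) eps z) -/(partial mu (@negH R) eps z).
have mt : measurable_fun I (fun t : measurableTypeR R =>
    ((26 * r * t ^- 2)%:E * truncated_neg mu eps t)%E).
  apply: measurable_funTS; apply: emeasurable_funM.
    apply/measurable_EFinP; apply: measurable_funM => //; exact: measurable_invsqr.
  exact: measurable_truncated_neg.
have t0 t : I t -> (0 <= (26 * r * t ^- 2)%:E * truncated_neg mu eps t)%E.
  move=> _; apply: mule_ge0; last exact: truncated_neg_ge0.
  by rewrite lee_fin !mulr_ge0 ?invr_ge0 ?sqr_ge0// ltW.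
have jp0 t : I t -> (0 <= \int[mu]_(w in D eps) weighted z r e (@posH R) ((w : R[i])^-1)%R t)%E.
  by move=> It; apply: integral_ge0 => w _; exact: w0.
have jn0 t : I t -> (0 <= \int[mu]_(w in D eps) weighted z r e (@negH R) ((w : R[i])^-1)%R t)%E.
  by move=> It; apply: integral_ge0 => w _; exact: w0.
have S5 : (\int[leb]_(t in I) \int[mu]_(w in D eps) weighted z r e (@negH R) ((w : R[i])^-1)%R t
  <= \int[leb]_(t in I) \int[mu]_(w in D eps) weighted z r e (@posH R) ((w : R[i])^-1)%R t
    + \int[leb]_(t in I) ((26 * r * t ^- 2)%:E * truncated_neg mu eps t))%E.
  rewrite -(ge0_integralD leb mI jp0 (measurable_weighted_in2 pos0 mpos) t0 mt).
  apply: ge0_le_integral; first exact: mI.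
  - exact: jn0.
  - exact: measurable_weighted_in2.
  - exact: (emeasurable_funD (measurable_weighted_in2 pos0 mpos) mt).
  - exact: weighted_neg_le.
have Afin := weighted_pos_fin; move: S5.
have := integral_ge0 _ jp0 : (0 <= \int[leb]_(t in I) _)%E.
move: Afin; set A := integral leb I _; set B := integral leb I _; set T := integral leb I _.
move: A B T (partial _ _ _ _) (partial _ _ _ _) (integral mu _ _) => A B T P N E Afin A0 BAT.
have {Afin A0} Afin : A \is a fin_num by rewrite ge0_fin_numE.
move=> h; rewrite -(leeD2rE _ _ Afin); apply: (le_trans h).
apply: (@le_trans _ _ (P + (A + T) + E)%E); first by rewrite leeD2r// leeD2l.
by rewrite -!addeA leeD2l// addeC -addeA.
Qed.

End Fixed.

End IntegratedInequality.

(** * Small discs and the angular count *)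

Section AnnulusEstimates.
Variable R : realType.
Local Notation Re := (@complex.Re R).
Local Notation Im := (@complex.Im R).
Local Notation leb := (@lebesgue_measure R).

Lemma integral_invsqr (x y : R) : 0 < x -> x < y ->
  (\int[leb]_(t in `[x, y]) (t ^- 2)%:E = (x^-1 - y^-1)%:E)%E.
Proof.
move=> x0 xy.
have -> : x^-1 - y^-1 = - y^-1 - - x^-1 by rewrite opprK addrC.
apply: (@is_derive_integral _ _ (fun t => - t^-1)) => // t /andP[xt _];
  have t0 : t != 0 by rewrite gt_eqF// (lt_le_trans x0).
  have dV : is_derive t 1 (fun u : R => u^-1) (- t ^- 2 * 1).
    exact: (@is_deriveV _ id t 1 1 t0 (is_derive_id t 1)).
  have := is_deriveN dV.
  by move=> d; apply: is_derive_eq d _; rewrite mulr1 opprK.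
have dX : is_derive t 1 (fun u : R => u ^+ 2) (2 * t ^+ 1 *: 1).
  exact: (@is_deriveX _ _ id 2 t 1 1 (is_derive_id t 1)).
by case: (@is_deriveV _ (fun u : R => u ^+ 2) t _ 1 (expf_neq0 2 t0) dX).
Qed.

Variable mu : {sigma_finite_measure set (borelC R) -> \bar R}.
Hypothesis mu_lf : locally_finite mu.

Local Notation D eps := ([set w : borelC R | (eps < modC w)%R]).
Definition annulus (s t : R) : set (borelC R) := [set w : borelC R | s < modC w <= t].

Lemma measurable_annulus s t : measurable (annulus s t).
Proof. exact: measurable_modC_itvoc. Qed.

Lemma integral_codisc_split (f : borelC R -> \bar R) s t : s <= t ->
  (forall w, (0 <= f w)%E) -> measurable_fun setT f ->
  (\int[mu]_(w in D s) f w = \int[mu]_(w in D t) f w + \int[mu]_(w in annulus s t) f w)%E.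
Proof.
move=> st f0 mf; rewrite -ge0_integral_setU//.
- congr (integral mu _ f); apply/seteqP; split=> w /=; rewrite /annulus/=.
    by move=> sw; case: (leP (modC w) t) => [wt|tw]; [right; rewrite sw|left].
  by move=> [/(le_lt_trans st)//|/andP[]].
- exact: measurable_codisc.
- exact: measurable_annulus.
- exact: measurable_funTS.
- apply/disj_setPS => w [] /= tw /andP[_]; by rewrite leNgt tw.
Qed.

Lemma integral_annulus_split (f : borelC R -> \bar R) s t u : s <= t -> t <= u ->
  (forall w, (0 <= f w)%E) -> measurable_fun setT f ->
  (\int[mu]_(w in annulus s u) f w =
   \int[mu]_(w in annulus t u) f w + \int[mu]_(w in annulus s t) f w)%E.
Proof.
move=> st tu f0 mf; rewrite -ge0_integral_setU//.
- congr (integral mu _ f); apply/seteqP; split=> w /=; rewrite /annulus/=.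
    by move=> /andP[sw wu]; case: (leP (modC w) t) => [wt|tw]; [right; rewrite sw|left].
  by move=> [/andP[tw ->]|/andP[-> wt]]; rewrite ?(le_lt_trans st)//= (le_trans wt).
- exact: measurable_annulus.
- exact: measurable_annulus.
- exact: measurable_funTS.
- by apply/disj_setPS => w [] /= /andP[tw _] /andP[_]; rewrite leNgt tw.
Qed.

Lemma integral_annulus_le (f : borelC R -> \bar R) s t (c M : R) :
  (forall w, (0 <= f w)%E) -> measurable_fun setT f ->
  0 <= c -> (forall w, annulus s t w -> (f w <= c%:E)%E) ->
  (disc_mass mu t <= M%:E)%E ->
  (\int[mu]_(w in annulus s t) f w <= (c * M)%:E)%E.
Proof.
move=> f0 mf c0 fc tM.
apply: (@le_trans _ _ (\int[mu]_(w in annulus s t) (cst c%:E) w)%E).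
  apply: ge0_le_integral => //; first exact: measurable_annulus.
  exact: measurable_funTS.
rewrite integral_cst; last exact: measurable_annulus.
rewrite EFinM lee_wpmul2l ?lee_fin//; apply: le_trans tM.
apply: le_measure; rewrite ?inE.
- exact: measurable_annulus.
- exact: measurable_disc.
- by move=> w /= /andP[].
Qed.

Section SmallDiscs.
Variables (L rho : R).
Hypotheses (L0 : 0 <= L) (rho0 : 0 < rho).
Hypothesis massL : forall t, 0 < t -> t <= rho -> (disc_mass mu t <= (L * t)%:E)%E.

(** On the annulus between rho / 2^(k+1) and rho / 2^k the mass is at most L rho / 2^k and the
    integrand at most (2^(k+1) / rho)^2, so one step adds 4 L 2^k / rho, exactly the increment of
    the bound. With eta = rho / 2^k the last term reads 4 L / eta. *)
Lemma sqmass_dyadic k :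
  (sqmass mu (rho / 2 ^+ k) <= sqmass mu rho + (4 * L * 2 ^+ k / rho)%:E)%E.
Proof.
elim: k => [|k ih].
  rewrite expr0 divr1 leeDl// lee_fin mulr1 divr_ge0 ?mulr_ge0// ltW//.
have p0 : (0 : R) < 2 ^+ k by rewrite exprn_gt0.
have q0 : (0 : R) < 2 ^+ k.+1 by rewrite exprn_gt0.
have s0 : 0 < rho / 2 ^+ k.+1 by exact: divr_gt0.
have st : rho / 2 ^+ k.+1 <= rho / 2 ^+ k.
  rewrite ler_pM2l// lef_pV2 ?posrE// exprS; lra.
rewrite /sqmass (integral_codisc_split st (@modC_invsqr_ge0 R) (@measurable_modC_invsqr R)).
apply: (@le_trans _ _ (sqmass mu (rho / 2 ^+ k) + ((rho / 2 ^+ k.+1) ^- 2 * (L * (rho / 2 ^+ k)))%:E)%E).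
  rewrite leeD2l//; apply: integral_annulus_le.
  - exact: modC_invsqr_ge0.
  - exact: measurable_modC_invsqr.
  - by rewrite invr_ge0 sqr_ge0.
  - move=> w /= /andP[sw _]; rewrite lee_fin lef_pV2 ?posrE ?exprn_gt0// ?(lt_trans s0)//.
    by rewrite lerXn2r ?nnegrE ?modC_ge0// ltW.
  - apply: massL; first exact: divr_gt0.
    by rewrite ler_pdivrMr// ler_peMr ?(ltW rho0)// exprn_ege1// ler1n.
apply: (le_trans (leeD2r _ ih)); rewrite -addeA leeD2l// -EFinD lee_fin.
rewrite (exprS 2 k).
have -> : (rho / (2 * 2 ^+ k)) ^- 2 * (L * (rho / 2 ^+ k)) = 4 * L * 2 ^+ k / rho.
  by field; rewrite !gt_eqF.
rewrite -mulrDl ler_pM2r ?invr_gt0//; lra.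
Qed.

(** Up to constants a majorant, near the origin, of both psi (eta Re (1 / zeta)) and log |1 - z /
    zeta|. *)
Definition invsqrt (w : borelC R) : \bar R := ((Num.sqrt (modC w))^-1)%:E.

Lemma invsqrt_ge0 w : (0 <= invsqrt w)%E.
Proof. by rewrite lee_fin invr_ge0 sqrtr_ge0. Qed.

Lemma measurable_invsqrt : measurable_fun setT invsqrt.
Proof.
apply/measurable_EFinP; apply: (measurableT_comp (@measurable_invR R)).
apply: (measurableT_comp (@measurable_sqrt R)); exact: measurable_modC.
Qed.

(** The ratio 4 of the radii halves the square root: the annulus of index k contributes at most 2 L
    sqrt(eta) / 2^k, and [1 - 2 ^- k] comes from the geometric sum. *)
Lemma invsqrt_dyadic eta k : 0 < eta -> eta <= rho ->
  (\int[mu]_(w in annulus (eta / 4 ^+ k) eta) invsqrt w <=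
   (4 * L * Num.sqrt eta * (1 - 2 ^- k))%:E)%E.
Proof.
move=> eta0 eta_rho; have sq0 : 0 < Num.sqrt eta by rewrite sqrtr_gt0.
elim: k => [|k ih].
  rewrite expr0 divr1 invr1 subrr mulr0 (_ : annulus _ _ = set0) ?integral_set0//.
  by apply/seteqP; split=> // w /= /andP[/lt_le_trans h /h]; rewrite ltxx.
have p0 : (0 : R) < 4 ^+ k by rewrite exprn_gt0.
have q0 : (0 : R) < 4 ^+ k.+1 by rewrite exprn_gt0.
have r0 : (0 : R) < 2 ^+ k by rewrite exprn_gt0.
have s0 : 0 < eta / 4 ^+ k.+1 by exact: divr_gt0.
have st : eta / 4 ^+ k.+1 <= eta / 4 ^+ k.
  rewrite ler_pM2l// lef_pV2 ?posrE// exprS; lra.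
have tu : eta / 4 ^+ k <= eta.
  by rewrite ler_pdivrMr// ler_peMr ?(ltW eta0)// exprn_ege1// ler1n.
have sqE : Num.sqrt (eta / 4 ^+ k.+1) = Num.sqrt eta / 2 ^+ k.+1.
  rewrite sqrtrM ?ltW//; congr (_ * _).
  have -> : (4 : R) ^+ k.+1 = (2 ^+ k.+1) ^+ 2.
    by rewrite -exprM mulnC exprM; congr (_ ^+ _); lra.
  by rewrite sqrtrV ?sqr_ge0// sqrtr_sqr ger0_norm// exprn_ge0.
rewrite (integral_annulus_split st tu invsqrt_ge0 measurable_invsqrt).
have h : (\int[mu]_(w in annulus (eta / 4 ^+ k.+1) (eta / 4 ^+ k)) invsqrt w <=
    ((Num.sqrt eta / 2 ^+ k.+1)^-1 * (L * (eta / 4 ^+ k)))%:E)%E.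
  apply: integral_annulus_le.
  - exact: invsqrt_ge0.
  - exact: measurable_invsqrt.
  - by rewrite invr_ge0 divr_ge0 ?exprn_ge0// ltW.
  - move=> w /= /andP[sw _]; rewrite lee_fin -sqE lef_pV2 ?posrE ?sqrtr_gt0//.
      by rewrite ler_wsqrtr// ltW.
    exact: lt_trans sw.
  - by apply: massL; [exact: divr_gt0|exact: le_trans eta_rho].
apply: (le_trans (leeD ih h)); rewrite -EFinD lee_fin.
have E4 : (4 : R) ^+ k = (2 ^+ k) ^+ 2.
  by rewrite -exprM mulnC exprM; congr (_ ^+ _); lra.
rewrite E4 !(exprS 2 k); set v := Num.sqrt eta in sq0 *.
have -> : eta = v ^+ 2 by rewrite sqr_sqrtr// ltW.
rewrite le_eqVlt; apply/orP; left; apply/eqP; field.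
by rewrite !gt_eqF.
Qed.

Lemma invsqrt_annulus eps eta : 0 < eps -> 0 < eta -> eta <= rho ->
  (\int[mu]_(w in annulus eps eta) invsqrt w <= (4 * L * Num.sqrt eta)%:E)%E.
Proof.
move=> eps0 eta0 eta_rho.
have [k hk] : exists k, eta / 4 ^+ k <= eps.
  exists (Num.bound (eta / eps)).
  rewrite ler_pdivrMr ?exprn_gt0// -ler_pdivrMl// mulrC.
  have := archi_boundP (divr_ge0 (ltW eta0) (ltW eps0)).
  move/ltW/le_trans; apply; rewrite -natrX ler_nat ltnW//.
  exact: ltn_expl.
apply: le_trans (le_trans (invsqrt_dyadic k eta0 eta_rho) _).
  apply: ge0_subset_integral; try exact: measurable_annulus.
  - by apply: measurable_funTS; exact: measurable_invsqrt.
  - by move=> w _; exact: invsqrt_ge0.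
  - by move=> w /= /andP[ew we]; rewrite /annulus/= we (le_lt_trans hk).
rewrite lee_fin -[leRHS]mulr1 ler_wpM2l ?mulr_ge0 ?sqrtr_ge0//.
Qed.

Lemma measurable_psi_Re c : measurable_fun [set: borelC R]
  (fun w : borelC R => (psi (c * Re (w : R[i])^-1))%:E).
Proof.
apply/measurable_EFinP; apply: (measurableT_comp (@measurable_psi R)).
by apply: measurable_funM => //; exact: measurable_Re_inv.
Qed.

(** For |zeta| > eta the argument is at most 1 in modulus and psi is quadratically small; inside,
    psi is at most 6 sqrt(eta / |zeta|), which integrates to at most 6 sqrt(eta) times 4 L
    sqrt(eta). The bound is free of eps. *)
Lemma psi_integral eps eta : 0 < eps -> eps <= eta -> eta <= rho ->
  (\int[mu]_(w in D eps) (psi (eta * Re ((w : R[i])^-1)%R))%:E <=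
   (2 * eta ^+ 2)%:E * sqmass mu eta + (24 * L * eta)%:E)%E.
Proof.
move=> eps0 ee eta_rho; have eta0 : 0 < eta by exact: lt_le_trans ee.
have mpsi := measurable_psi_Re eta.
have psi0 w : (0 <= (psi (eta * Re ((w : R[i])^-1)%R))%:E)%E.
  by rewrite lee_fin psi_ge0.
have Rele (w : R[i]) : `|eta * Re w^-1| <= eta / modC w.
  rewrite normrM gtr0_norm// ler_pM2l//.
  by rewrite (le_trans (Re_le_modC _))// modCV.
rewrite (integral_codisc_split ee psi0 mpsi); apply: leeD.
  rewrite /sqmass -ge0_integralZl_EFin//; last 4 first.
  - exact: measurable_codisc.
  - by move=> w _; exact: modC_invsqr_ge0.
  - by apply: measurable_funTS; exact: measurable_modC_invsqr.
  - by rewrite mulr_ge0// sqr_ge0.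
  apply: ge0_le_integral => //; first exact: measurable_codisc.
  - exact: measurable_funTS.
  - by apply: measurable_funTS; apply: measurable_funeM; exact: measurable_modC_invsqr.
  - move=> w /= ew; rewrite -EFinM lee_fin.
    have w0 := lt_trans eta0 ew.
    have h1 : eta / modC w <= 1 by rewrite ler_pdivrMr// mul1r ltW.
    apply: le_trans (psi_le_sqr (le_trans (Rele w) h1)) _.
    rewrite -mulrA ler_pM2l// -[leRHS](_ : (eta / modC w) ^+ 2 = _); last first.
      by rewrite exprMn exprVn.
    rewrite -(real_normK (num_real (eta * _))) lerXn2r ?nnegrE//.
    by rewrite divr_ge0// ltW.
apply: (@le_trans _ _ ((6 * Num.sqrt eta)%:E * \int[mu]_(w in annulus eps eta) invsqrt w)%E).
  rewrite -ge0_integralZl_EFin//; last 3 first.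
  - exact: measurable_annulus.
  - by move=> w _; exact: invsqrt_ge0.
  - by apply: measurable_funTS; exact: measurable_invsqrt.
  apply: ge0_le_integral => //; first exact: measurable_annulus.
  - exact: measurable_funTS.
  - by apply: measurable_funTS; apply: measurable_funeM; exact: measurable_invsqrt.
  - move=> w _; rewrite -EFinM lee_fin; apply: (le_trans (psi_le_sqrt _)).
    rewrite -mulrA ler_pM2l// -sqrtrV ?modC_ge0// -sqrtrM ?(ltW eta0)//.
    by rewrite ler_wsqrtr//; exact: Rele.
apply: (@le_trans _ _ ((6 * Num.sqrt eta)%:E * (4 * L * Num.sqrt eta)%:E)%E).
  by rewrite lee_wpmul2l ?lee_fin ?mulr_ge0 ?sqrtr_ge0// invsqrt_annulus.
rewrite -EFinM lee_fin.
have -> : 6 * Num.sqrt eta * (4 * L * Num.sqrt eta) = 24 * L * (Num.sqrt eta ^+ 2) by ring.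
by rewrite sqr_sqrtr// ltW.
Qed.

End SmallDiscs.

Definition angular_count (eps t : R) : \bar R :=
  mu (D eps `&` [set w : borelC R | t^-1 <= `|Im (w : R[i])^-1|]).

(** Integrand of a layer-cake formula: in t > 0 it integrates to |Im (1 / zeta)|, and in zeta, over
    |zeta| > eps, to the angular count over t^2. *)
Let joint (p : measurableTypeR R * borelC R) : \bar R :=
  ((p.1 ^- 2)%:E * (\1_[set q : measurableTypeR R * borelC R | q.1^-1 <= `|Im (q.2 : R[i])^-1|] p)%:E)%E.

Let mset : measurable [set q : measurableTypeR R * borelC R | q.1^-1 <= `|Im (q.2 : R[i])^-1|].
Proof.
have m1 : measurable_fun [set: measurableTypeR R * borelC R]
    (fun q : measurableTypeR R * borelC R => q.1^-1 : R).
  exact: (measurableT_comp (@measurable_invR R) measurable_fst).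
have m2 : measurable_fun [set: measurableTypeR R * borelC R]
    (fun q : measurableTypeR R * borelC R => `|Im (q.2 : R[i])^-1| : R).
  apply: (measurableT_comp (@normr_measurable R setT)).
  exact: (measurableT_comp (@measurable_Im_inv R) measurable_snd).
rewrite -[X in measurable X]setTI.
by apply: (measurable_fun_ler m1 m2 measurableT (Y := [set true])).
Qed.

Let joint_ge0 p : (0 <= joint p)%E.
Proof. by rewrite mule_ge0// lee_fin ?invr_ge0 ?sqr_ge0// indicE. Qed.

Let mjoint : measurable_fun setT joint.
Proof.
apply: emeasurable_funM; apply/measurable_EFinP; last exact: measurable_indic.
exact: (measurableT_comp (@measurable_invsqr R) measurable_fst).
Qed.

Let integral_joint eps t :
  (\int[mu]_(w in D eps) joint (t, w) = angular_count eps t * (t ^- 2)%:E)%E.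
Proof.
pose A := [set w : borelC R | t^-1 <= `|Im (w : R[i])^-1|].
have mA : measurable A.
  rewrite (_ : A = xsection [set q : measurableTypeR R * borelC R |
    q.1^-1 <= `|Im (q.2 : R[i])^-1|] t); first exact: measurable_xsection.
  by apply/seteqP; split=> w; rewrite /xsection/= inE.
rewrite /joint/= ge0_integralZl_EFin//; last 3 first.
- exact: measurable_codisc.
- apply: measurable_funTS; apply/measurable_EFinP.
  rewrite (_ : (fun w => _) = \1_A); first exact: measurable_indic.
  by apply/funext => w; rewrite !indicE; congr (nat_of_bool _)%:R; apply/idP/idP; rewrite !inE.
- by rewrite invr_ge0 sqr_ge0.
rewrite muleC; congr (_ * _)%E.
under eq_integral => w _.
  rewrite (_ : \1__ (t, w) = \1_A w); last first.
    by rewrite !indicE; congr (nat_of_bool _)%:R; apply/idP/idP; rewrite !inE.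
  over.
rewrite integral_indic//; last exact: measurable_codisc.
by rewrite setIC.
Qed.

Lemma measurable_angular_count eps : measurable_fun [set: R]
  (fun t : R => (angular_count eps t * (t ^- 2)%:E)%E).
Proof.
have := measurable_fun_integral_section mu (measurable_codisc eps) joint_ge0 mjoint.
by congr measurable_fun; apply/funext => t; rewrite integral_joint.
Qed.

Lemma integral_Im_inv_le eps :
  (\int[mu]_(w in D eps) (`|Im ((w : R[i])^-1)%R|)%:E <=
   2%:E * \int[leb]_(t in [set t : R | (0 < t)%R])
      (angular_count eps t * (t ^- 2)%R%:E))%E.
Proof.
have mpos : measurable ([set t : R | 0 < t] : set (measurableTypeR R)).
  by rewrite -set_itvoy; exact: measurable_itv.
under [X in (_ <= _ * X)%E]eq_integral do rewrite -integral_joint.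
rewrite (@tonelli_setX _ _ _ _ _ (leb : {sigma_finite_measure set _ -> \bar R}) mu _ (D eps) joint
  mpos (measurable_codisc eps) joint_ge0 mjoint).
have mi : measurable_fun (D eps) (fun w : borelC R =>
    \int[leb]_(t in [set t : R | (0 < t)%R]) joint (t, w))%E.
  apply: measurable_funTS.
  have mg : measurable_fun setT (fun p : borelC R * measurableTypeR R => joint (p.2, p.1)).
    apply: (measurableT_comp mjoint).
    exact: (measurable_fun_pair measurable_snd measurable_fst).
  exact: (@measurable_fun_integral_section _ _ _ _ _ (leb : {sigma_finite_measure set _ -> \bar R})
    _ (fun p : borelC R * measurableTypeR R => joint (p.2, p.1)) mpos (fun p => joint_ge0 _) mg).
rewrite -ge0_integralZl_EFin//; last 2 first.
- exact: measurable_codisc.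
- by move=> w _; apply: integral_ge0 => t _; exact: joint_ge0.
apply: ge0_le_integral => //.
- exact: measurable_codisc.
- apply: measurable_funTS; apply/measurable_EFinP.
  apply: (measurableT_comp (@normr_measurable R setT)); exact: measurable_Im_inv.
- exact: measurable_funeM.
move=> w _; set b := `|_|.
have [b0|b0] := eqVneq b 0.
  by rewrite b0 mule_ge0// integral_ge0.
have {}b0 : 0 < b by rewrite lt_neqAle eq_sym b0 normr_ge0.
have bb : b^-1 < 2 * b^-1 by have : 0 < b^-1 by [rewrite invr_gt0]; lra.
(* Only [1 / b, 2 / b] is kept, where t^(-2) integrates to b / 2. This costs the factor 2 and avoids
   an improper integral. *)
apply: (@le_trans _ _ (2%:E * \int[leb]_(t in `[b^-1%R, (2 * b^-1)%R]) (t ^- 2)%:E)%E).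
  rewrite integral_invsqr ?invr_gt0// -EFinM lee_fin invrM ?unitfE ?invr_eq0 ?gt_eqF//.
  by rewrite invrK; lra.
rewrite lee_wpmul2l//.
apply: (@le_trans _ _ (\int[leb]_(t in `[b^-1%R, (2 * b^-1)%R]) joint (t, w))%E).
  rewrite le_eqVlt; apply/orP; left; apply/eqP; apply: eq_integral => t.
  rewrite inE/= in_itv/= => /andP[bt _]; rewrite /joint/= indicE mem_set ?mule1//=.
  by rewrite -/b -[b]invrK lef_pV2 ?posrE ?invr_gt0// (lt_le_trans _ bt)// invr_gt0.
apply: ge0_subset_integral => //.
- by apply: measurable_funTS; exact: (measurableT_comp mjoint (measurable_pair2 w)).
- move=> t /=; rewrite in_itv/= => /andP[bt _]; apply: lt_le_trans bt; by rewrite invr_gt0.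
Qed.

End AnnulusEstimates.

(** * The limit defining the potential *)

Section CauchyLimit.
Variable R : realType.

(** The Cauchy condition reads f x = f e + c with c real, which makes sense for infinite values too:
    if one value [f e] is infinite, f is constant on (0, e). *)
Lemma ereal_cauchy_cvg (f : R -> \bar R) :
  (forall d : R, 0 < d -> exists2 e : R, 0 < e & forall x, 0 < x -> x < e ->
     exists2 c : R, `|c| <= d & f x = (f e + c%:E)%E) ->
  cvg (f x @[x --> (0 : R)^'+]).
Proof.
move=> hf; have [e1 e10 h1] := hf 1 ltr01.
have near0_ e (e0 : 0 < e) : \forall x \near (0 : R)^'+, 0 < x < e.
  by near=> x; apply/andP; split; near: x;
    [exact: nbhs_right_gt|exact: nbhs_right_lt].
case fe: (f e1) => [l| |].
- pose g := fine \o f.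
  have fg : \forall x \near (0 : R)^'+, f x = (g x)%:E.
    near=> x; have /andP[x0 xe] : 0 < x < e1 by near: x; exact: near0_.
    by have [c _ fx] := h1 x x0 xe; rewrite /g/= fx fe.
  have /cvg_ex[l' gl'] : cvg (g x @[x --> (0 : R)^'+]).
    apply/cauchy_cvgP; apply: cauchy_exP => d d0.
    have d20 : 0 < d / 2 by exact: divr_gt0.
    have [e2 e20 h2] := hf _ d20.
    (* A common point through which finiteness passes from [f e1] to [f e2]. *)
    have [x0 [/andP[x00 x0e] x0e1]] : exists x0, 0 < x0 < e2 /\ x0 < e1.
      exists (Num.min e1 e2 / 2); rewrite divr_gt0 ?lt_min ?e10//=.
      have : Num.min e1 e2 <= e1 by rewrite ge_min lexx.
      have : Num.min e1 e2 <= e2 by rewrite ge_min lexx orbT.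
      have : 0 < Num.min e1 e2 by rewrite lt_min e10.
      by split; lra.
    have [c0 _ fx0] := h1 _ x00 x0e1; have [c c2 fx0'] := h2 _ x00 x0e.
    have fe2 : f e2 \is a fin_num.
      move: fx0' ; rewrite fx0 fe; case: (f e2) => [s| |]//.
    exists (fine (f e2)).
    suff : \forall x \near (0 : R)^'+, ball (fine (f e2)) d (g x) by [].
    near=> x.
    have /andP[xp xe] : 0 < x < e2 by near: x; exact: near0_.
    have [c' c'2 fx] := h2 _ xp xe.
    rewrite /= -ball_normE/= /g/= fx -(fineK fe2)/= opprD addNKr normrN.
    by rewrite (le_lt_trans c'2)// ltr_pdivrMr// ltr_pMr// ltr1n.
  apply/cvg_ex; exists l'%:E; apply: cvg_EFin => //.
  by near=> x; have -> : f x = (g x)%:E by near: x; exact: fg.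
- apply/cvg_ex; exists +oo%E; apply: cvg_near_cst; near=> x.
  have /andP[x0 xe] : 0 < x < e1 by near: x; exact: near0_.
  by have [c _ ->] := h1 x x0 xe; rewrite fe addye.
- apply/cvg_ex; exists -oo%E; apply: cvg_near_cst; near=> x.
  have /andP[x0 xe] : 0 < x < e1 by near: x; exact: near0_.
  by have [c _ ->] := h1 x x0 xe; rewrite fe addNye.
Unshelve. all: by end_near. Qed.

End CauchyLimit.

Section PotentialLimit.
Variable R : realType.
Local Notation Re := (@complex.Re R).
Local Notation Im := (@complex.Im R).

Variable mu : {sigma_finite_measure set (borelC R) -> \bar R}.
Hypothesis mu_lf : locally_finite mu.
Hypothesis mu_tail : (\int[mu]_(z in [set z : borelC R | (1 <= modC z)%R])
          (modC z ^- 2)%R%:E < +oo)%E.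

Local Notation D eps := ([set w : borelC R | (eps < modC w)%R]).

Lemma bounded_integrable (A : set (borelC R)) (f : borelC R -> R) (t M : R) :
  measurable A -> measurable_fun setT f ->
  (forall w, A w -> modC w <= t) -> (forall w, A w -> `|f w| <= M) ->
  mu.-integrable A (EFin \o f).
Proof.
move=> mA mf At fM; apply: measurable_bounded_integrable => //.
- apply: le_lt_trans (disc_mass_fin mu_lf t); apply: le_measure; rewrite ?inE//.
  exact: measurable_disc.
- exact: measurable_funTS.
- exists M; split; first exact: num_real.
  by move=> x Mx w Aw; exact: le_trans (fM _ Aw) (ltW Mx).
Qed.

Section LinearPart.
Variable z : R[i].

Definition linear_part (w : borelC R) : R := Re (z / (w : R[i])).

Lemma linear_partE w :
  linear_part w = Re z * Re (w : R[i])^-1 - Im z * Im (w : R[i])^-1.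
Proof. by rewrite /linear_part complex_ReM. Qed.

Lemma measurable_linear_part : measurable_fun setT linear_part.
Proof.
rewrite (_ : linear_part =
    (fun w => Re z * Re (w : R[i])^-1 - Im z * Im (w : R[i])^-1)); last first.
  by apply/funext => w; rewrite linear_partE.
by apply: measurable_funB; apply: measurable_funM => //;
  [exact: measurable_Re_inv|exact: measurable_Im_inv].
Qed.

Lemma linear_part_le (s : R) (w : borelC R) : 0 < s -> s <= modC w ->
  `|linear_part w| <= modC z / s.
Proof.
move=> s0 sw; rewrite (le_trans (Re_le_modC _))// modCM modCV.
by rewrite ler_wpM2l ?modC_ge0// lef_pV2 ?posrE// (lt_le_trans s0).
Qed.

Lemma integrable_linear_part (A : set (borelC R)) s t : 0 < s -> measurable A ->
  (forall w, A w -> s <= modC w <= t) -> mu.-integrable A (EFin \o linear_part).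
Proof.
move=> s0 mA As; apply: (@bounded_integrable _ _ t (modC z / s)) => //.
- exact: measurable_linear_part.
- by move=> w /As/andP[].
- by move=> w /As/andP[sw _]; exact: linear_part_le.
Qed.

Let closed_annulus s := [set w : borelC R | s <= modC w <= 1].

Let mclosed s : measurable (closed_annulus s).
Proof.
apply: (@measurable_modC_set _ [set y | s <= y <= 1]).
by rewrite -set_itvcc; exact: measurable_itv.
Qed.

Lemma Rintegral_linear_part s : 0 < s ->
  Rintegral mu (closed_annulus s) linear_part = Re (z * pv_truncated mu s).
Proof.
move=> s0; rewrite (_ : linear_part =
    (fun w => Re z * Re (w : R[i])^-1 - Im z * Im (w : R[i])^-1)); last first.
  by apply/funext => w; rewrite linear_partE.
have inv_le (f : R[i] -> R) : (forall v, `|f v| <= modC v) ->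
    forall w, closed_annulus s w -> `|f (w : R[i])^-1| <= s^-1.
  move=> fle w /andP[sw _]; rewrite (le_trans (fle _))// modCV.
  by rewrite lef_pV2 ?posrE// (lt_le_trans s0).
have iRe : mu.-integrable (closed_annulus s) (EFin \o (fun w : borelC R => Re (w : R[i])^-1)).
  apply: (@bounded_integrable _ _ 1 s^-1) => //; first exact: measurable_Re_inv.
    by move=> w /andP[].
  exact/inv_le/Re_le_modC.
have iIm : mu.-integrable (closed_annulus s) (EFin \o (fun w : borelC R => Im (w : R[i])^-1)).
  apply: (@bounded_integrable _ _ 1 s^-1) => //; first exact: measurable_Im_inv.
    by move=> w /andP[].
  exact/inv_le/Im_le_modC.
rewrite RintegralB//; last 2 first.
- exact: (integrableZl (mclosed s) (Re z) iRe).
- exact: (integrableZl (mclosed s) (Im z) iIm).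
by rewrite RintegralZl// RintegralZl// complex_ReM.
Qed.

Let open_annulus s t := [set w : borelC R | s < modC w < t].

Let mopen s t : measurable (open_annulus s t).
Proof.
apply: (@measurable_modC_set _ [set y | s < y < t]).
by rewrite -set_itvoo; exact: measurable_itv.
Qed.

Let open_annulus_fin s t : (mu (open_annulus s t) < +oo)%E.
Proof.
apply: le_lt_trans (disc_mass_fin mu_lf t); apply: le_measure; rewrite ?inE//.
- exact: measurable_disc.
- by move=> w /= /andP[_ /ltW].
Qed.

(** The potential is cut off by a strict inequality, the principal value by a weak one. A thin open
    annulus of small mass fills the gap between the set s < |zeta| and the set s' <= |zeta|. *)
Let open_annulus_small s s1 (e : R) : s < s1 -> 0 < e ->
  exists2 s', s < s' < s1 & (mu (open_annulus s s') <= e%:E)%E.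
Proof.
(* The denominator starts at 2, so that already the first outer radius lies strictly below s1. *)
move=> ss1 e0; pose F n := open_annulus s (s + (s1 - s) / n.+2%:R).
have F0 : \bigcap_n F n = set0.
  apply/seteqP; split=> // w Fw; have := Fw 0 I; rewrite /F/= => /andP[sw _].
  have ms : 0 < modC w - s by rewrite subr_gt0.
  pose n := Num.bound ((s1 - s) / (modC w - s)).
  have := Fw n I; rewrite /F/= => /andP[_].
  rewrite -ltrBlDl ltr_pdivlMr ?ltr0n// mulrC -ltr_pdivlMr// => h.
  have h0 : 0 <= (s1 - s) / (modC w - s).
    by rewrite divr_ge0 ?subr_ge0// ltW.
  have := lt_trans h (archi_boundP h0); rewrite -/n ltr_nat.
  by rewrite ltnNge -addn2 leq_addr.
have cvgF : (mu (F n) @[n --> \oo] --> 0)%E.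
  rewrite -(measure0 mu) -F0; apply: nonincreasing_cvg_mu.
  - exact: open_annulus_fin.
  - by move=> n; exact: mopen.
  - by rewrite F0.
  - move=> m n mn; apply/subsetPset => w; rewrite /F /open_annulus /= => /andP[sw wn]; rewrite sw/=.
    apply: (lt_le_trans wn); rewrite lerD2l; apply: ler_wpM2l; first by rewrite subr_ge0 ltW.
    by rewrite lef_pV2 ?posrE ?ltr0n// ler_nat.
have [n muF] : exists n, (mu (F n) <= e%:E)%E.
  have /fine_cvgP[Ffin] := cvgF; move/cvgr0Pnorm_le => /(_ _ e0) Fe.
  have [n _ /(_ n (leqnn n))[fn en]] : \forall n \near \oo,
      mu (F n) \is a fin_num /\ `|fine (mu (F n))| <= e.
    by near=> n; split; near: n.
  exists n; rewrite -(fineK fn) lee_fin; exact: le_trans (ler_norm _) en.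
exists (s + (s1 - s) / n.+2%:R) => //.
have s10 : 0 < s1 - s by rewrite subr_gt0.
rewrite ltrDl divr_gt0 ?ltr0n//= -ltrBrDl ltr_pdivrMr ?ltr0n//.
by rewrite ltr_pMr// ltr1n.
Unshelve. all: by end_near. Qed.

(** The integral is the difference of those over s < |zeta| <= 1 and t < |zeta| <= 1. Each is
    arbitrarily close to the real part of z times a principal value truncated at a slightly larger
    radius, and two such values differ by at most e. *)
Lemma linear_part_annulus (e s1 s t : R) :
  (forall x y, 0 < x -> x < s1 -> 0 < y -> y < s1 ->
     modC (pv_truncated mu x - pv_truncated mu y) <= e) ->
  s1 <= 1 -> 0 < s -> s < t -> t < s1 ->
  `|Rintegral mu (annulus s t) linear_part| <= modC z * e.
Proof.
move=> pve s11 s0 st ts1.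
have t0 : 0 < t := lt_trans s0 st.
pose q x := Rintegral mu (annulus x 1) linear_part.
have qE : Rintegral mu (annulus s t) linear_part = q s - q t.
  apply/eqP; rewrite eq_sym subr_eq addrC; apply/eqP.
  rewrite -Rintegral_setU//.
  - congr (Rintegral mu _ _); apply/seteqP; split=> w; rewrite /annulus/=.
      move=> /andP[sw w1]; by case: (leP (modC w) t) => _; [right; rewrite sw|left; rewrite w1].
    move=> [/andP[tw ->]|/andP[-> wt]].
      by rewrite (lt_trans st).
    by rewrite (le_trans wt)// (le_trans (ltW ts1)).
  - exact: measurable_annulus.
  - exact: measurable_annulus.
  - apply: (@integrable_linear_part _ s 1) => //.
      by apply: measurableU; exact: measurable_annulus.
    move=> w [] /= /andP[h1 h2].
      by rewrite h2 (ltW (lt_trans st h1)).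
    by rewrite (ltW h1) (le_trans h2)// (le_trans (ltW ts1)).
  - by apply/disj_setPS => w [] /= /andP[tw _] /andP[_]; rewrite leNgt tw.
have approx x d : 0 < x -> x < s1 -> 0 < d -> exists2 y, x < y < s1 &
    `|q x - Re (z * pv_truncated mu y)| <= modC z / x * d.
  move=> x0 xs1 d0; have [y /andP[xy ys1] muy] := open_annulus_small xs1 d0.
  exists y; first by rewrite xy.
  have y0 := lt_trans x0 xy.
  rewrite -Rintegral_linear_part//.
  have -> : q x = Rintegral mu (closed_annulus y) linear_part +
      Rintegral mu (open_annulus x y) linear_part.
    rewrite -Rintegral_setU//.
    - congr (Rintegral mu _ _); apply/seteqP; split=> w; rewrite /annulus/=.
        move=> /andP[xw w1]; by case: (leP y (modC w)) => wy; [left|right]; apply/andP.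
      move=> [] /= /andP[h1 h2].
        by rewrite h2 (lt_le_trans xy).
      by rewrite h1 (le_trans (ltW h2))// (le_trans (ltW ys1)).
    - apply: (@integrable_linear_part _ x 1) => //; first exact: measurableU.
      move=> w [] /= /andP[h1 h2].
        by rewrite h2 (le_trans (ltW xy)).
      by rewrite (ltW h1) (le_trans (ltW h2))// (le_trans (ltW ys1)).
    - by apply/disj_setPS => w [] /= /andP[h _] /andP[_]; rewrite ltNge h.
  rewrite addrC addKr.
  have io : mu.-integrable (open_annulus x y) (EFin \o linear_part).
    apply: (@integrable_linear_part _ x y) => // w /= /andP[h1 h2].
    by rewrite !ltW.
  apply: (le_trans (le_normr_Rintegral (mopen x y) io)).
  have mfin : mu (open_annulus x y) \is a fin_num.
    by rewrite ge0_fin_numE// open_annulus_fin.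
  apply: (@le_trans _ _ (Rintegral mu (open_annulus x y) (fun=> modC z / x))).
    apply: le_Rintegral => //.
    - apply: (@bounded_integrable _ _ y (modC z / x)) => //.
      + apply: (measurableT_comp (@normr_measurable R setT)).
        exact: measurable_linear_part.
      + by move=> w /= /andP[_ /ltW].
      + move=> w /= /andP[h1 _]; rewrite normr_id.
        by apply: linear_part_le => //; exact: ltW.
    - apply: (@bounded_integrable _ _ y (modC z / x)) => //.
      + by move=> w /= /andP[_ /ltW].
      + by move=> w _; rewrite ger0_norm// divr_ge0 ?modC_ge0// ltW.
    - by move=> w /= /andP[h1 _]; apply: linear_part_le => //; exact: ltW.
  rewrite Rintegral_cst// ler_wpM2l ?divr_ge0 ?modC_ge0 ?(ltW x0)//.
  by rewrite -lee_fin fineK.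
rewrite qE; apply/ler_addgt0Pr => d d0.
have zs0 : 0 <= modC z by exact: modC_ge0.
(* Each of the two approximations then costs at most d / 2; the summand 1 keeps the denominator
   positive when z = 0. *)
pose d1 := d / (2 * (modC z / s + 1)).
have s1V : 0 <= modC z / s by rewrite divr_ge0// ltW.
have d10 : 0 < d1 by apply: divr_gt0 => //; lra.
have [y /andP[xy ys1] qy] := approx s d1 s0 (lt_trans st ts1) d10.
have [y' /andP[xy' ys1'] qy'] := approx t d1 t0 ts1 d10.
have bs x : s <= x -> modC z / x * d1 <= d / 2.
  move=> sx; have x0 := lt_le_trans s0 sx.
  apply: (@le_trans _ _ (modC z / s * d1)).
    by rewrite ler_pM2r// ler_wpM2l// lef_pV2 ?posrE.
  apply: (@le_trans _ _ ((modC z / s + 1) * d1)); first by rewrite ler_pM2r// lerDl.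
  rewrite /d1 le_eqVlt; apply/orP; left; apply/eqP; field.
  by rewrite -/(modC z / s) gt_eqF//= gt_eqF//; nra.
have := pve y y' (lt_trans s0 xy) ys1 (lt_trans t0 xy') ys1'.
set P := pv_truncated mu y in qy *; set P' := pv_truncated mu y' in qy' *.
move=> hP; have hR : `|Re (z * P) - Re (z * P')| <= modC z * e.
  have -> : Re (z * P) - Re (z * P') = Re (z * (P - P')).
    by rewrite mulrBr; case: (z * P) => ? ?; case: (z * P').
  rewrite (le_trans (Re_le_modC _))// modCM; exact: ler_wpM2l.
have := bs s (lexx s); have := bs t (ltW st).
move: qy qy' hR; rewrite !ler_norml.
by do 3 move=> /andP[? ?]; move=> ? ?; apply/andP; split; lra.
Qed.

End LinearPart.

Lemma pv_cauchy : cvg (pv_truncated mu eps @[eps --> (0 : R)^'+]) ->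
  forall e : R, 0 < e -> exists2 s1, 0 < s1 <= 1 &
    forall x y, 0 < x -> x < s1 -> 0 < y -> y < s1 ->
    modC (pv_truncated mu x - pv_truncated mu y) <= e.
Proof.
move=> /cvg_ex[l] + e e0.
move/cvgrPdist_lt => /(_ ((e / 2)%:C)%C); rewrite ltcE/= eqxx/= divr_gt0// => /(_ isT).
move=> [s /= s0 hs]; exists (Num.min s 1).
  by rewrite lt_min s0 ltr01/= ge_min lexx orbT.
have h x : 0 < x -> x < Num.min s 1 -> modC (l - pv_truncated mu x) < e / 2.
  rewrite lt_min => x0 /andP[xs _]; have := hs x; rewrite /= sub0r normrN gtr0_norm//.
  by move=> /(_ xs x0); rewrite normE_modC ltcR.
have tri (a b c : R[i]) : modC (a - b) <= modC (c - b) + modC (c - a).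
  have -> : a - b = (c - b) - (c - a) by ring.
  by rewrite (le_trans (modCD _ _))// modCN.
move=> x y x0 xs y0 ys; refine (le_trans (tri (pv_truncated mu x) (pv_truncated mu y) l) _).
have := h x x0 xs; have := h y y0 ys => hy hx.
rewrite [leRHS]splitr; apply: lerD; exact: ltW.
Qed.

End PotentialLimit.

(** * Uniform convergence of the truncated potentials *)

Section PotentialBound.
Variable R : realType.
Local Notation Re := (@complex.Re R).
Local Notation Im := (@complex.Im R).

Variable mu : {sigma_finite_measure set (borelC R) -> \bar R}.
Hypothesis mu_lf : locally_finite mu.
Hypothesis mu_tail : (\int[mu]_(z in [set z : borelC R | (1 <= modC z)%R])
          (modC z ^- 2)%R%:E < +oo)%E.
Hypothesis mu_pv : cvg (pv_truncated mu eps @[eps --> (0 : R)^'+]).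
Variables (L rho : R).
Hypotheses (L0 : 0 <= L) (rho0 : 0 < rho).
Hypothesis massL : forall t, 0 < t -> t <= rho -> (disc_mass mu t <= (L * t)%:E)%E.

Definition log_part (z : R[i]) (w : borelC R) : R := ln (modC (1 - z / (w : R[i]))).

Lemma measurable_log_part z : measurable_fun setT (log_part z).
Proof.
apply: (measurableT_comp (@measurable_ln R)).
rewrite (_ : (fun w : borelC R => _) = (fun w => Num.sqrt
  ((1 - Re (z / (w : R[i]))) ^+ 2 + (0 - Im (z / (w : R[i]))) ^+ 2))); last first.
  apply/funext => w; rewrite modCE; congr Num.sqrt.
  by case: (z / _) => x y /=.
apply: (measurableT_comp (@measurable_sqrt R)).
apply: measurable_funD; apply: measurable_funX; apply: measurable_funB => //.
  exact: measurable_linear_part.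
rewrite (_ : (fun w : borelC R => _) =
    (fun w => Re z * Im (w : R[i])^-1 + Im z * Re (w : R[i])^-1)); last first.
  by apply/funext => w; rewrite complex_ImM.
by apply: measurable_funD; apply: measurable_funM => //;
  [exact: measurable_Im_inv|exact: measurable_Re_inv].
Qed.

Section Split.
Variables (z : R[i]) (eps e2 : R).
Hypotheses (eps0 : 0 < eps) (eps_e2 : eps < e2) (e2z : 2 * e2 <= modC z).

Let e20 : 0 < e2. Proof. exact: lt_trans eps_e2. Qed.

Lemma annulus_modC w : annulus eps e2 w -> 2 <= modC (z / (w : R[i])).
Proof.
move=> /andP[ew we]; have w0 := lt_trans eps0 ew.
rewrite modCM modCV ler_pdivlMr//; apply: le_trans e2z.
by rewrite ler_pM2l.
Qed.

(** For |zeta| <= |z| / 2 the quotient has modulus at least 2, so the kernel has no pole on the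
    annulus and its logarithm is nonnegative. *)
Lemma annulus_modC1B w : annulus eps e2 w -> 1 <= modC (1 - z / (w : R[i])).
Proof.
move=> /annulus_modC h; have := modCD (1 - z / (w : R[i])) (-1).
rewrite addrC addrA addNr sub0r !modCN modC1; lra.
Qed.

Lemma log_part_ge0 w : annulus eps e2 w -> 0 <= log_part z w.
Proof. by move=> /annulus_modC1B; exact: ln_ge0. Qed.

Lemma log_part_le w : annulus eps e2 w ->
  log_part z w <= 2 * Num.sqrt (modC z) * (Num.sqrt (modC w))^-1.
Proof.
move=> aw; have h1 := annulus_modC1B aw.
have /andP[ew we] := aw; have w0 := lt_trans eps0 ew.
apply: (@le_trans _ _ (ln (1 + modC (z / (w : R[i]))))).
  apply: ln_mono; first by rewrite (lt_le_trans ltr01).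
  by rewrite (le_trans (modCD _ _))// modCN modC1.
apply: (le_trans (ln1D_le_sqrt (modC_ge0 _))).
by rewrite modCM modCV sqrtrM ?modC_ge0// sqrtrV ?modC_ge0// mulrA.
Qed.

Lemma kernelH_annulus w : annulus eps e2 w ->
  kernelH (z / (w : R[i]))%R = (log_part z w + linear_part z w)%:E.
Proof.
move=> aw; rewrite kernelH_neq1//; apply/eqP => zw1.
by have := annulus_modC1B aw; rewrite zw1 subrr [modC 0]ComplexField.Normc.normc0; lra.
Qed.

Lemma integrable_log_part : mu.-integrable (annulus eps e2) (EFin \o log_part z).
Proof.
apply: (@bounded_integrable _ _ mu_lf _ _ e2 (2 * Num.sqrt (modC z) * (Num.sqrt eps)^-1)).
- exact: measurable_annulus.
- exact: measurable_log_part.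
- by move=> w /andP[].
- move=> w aw; rewrite ger0_norm ?log_part_ge0// (le_trans (log_part_le aw))//.
  have /andP[ew _] := aw.
  rewrite ler_wpM2l ?mulr_ge0 ?sqrtr_ge0// lef_pV2 ?posrE ?sqrtr_gt0//.
    by rewrite ler_wsqrtr// ltW.
  exact: lt_trans ew.
Qed.

Lemma integrable_linear_annulus : mu.-integrable (annulus eps e2) (EFin \o linear_part z).
Proof.
apply: (@integrable_linear_part _ _ mu_lf _ _ eps e2) => //; first exact: measurable_annulus.
by move=> w /andP[ew ->]; rewrite ltW.
Qed.

Definition annulus_shift : R :=
  Rintegral mu (annulus eps e2) (log_part z) +
  Rintegral mu (annulus eps e2) (linear_part z).

Lemma integral_kernelH_annulus :
  (\int[mu]_(w in annulus eps e2) kernelH (z / (w : R[i]))%R = annulus_shift%:E)%E.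
Proof.
have -> : (\int[mu]_(w in annulus eps e2) kernelH (z / (w : R[i]))%R =
    \int[mu]_(w in annulus eps e2) ((log_part z w)%:E + (linear_part z w)%:E))%E.
  by apply: eq_integral => w; rewrite inE => aw; rewrite kernelH_annulus.
have il := integrable_log_part; have ir := integrable_linear_annulus.
rewrite (integralD (@measurable_annulus R eps e2) il ir) EFinD; congr (_ + _)%E;
  by rewrite /Rintegral fineK//; apply: integrable_fin_num => //; exact: measurable_annulus.
Qed.

Lemma truncated_split :
  truncated mu eps z = (truncated mu e2 z + annulus_shift%:E)%E.
Proof.
have mp : measurable_fun [set: borelC R] (fun w : borelC R => posH (z / (w : R[i]))).
  by apply: measurable_kernel_mul; exact: comp_measurable_posH.
have mn : measurable_fun [set: borelC R] (fun w : borelC R => negH (z / (w : R[i]))).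
  by apply: measurable_kernel_mul; exact: comp_measurable_negH.
have p0 (w : borelC R) : (0 <= posH (z / (w : R[i]))%R)%E by exact: posH_ge0.
have n0 (w : borelC R) : (0 <= negH (z / (w : R[i]))%R)%E by exact: negH_ge0.
have pf := partial_posH_fin mu_lf mu_tail z eps0.
have := integral_kernelH_annulus; rewrite integralE.
have -> : (\int[mu]_(w in annulus eps e2) (fun w : borelC R => kernelH (z / (w : R[i]))%R)^\+ w
   = \int[mu]_(w in annulus eps e2) posH (z / (w : R[i]))%R)%E.
  by apply: eq_integral => w _; rewrite funeposE.
have -> : (\int[mu]_(w in annulus eps e2) (fun w : borelC R => kernelH (z / (w : R[i]))%R)^\- w
   = \int[mu]_(w in annulus eps e2) negH (z / (w : R[i]))%R)%E.
  by apply: eq_integral => w _; rewrite funenegE.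
rewrite !truncatedE; move: pf; rewrite /partial.
rewrite (integral_codisc_split mu (ltW eps_e2) p0 mp) (integral_codisc_split mu (ltW eps_e2) n0 mn).
have : (0 <= \int[mu]_(w in annulus eps e2) posH (z / (w : R[i]))%R)%E.
  exact: integral_ge0.
set p := integral mu (annulus _ _) (fun w => posH _).
set n := integral mu (annulus _ _) (fun w => negH _).
have P0 : (0 <= \int[mu]_(w in [set w | (e2 < modC w)%R]) posH (z / (w : R[i]))%R)%E.
  exact: integral_ge0.
have N0 : (0 <= \int[mu]_(w in [set w | (e2 < modC w)%R]) negH (z / (w : R[i]))%R)%E.
  exact: integral_ge0.
have n_0 : (0 <= n)%E by exact: integral_ge0.
move: P0 N0 n_0.
set P := integral mu _ (fun w => posH _); set N := integral mu _ (fun w => negH _).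
move: p n P N annulus_shift => p n P N s.
(* P and p are finite as positive parts, and n because p - n is real. Only N can be infinite, and
   then both truncations are -oo. *)
case: P => [P| |]//; case: p => [p| |]//; case: n => [n| |]//; case: N => [N| |]//= _ _ _ _ _ [<-] //.
by rewrite -!EFinD; congr EFin; ring.
Qed.

Lemma Rintegral_log_part_ge0 : 0 <= Rintegral mu (annulus eps e2) (log_part z).
Proof. by apply: Rintegral_ge0 => w; exact: log_part_ge0. Qed.

Lemma Rintegral_log_part_le : e2 <= rho ->
  Rintegral mu (annulus eps e2) (log_part z) <= 8 * L * Num.sqrt (modC z) * Num.sqrt e2.
Proof.
move=> e2rho; have il := integrable_log_part.
rewrite -lee_fin /Rintegral fineK; last by apply: integrable_fin_num => //; exact: measurable_annulus.
apply: (@le_trans _ _ ((2 * Num.sqrt (modC z))%:E *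
    \int[mu]_(w in annulus eps e2) invsqrt w)%E).
  rewrite -ge0_integralZl_EFin//; last 3 first.
  - exact: measurable_annulus.
  - by move=> w _; exact: invsqrt_ge0.
  - by apply: measurable_funTS; exact: measurable_invsqrt.
  apply: ge0_le_integral; first exact: measurable_annulus.
  - by move=> w aw; rewrite lee_fin log_part_ge0.
  - by apply/measurable_funTS/measurable_EFinP; exact: measurable_log_part.
  - by apply: measurable_funTS; apply: measurable_funeM; exact: measurable_invsqrt.
  - by move=> w aw; rewrite -EFinM lee_fin log_part_le.
apply: (@le_trans _ _ ((2 * Num.sqrt (modC z))%:E * (4 * L * Num.sqrt e2)%:E)%E).
  rewrite lee_wpmul2l ?lee_fin ?mulr_ge0 ?sqrtr_ge0//.
  exact: (invsqrt_annulus L0 massL eps0 e20 e2rho).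
by rewrite -EFinM lee_fin le_eqVlt; apply/orP; left; apply/eqP; ring.
Qed.

End Split.

(** The linear part of the shift is at most |z| times the oscillation of the principal value, the
    logarithmic part at most 8 L sqrt(|z| e2); both are uniform on |z| <= r. *)
Lemma truncated_close (r d : R) : 0 < d -> exists2 e1, 0 < e1 &
  forall z eps e2, 0 < eps -> eps < e2 -> e2 < e1 -> 2 * e2 <= modC z -> modC z <= r ->
  exists2 c : R, `|c| <= d & truncated mu eps z = (truncated mu e2 z + c%:E)%E.
Proof.
move=> d0; have [r0|r0] := ltP r 0.
  exists 1 => // z eps e2 ? ? ? ? zr; exfalso.
  by have := modC_ge0 z; rewrite leNgt (le_lt_trans zr).
pose e := d / (2 * (r + 1)).
have e0 : 0 < e by apply: divr_gt0 => //; lra.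
have [s1 /andP[s10 s11] hs] := pv_cauchy mu_pv e0.
(* With sqrt(e2) <= d / B the logarithmic part is at most d / 2; the summand 1 covers L = 0 and r =
   0. *)
pose B := 16 * L * Num.sqrt r + 1.
have B0 : 0 < B by rewrite ltr_wpDl// !mulr_ge0// sqrtr_ge0.
pose e1 := Num.min s1 (Num.min rho ((d / B) ^+ 2)).
exists e1; first by rewrite !lt_min s10 rho0 exprn_gt0// divr_gt0.
move=> z eps e2 eps0 epse e2e1 e2z zr.
move: e2e1; rewrite !lt_min => /andP[e2s /andP[e2rho e2B]].
have e20 := lt_trans eps0 epse.
exists (annulus_shift z eps e2); last exact: truncated_split.
have lin := linear_part_annulus mu_lf z hs s11 eps0 epse e2s.
have lg0 : 0 <= Rintegral mu (annulus eps e2) (log_part z).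
  exact: Rintegral_log_part_ge0.
have lg : Rintegral mu (annulus eps e2) (log_part z) <=
    8 * L * Num.sqrt (modC z) * Num.sqrt e2.
  by apply: Rintegral_log_part_le => //; exact: ltW.
have z0 := modC_ge0 z.
have h1 : modC z * e <= d / 2.
  apply: (@le_trans _ _ ((r + 1) * e)); first by rewrite ler_pM2r//; lra.
  by rewrite /e le_eqVlt; apply/orP; left; apply/eqP; field; rewrite gt_eqF//; lra.
have h2 : 8 * L * Num.sqrt (modC z) * Num.sqrt e2 <= d / 2.
  have sq : Num.sqrt e2 <= d / B.
    rewrite -[leRHS]ger0_norm ?divr_ge0 ?(ltW B0) ?(ltW d0)// -sqrtr_sqr.
    by rewrite ler_wsqrtr// ltW.
  apply: (@le_trans _ _ (8 * L * Num.sqrt r * (d / B))).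
    apply: ler_pM => //; rewrite ?mulr_ge0 ?sqrtr_ge0//.
    by rewrite ler_wpM2l ?mulr_ge0// ler_wsqrtr.
  rewrite mulrA ler_pdivrMr// /B.
  have : 0 <= L * Num.sqrt r by rewrite mulr_ge0 ?sqrtr_ge0.
  by nra.
rewrite /annulus_shift; move: lin; rewrite !ler_norml => /andP[? ?].
by apply/andP; split; lra.
Qed.

Lemma cvg_truncated z : 0 < modC z -> cvg (truncated mu eps z @[eps --> (0 : R)^'+]).
Proof.
move=> z0; apply: ereal_cauchy_cvg => d d0.
have [e1 e10 he] := truncated_close (modC z) d0.
pose e2 := Num.min (e1 / 2) (modC z / 2).
have e20 : 0 < e2 by rewrite lt_min !divr_gt0.
have e2e1 : e2 < e1 by rewrite gt_min; apply/orP; left; lra.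
have e2z : 2 * e2 <= modC z.
  by have : e2 <= modC z / 2 by [rewrite ge_min lexx orbT]; lra.
exists e2 => // x x0 xe; exact: he.
Qed.

(** This one-sided estimate serves twice: at z it bounds u(z), and at real points it bounds u_eps^-
    by u^- + d. The second use needs one e1 for a whole interval of points. *)
Lemma potential_le (r d : R) : 0 < d -> exists2 e1, 0 < e1 &
  forall z e2, 0 < e2 -> e2 < e1 -> 2 * e2 <= modC z -> modC z <= r ->
  (potential mu z <= truncated mu e2 z + d%:E)%E.
Proof.
move=> d0; have [e1 e10 he] := truncated_close r d0.
exists e1 => // z e2 e20 e2e1 e2z zr.
have z0 : 0 < modC z by rewrite (lt_le_trans _ e2z)// mulr_gt0.
apply: (lime_le (cvg_truncated z0)); near=> x.
have x0 : 0 < x by near: x; exact: nbhs_right_gt.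
have xe : x < e2 by near: x; exact: nbhs_right_lt.
have [c cd ->] := he z x e2 x0 xe e2e1 e2z zr.
by rewrite leeD2l// lee_fin (le_trans (ler_norm _)).
Unshelve. all: by end_near. Qed.

End PotentialBound.

(** * The main bound *)

(** The integral of a nonnegative function is a supremum over the simple functions below it, hence
    monotone without measurability. It allows comparison with [delta]. *)
Lemma ge0_le_integral_nonmeas d (T : measurableType d) (R : realType)
    (mu : {measure set T -> \bar R}) (D : set T) (f g : T -> \bar R) :
  (forall x, D x -> (0 <= f x)%E) -> (forall x, D x -> (f x <= g x)%E) ->
  (\int[mu]_(x in D) f x <= \int[mu]_(x in D) g x)%E.
Proof.
move=> f0 fg; have g0 x : D x -> (0 <= g x)%E.
  by move=> Dx; exact: le_trans (f0 x Dx) (fg x Dx).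
rewrite !ge0_integralE//; apply: ge_ereal_sup => _ [h hf <-]; apply: ereal_sup_ubound; exists h => // x.
apply: (le_trans (hf x)); rewrite /patch; case: ifPn => //; rewrite inE; exact: fg.
Qed.

Section MainBound.
Variable R : realType.
Local Notation Re := (@complex.Re R).
Local Notation Im := (@complex.Im R).
Local Notation leb := (@lebesgue_measure R).

Variable mu : {sigma_finite_measure set (borelC R) -> \bar R}.
Hypothesis mu_lf : locally_finite mu.
Hypothesis mu_tail : (\int[mu]_(z in [set z : borelC R | (1 <= modC z)%R])
          (modC z ^- 2)%R%:E < +oo)%E.
Hypothesis mu_pv : cvg (pv_truncated mu eps @[eps --> (0 : R)^'+]).
Variables (L rho : R).
Hypotheses (L0 : 0 <= L) (rho0 : 0 < rho).
Hypothesis massL : forall t, 0 < t -> t <= rho -> (disc_mass mu t <= (L * t)%:E)%E.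

Definition delta_integral : \bar R :=
  (\int[leb]_(t in [set t : R | (0 < t)%R]) (delta mu t * (t ^- 2)%R%:E))%E.

Local Notation D eps := ([set w : borelC R | (eps < modC w)%R]).

(** With the squared mass beyond eta at most M + 4 L / eta, the psi part is 24 (r / eta) (2 eta^2 (M
    + 4 L / eta) + 24 L eta). The term in M keeps a factor eta and can be made small, and L receives
    24 (8 + 24) = 768. The dyadic form of eta comes from [sqmass_dyadic]. *)
Lemma integral_error_term (r eta eps M : R) k : 0 < r -> eta = rho / 2 ^+ k ->
  0 < eps -> eps <= eta -> sqmass mu rho = M%:E ->
  (\int[mu]_(w in D eps) (error_term r eta ((w : R[i])^-1)%R)%:E <=
   (590 * r)%:E * \int[leb]_(t in [set t : R | (0 < t)%R])
      (angular_count mu eps t * (t ^- 2)%R%:E)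
   + (48 * r * eta * M + 768 * r * L)%:E)%E.
Proof.
move=> r0 etaE eps0 ee ME.
have p2 : (0 : R) < 2 ^+ k by rewrite exprn_gt0.
have eta0 : 0 < eta by exact: lt_le_trans ee.
have eta_rho : eta <= rho.
  by rewrite etaE ler_pdivrMr// ler_peMr ?(ltW rho0)// exprn_ege1// ler1n.
have mI : measurable_fun (D eps) (fun w : borelC R => (`|Im ((w : R[i])^-1)%R|)%:E).
  apply: measurable_funTS; apply/measurable_EFinP.
  apply: (measurableT_comp (@normr_measurable R setT)); exact: measurable_Im_inv.
have mP : measurable_fun (D eps) (fun w : borelC R => (psi (eta * Re ((w : R[i])^-1)%R))%:E).
  by apply: measurable_funTS; exact: measurable_psi_Re.
have mD := measurable_codisc eps.
have [C1 C1E] : exists c, c = 295 * r by exists (295 * r).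
have [C2 C2E] : exists c, c = 24 * (r / eta) by exists (24 * (r / eta)).
have c1 : 0 <= C1 by rewrite C1E; apply: mulr_ge0; [exact: ler0n|exact: ltW].
have c2 : 0 <= C2 by rewrite C2E; apply: mulr_ge0; [exact: ler0n|rewrite divr_ge0// ltW].
have i0 (w : borelC R) : D eps w -> (0 <= (`|Im ((w : R[i])^-1)%R|)%:E)%E by [].
have s0 (w : borelC R) : D eps w -> (0 <= (psi (eta * Re ((w : R[i])^-1)%R))%:E)%E.
  by move=> _; rewrite lee_fin psi_ge0.
have -> : (\int[mu]_(w in D eps) (error_term r eta ((w : R[i])^-1)%R)%:E =
   C1%:E * \int[mu]_(w in D eps) (`|Im ((w : R[i])^-1)%R|)%:E +
   C2%:E * \int[mu]_(w in D eps) (psi (eta * Re ((w : R[i])^-1)%R))%:E)%E.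
  rewrite -(ge0_integralZl_EFin mu mD i0 mI c1) -(ge0_integralZl_EFin mu mD s0 mP c2).
  rewrite -ge0_integralD//.
  - apply: eq_integral => w _.
    by rewrite /error_term (mulrA 295) -C1E -C2E -!EFinM -EFinD.
  - by move=> w _; rewrite mule_ge0// lee_fin.
  - exact: measurable_funeM.
  - by move=> w _; rewrite mule_ge0// lee_fin// psi_ge0.
  - exact: measurable_funeM.
apply: leeD.
  have := integral_Im_inv_le mu eps.
  have c1' : (0 <= C1%:E)%E by rewrite lee_fin.
  move=> /(lee_wpmul2l c1') /le_trans; apply.
  have -> : 590 * r = C1 * 2 by rewrite C1E; ring.
  by rewrite muleA -EFinM.
have := psi_integral L0 massL eps0 ee eta_rho.
have sq : (sqmass mu eta <= (M + 4 * L / eta)%:E)%E.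
  have := sqmass_dyadic L0 rho0 massL k; rewrite -etaE ME -EFinD.
  have -> // : 4 * L * 2 ^+ k / rho = 4 * L / eta.
  by rewrite etaE; field; rewrite !gt_eqF.
have c2' : (0 <= C2%:E)%E by rewrite lee_fin.
move=> /(lee_wpmul2l c2') /le_trans; apply.
apply: (@le_trans _ _ (C2%:E * ((2 * eta ^+ 2 * (M + 4 * L / eta) + 24 * L * eta)%:E))%E).
  apply: lee_wpmul2l => //; rewrite [X in (_ <= X)%E]EFinD leeD2r// [X in (_ <= X)%E]EFinM.
  by rewrite lee_wpmul2l// lee_fin mulr_ge0// sqr_ge0.
rewrite -EFinM lee_fin C2E le_eqVlt; apply/orP; left; apply/eqP.
by field; rewrite gt_eqF.
Qed.

Lemma angular_count_le eps t : (angular_count mu eps t <= levin_tsuji mu t)%E.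
Proof.
have mA : measurable [set z : borelC R | t^-1 <= `|Im ((z : R[i])^-1)|].
  rewrite (_ : [set z : borelC R | _] = [set: borelC R] `&`
      (fun z : borelC R => Im (z : R[i])^-1 : R) @^-1` (~` `]- t^-1, t^-1[%classic)).
    by apply: measurable_Im_inv => //; exact: measurableC.
  rewrite setTI; apply/seteqP; split=> w /=; rewrite in_itv/= -ltr_norml.
    by rewrite ltNge => ->.
  by move/negP; rewrite -leNgt.
apply: le_measure; rewrite ?inE//.
  by apply: measurableI => //; exact: measurable_codisc.
Qed.

(** From u <= u_eps + d follows u_eps^- <= u^- + d, once at t and once at - t. The left-hand side is
    thus a measurable nonnegative minorant of the u^- terms of [delta]. *)
Lemma truncated_neg_le (eps t d : R) :
  (potential mu t%:C%C <= truncated mu eps t%:C%C + d%:E)%E ->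
  (potential mu (- t)%:C%C <= truncated mu eps (- t)%:C%C + d%:E)%E ->
  0 <= d ->
  (maxe (truncated_neg mu eps t - (2 * d)%:E) 0 <=
   (potential mu)^\- t%:C%C + (potential mu)^\- (- t)%:C%C)%E.
Proof.
move=> h1 h2 d0; rewrite ge_max adde_ge0 ?funeneg_ge0// andbT.
have key (u v : \bar R) : (u <= v + d%:E)%E -> (maxe (- v) 0 <= maxe (- u) 0 + d%:E)%E.
  move=> uv; rewrite ge_max; apply/andP; split; last first.
    by rewrite adde_ge0// ?lee_fin// le_max lexx orbT.
  rewrite -leeBlDr//; apply: (@le_trans _ _ (- u)%E); last by rewrite le_max lexx.
  by rewrite -fin_num_oppeD// leeN2.
rewrite leeBlDr// /truncated_neg mul1r mulN1r !funenegE.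
have := leeD (key _ _ h1) (key _ _ h2).
by rewrite addeACA -EFinD (_ : d + d = 2 * d)//; ring.
Qed.

(** The truncation error d is independent of eta, so it can later be chosen small against the factor
    1 / eta; M depends on rho alone. *)
Lemma core_bound z (eta d M : R) k : 0 < d -> eta = rho / 2 ^+ k -> eta < modC z / 2 ->
  sqmass mu rho = M%:E ->
  (potential mu z <= (590 * modC z)%:E * delta_integral +
    (d + 52 * modC z * d / eta + 48 * modC z * eta * M + 768 * modC z * L)%:E)%E.
Proof.
move=> d0 etaE eta_z ME; set r := modC z in eta_z *.
have p2 : (0 : R) < 2 ^+ k by rewrite exprn_gt0.
have eta0 : 0 < eta by rewrite etaE divr_gt0.
have r0 : 0 < r by rewrite -(@pmulr_lgt0 _ 2^-1)// (lt_trans eta0).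
have eta_r : eta < r by rewrite (lt_trans eta_z)// ltr_pdivrMr// ltr_pMr// ltr1n.
have [e1 e10 he] := potential_le mu_lf mu_tail mu_pv L0 rho0 massL r d0.
(* The bound eta / 2 gives 2 eps <= eta, so that u <= u_eps + d holds at every point with eta <= |v|
   <= r. *)
pose eps := Num.min (e1 / 2) (eta / 2).
have eps0 : 0 < eps by rewrite lt_min !divr_gt0.
have epse1 : eps < e1.
  by rewrite gt_min; apply/orP; left; rewrite ltr_pdivrMr// ltr_pMr// ltr1n.
have epseta : 2 * eps <= eta.
  by rewrite mulrC -ler_pdivlMr// ge_min lexx orbT.
have epseta' : eps <= eta.
  by apply: le_trans epseta; rewrite ler_peMl ?(ltW eps0)// ler1n.
have pe v : eta <= modC v -> modC v <= r ->
    (potential mu v <= truncated mu eps v + d%:E)%E.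
  by move=> ev vr; apply: he => //; exact: le_trans ev.
pose I := (`[eta, r]%classic : set (measurableTypeR R)).
have mI : measurable I by exact: measurable_itv.
pose pos := ([set t : R | 0 < t] : set (measurableTypeR R)).
have mpos : measurable pos by rewrite /pos -set_itvoy; exact: measurable_itv.
have It0 t : I t -> 0 < t.
  by rewrite /I/= in_itv/= => /andP[h _]; exact: lt_le_trans h.
pose q (t : R) : \bar R := ((t ^- 2)%:E * maxe (truncated_neg mu eps t - (2 * d)%:E) 0)%E.
have q0 t : (0 <= q t)%E.
  by rewrite mule_ge0 ?lee_fin ?invr_ge0 ?sqr_ge0// le_max lexx orbT.
have mq : measurable_fun setT q.
  apply: emeasurable_funM.
    by apply/measurable_EFinP; exact: measurable_invsqr.
  apply: measurable_maxe => //; apply: emeasurable_funB => //.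
  exact: measurable_truncated_neg.
pose Q := (\int[leb]_(t in I) q t)%E.
have Q0 : (0 <= Q)%E by exact: integral_ge0.
pose N := (\int[leb]_(t in pos) (angular_count mu eps t * (t ^- 2)%:E))%E.
have n0 t : (0 <= angular_count mu eps t * (t ^- 2)%:E)%E.
  by rewrite mule_ge0// lee_fin invr_ge0 sqr_ge0.
have N0 : (0 <= N)%E by exact: integral_ge0.
have mn := measurable_angular_count mu eps.
(* The two integrands together stay below [delta] over t^2 pointwise, so a single copy of the
   integral pays for both. *)
have QN : (Q + N <= delta_integral)%E.
  have -> : Q = (\int[leb]_(t in pos) (q \_ I) t)%E.
    rewrite -integral_mkcondr; congr (integral leb _ q).
    by apply/esym/setIidr => t /It0.
  rewrite -ge0_integralD//.
  - apply: ge0_le_integral_nonmeas => [t _|t /= t0].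
      by rewrite adde_ge0// /patch; case: ifP.
    have ac := angular_count_le eps t.
    have t20 : (0 <= (t ^- 2)%:E :> \bar R)%E by rewrite lee_fin invr_ge0 sqr_ge0.
    have d1 := funeneg_ge0 (potential mu) t%:C%C.
    have d2 := funeneg_ge0 (potential mu) (- t)%:C%C.
    rewrite /delta -(addeA (levin_tsuji _ _)) [X in (_ <= X)%E]muleC.
    rewrite ge0_muleDr ?adde_ge0 ?measure_ge0// [X in (X <= _)%E]addeC; apply: leeD.
      by rewrite muleC lee_wpmul2l.
    rewrite /patch; case: ifPn => [|_]; last by rewrite mule_ge0// adde_ge0.
    rewrite inE => It; rewrite /q lee_wpmul2l//.
    move: It; rewrite /I/= in_itv/= => /andP[et tr].
    apply: truncated_neg_le; last exact: ltW.
      by apply: pe; rewrite modC_real gtr0_norm.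
    by apply: pe; rewrite modC_real normrN gtr0_norm.
  - by move=> t _; rewrite /patch; case: ifP.
  - apply: measurable_funTS; apply/(measurable_restrictT _ _).1 => //.
    exact: measurable_funTS.
  - exact: measurable_funTS.
have [A AE] : exists a, a = 26 * r by exists (26 * r).
have c26 : 0 <= A by rewrite AE; apply: mulr_ge0; [exact: ler0n|exact: ltW].
(* Restores the loss 2 d in [q]: t^(-2) integrates to at most 1 / eta over I, which yields 52 r d /
   eta. *)
have S1 : (\int[leb]_(t in I) ((A * t ^- 2)%:E * truncated_neg mu eps t) <=
    A%:E * Q + (A * (2 * d) / eta)%:E)%E.
  have c52 : 0 <= A * (2 * d) by rewrite mulr_ge0// mulr_ge0// ltW.
  have mt : measurable_fun I (fun t : R => (t ^- 2)%:E : \bar R).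
    by apply/measurable_funTS/measurable_EFinP; exact: measurable_invsqr.
  have t20 (t : R) : I t -> (0 <= (t ^- 2)%:E :> \bar R)%E.
    by move=> _; rewrite lee_fin invr_ge0 sqr_ge0.
  apply: (@le_trans _ _ (\int[leb]_(t in I) (A%:E * q t + (A * (2 * d))%:E * (t ^- 2)%:E))%E).
    apply: ge0_le_integral; first exact: mI.
    - move=> t _; apply: mule_ge0; last exact: truncated_neg_ge0.
      by rewrite lee_fin mulr_ge0// invr_ge0 sqr_ge0.
    - apply: measurable_funTS; apply: emeasurable_funM; last exact: measurable_truncated_neg.
      by apply/measurable_EFinP; apply: measurable_funM => //; exact: measurable_invsqr.
    - apply: emeasurable_funD; apply: measurable_funeM => //.
      exact: measurable_funTS.
    - move=> t It; rewrite /q.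
      have -> : ((A * (2 * d))%:E * (t ^- 2)%:E = A%:E * ((t ^- 2)%:E * (2 * d)%:E))%E.
        by rewrite -!EFinM; congr EFin; ring.
      have T0 := truncated_neg_ge0 mu eps t; set T := truncated_neg _ _ _ in T0 *.
      rewrite EFinM -muleA -ge0_muleDr; last 2 first.
      + by apply: mule_ge0; [exact: t20|rewrite le_max lexx orbT].
      + by apply: mule_ge0; [exact: t20|rewrite lee_fin mulr_ge0// ltW].
      apply: lee_wpmul2l; first by rewrite lee_fin.
      rewrite -ge0_muleDr ?le_max ?lexx ?orbT//; last by rewrite lee_fin mulr_ge0// ltW.
      apply: lee_wpmul2l; first exact: t20.
      by rewrite -leeBlDr// le_max lexx.
  rewrite ge0_integralD//; last 4 first.
  - by move=> t _; rewrite mule_ge0// lee_fin.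
  - by apply: measurable_funeM; exact: measurable_funTS.
  - by move=> t It; apply: mule_ge0; [rewrite lee_fin|exact: t20].
  - exact: measurable_funeM.
  rewrite !ge0_integralZl_EFin//; last exact: measurable_funTS.
  rewrite leeD2l// integral_invsqr// -EFinM lee_fin ler_wpM2l//.
  by rewrite gerBl invr_ge0 ltW.
have [C CE] : exists a, a = 590 * r by exists (590 * r).
have AC : A <= C by rewrite AE CE ler_pM2r// ler_nat.
have tr : (truncated mu eps z <= A%:E * Q + (A * (2 * d) / eta)%:E +
    (C%:E * N + (48 * r * eta * M + 768 * r * L)%:E))%E.
  pose e : R := if 0 <= Re z then -1 else 1.
  have e1' : e = 1 \/ e = -1 by rewrite /e; case: ifP; [right|left].
  have ez : e * `|Re z| = - Re z.
    rewrite /e; case: ifPn => [zr|]; first by rewrite ger0_norm// mulN1r.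
    by rewrite -ltNge => zr; rewrite ltr0_norm// mul1r.
  have ii : (partial mu (@posH R) eps z <= partial mu (@negH R) eps z +
      (\int[leb]_(t in I) ((A * t ^- 2)%:E * truncated_neg mu eps t)
       + \int[mu]_(w in D eps) (error_term r eta ((w : R[i])^-1)%R)%:E))%E.
    rewrite AE; exact: (integrated_inequality mu_lf mu_tail (erefl r) r0 eta0 eta_z ez e1' eps0).
  have pf := partial_posH_fin mu_lf mu_tail z eps0.
  have pp := @partial_ge0 _ mu _ eps z (@posH_ge0 R).
  have pn := @partial_ge0 _ mu _ eps z (@negH_ge0 R).
  have := integral_error_term r0 etaE eps0 epseta' ME; rewrite -CE => ie.
  have := le_trans ii (leeD2l _ (leeD S1 ie)); rewrite -/N truncatedE.
  case: (partial mu (@negH R) eps z) pn => [n _|_ _|//].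
    by move=> h; rewrite leeBlDr// addeC.
  by rewrite addeNy leNye.
clearbody Q N; rewrite -CE; apply: (le_trans (pe z _ (lexx _))); first exact: ltW.
apply: (le_trans (leeD2r _ tr)).
have c590 : 0 <= C by exact: le_trans AC.
apply: (@le_trans _ _ (C%:E * (Q + N) + (d + 52 * r * d / eta + 48 * r * eta * M + 768 * r * L)%:E)%E); last first.
  by rewrite leeD2r// lee_wpmul2l// lee_fin.
rewrite ge0_muleDr//.
have h26 : (A%:E * Q <= C%:E * Q)%E.
  by rewrite lee_wpmul2r// lee_fin.
apply: (@le_trans _ _ (C%:E * Q + (A * (2 * d) / eta)%:E + (C%:E * N + (48 * r * eta * M + 768 * r * L)%:E) + d%:E)%E).
  by rewrite !leeD2r.
have reorder (a b : \bar R) (x y u : R) :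
    (a + x%:E + (b + y%:E) + u%:E = a + b + (x + y + u)%:E)%E.
  by rewrite !EFinD !addeA -(addeA a) (addeC x%:E) !addeA.
rewrite reorder leeD2l// lee_fin.
by rewrite le_eqVlt AE; apply/orP; left; apply/eqP; ring.
Qed.

End MainBound.

(** The origin is treated apart because the truncations are shown to converge only for z != 0. *)
Lemma potential0 (R : realType) (mu : {measure set (borelC R) -> \bar R}) :
  potential mu 0 = 0%E.
Proof.
rewrite /potential; apply: lim_near_cst => //; near=> e.
apply: integral0_eq => w _; rewrite mul0r /kernelH subr0 modC1.
by rewrite lne_EFin// ln1 adde0.
Unshelve. all: by end_near. Qed.

(** * Choice of the parameters *)

Section PotentialGrowth.
Variable R : realType.
Variable mu : {sigma_finite_measure set (borelC R) -> \bar R}.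
Hypothesis mu_lf : locally_finite mu.
Hypothesis mu_tail : (\int[mu]_(z in [set z : borelC R | (1 <= modC z)%R])
          (modC z ^- 2)%R%:E < +oo)%E.
Hypothesis mu_pv : cvg (pv_truncated mu eps @[eps --> (0 : R)^'+]).

Local Notation upper_density :=
  (limf_esup (fun r : R => disc_mass mu r * r^-1%R%:E)%E (0%R : R)^'+).

Lemma upper_density_ge0 : (0 <= upper_density)%E.
Proof.
rewrite limf_esupE; apply: le_ereal_inf_tmp => _ [V V0 <-].
have [x [Vx x0]] : exists x, V x /\ 0 < x.
  have : \forall x \near (0 : R)^'+, V x /\ 0 < x.
    by near=> x; split; near: x => //; exact: nbhs_right_gt.
  exact: filter_ex.
apply: (@le_trans _ _ (disc_mass mu x * x^-1%:E)%E).
  by rewrite mule_ge0 ?measure_ge0// lee_fin invr_ge0 ltW.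
by apply: ereal_sup_ubound; exists x.
Unshelve. all: by end_near. Qed.

Lemma disc_mass_upper_density (l e : R) : upper_density = l%:E -> 0 < e ->
  exists2 rho, 0 < rho & forall t, 0 < t -> t <= rho ->
    (disc_mass mu t <= ((l + e) * t)%:E)%E.
Proof.
move=> lE e0.
have : (upper_density < (l + e)%:E)%E by rewrite lE lte_fin ltrDl.
rewrite limf_esupE => /ereal_inf_lt[_ [V [rho /= rho0 hV] <-] hsup].
exists (rho / 2); first by rewrite divr_gt0.
move=> t t0 t_rho; have Vt : V t.
  apply: hV => //=; rewrite sub0r normrN gtr0_norm//.
  by rewrite (le_lt_trans t_rho)// ltr_pdivrMr// ltr_pMr// ltr1n.
have : (disc_mass mu t * t^-1%:E <= (l + e)%:E)%E.
  by apply: le_trans (ltW hsup); apply: ereal_sup_ubound; exists t.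
by rewrite lee_pdivrMr.
Qed.

(** The order of choice is e', rho, M, eta, d: the excess over the upper density, the radius and the
    mass term it determines, eta small against M, d small against eta. Each of the three resulting
    errors is at most e / 3. *)
Lemma potential_bound (z : R[i]) (D l : R) :
  delta_integral mu = D%:E -> upper_density = l%:E ->
  (potential mu z <= (768 * modC z * (D + l))%:E)%E.
Proof.
move=> DE lE; have l0 : 0 <= l by rewrite -lee_fin -lE upper_density_ge0.
have D0 : 0 <= D.
  rewrite -lee_fin -DE; apply: integral_ge0 => t _.
  rewrite mule_ge0 ?lee_fin ?invr_ge0 ?sqr_ge0// /delta.
  by rewrite !adde_ge0 ?funeneg_ge0// measure_ge0.
have [->|z0] := eqVneq z 0.
  rewrite potential0 lee_fin.
  by apply: mulr_ge0; [apply: mulr_ge0; [exact: ler0n|exact: modC_ge0]|exact: addr_ge0].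
have r0 : 0 < modC z by rewrite modC_gt0.
set r := modC z in r0 *; apply/lee_addgt0Pr => e e0.
have [K KE] : exists K, K = 768 * r by exists (768 * r).
have K0 : 0 < K by rewrite KE; apply: mulr_gt0; [rewrite ltr0n|].
pose e' := e / (3 * K).
have e'0 : 0 < e' by rewrite divr_gt0// mulr_gt0.
have [rho rho0 massL] := disc_mass_upper_density lE e'0.
have Mfin : sqmass mu rho \is a fin_num.
  by rewrite ge0_fin_numE ?sqmass_ge0// sqmass_fin.
pose M := fine (sqmass mu rho); have ME : sqmass mu rho = M%:E by rewrite fineK.
have M0 : 0 <= M by rewrite fine_ge0// sqmass_ge0.
pose B := Num.min (r / 2) (e / (3 * (48 * r * M + 1))).
have B1 : 0 < 48 * r * M + 1.
  by rewrite ltr_wpDl//; apply: mulr_ge0 => //; apply: mulr_ge0; [exact: ler0n|exact: ltW].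
have B0 : 0 < B by rewrite lt_min divr_gt0//= divr_gt0// mulr_gt0.
have [k hk] : exists k, rho / 2 ^+ k < B.
  exists (Num.bound (rho / B)).
  rewrite ltr_pdivrMr ?exprn_gt0// -ltr_pdivrMl// mulrC.
  apply: (lt_trans (archi_boundP (divr_ge0 (ltW rho0) (ltW B0)))).
  by rewrite -natrX ltr_nat ltn_expl.
pose eta := rho / 2 ^+ k.
have eta0 : 0 < eta by rewrite divr_gt0// exprn_gt0.
move: hk; rewrite -/eta lt_min => /andP[eta_r eta_e].
pose d := e / (3 * (1 + 52 * r / eta)).
have B2 : 0 < 1 + 52 * r / eta.
  rewrite ltr_pwDl//; apply: divr_ge0; last exact: ltW.
  by apply: mulr_ge0; [exact: ler0n|exact: ltW].
have d0 : 0 < d by rewrite divr_gt0// mulr_gt0.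
have le0 : 0 <= l + e' by rewrite addr_ge0// ltW.
have := core_bound mu_lf mu_tail mu_pv le0 rho0 massL d0 (erefl eta) eta_r ME.
move/le_trans; apply; rewrite DE -EFinM -EFinD lee_fin -/r.
have h1 : d + 52 * r * d / eta = e / 3.
  by rewrite /d; field; rewrite !gt_eqF//=; move: B2; rewrite -(ltr_pM2r eta0); nra.
have h2 : 48 * r * eta * M <= e / 3.
  move: eta_e; rewrite ltr_pdivlMr; last by rewrite mulr_gt0.
  have : 0 <= eta by exact: ltW.
  by lra.
have h3 : K * e' = e / 3 by rewrite /e'; field; rewrite gt_eqF.
have h4 : 590 * r * D <= K * D.
  by rewrite KE; apply: ler_wpM2r => //; rewrite ler_pM2r// ler_nat.
rewrite h1 -KE mulrDr; move: h4 h3 h2.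
move: (590 * r * D) (48 * r * eta * M) => x y.
by rewrite mulrDr; lra.
Qed.

End PotentialGrowth.

(** * Locally finite measures as sigma-finite measures *)

Section SigmaFinite.
Context (R : realType) (mu : {measure set (borelC R) -> \bar R}).
Variable mu_lf : locally_finite mu.

(* The proof of local finiteness is an argument so that the instance can use it. *)
Definition lf_measure (_ : locally_finite mu) : set (borelC R) -> \bar R := mu.

HB.instance Definition _ := Measure.copy (lf_measure mu_lf) mu.

HB.instance Definition _ := Measure_isSigmaFinite.Build _ _ _ (lf_measure mu_lf)
  (sigma_finite_lf mu_lf).

End SigmaFinite.

Theorem theorem3 (R : realType) :
  exists K : R, 0 < K /\
    forall mu : {measure set (borelC R) -> \bar R},
      locally_finite mu ->
      (\int[mu]_(z in [set z : borelC R | (1 <= modC z)%R])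
          (modC z ^- 2)%R%:E < +oo)%E ->
      cvg (pv_truncated mu eps @[eps --> (0 : R)^'+]) ->
      (ereal_sup [set max_on_disc (potential mu) r * r^-1%R%:E
                   | r in [set r : R | (0 < r)%R]]
       <= K%:E *
          (\int[lebesgue_measure]_(t in [set t : R | (0 < t)%R])
              (delta mu t * (t ^- 2)%R%:E)
           + limf_esup (fun r : R => disc_mass mu r * r^-1%R%:E) (0%R : R)^'+))%E.
Proof.
exists 768; split; first by rewrite ltr0n.
move=> mu mu_lf mu_tail mu_pv.
pose nu : {sigma_finite_measure set (borelC R) -> \bar R} := lf_measure mu_lf.
have bound z D l := @potential_bound R nu mu_lf mu_tail mu_pv z D l.
have K0 : (0 < (768 : R)%:E)%E by rewrite lte_fin ltr0n.
have D0 : (0 <= delta_integral nu)%E.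
  apply: integral_ge0 => t _; rewrite mule_ge0 ?lee_fin ?invr_ge0 ?sqr_ge0//.
  by rewrite /delta !adde_ge0 ?funeneg_ge0// measure_ge0.
have l0 := upper_density_ge0 nu.
move: bound D0 l0.
rewrite -[X in (_ <= _ * (X + _))%E]/(delta_integral nu).
rewrite -[X in (_ <= _ * (_ + X))%E]/(limf_esup (fun r : R => disc_mass nu r * r^-1%R%:E)%E (0%R : R)^'+).
(* Both terms on the right are nonnegative, so if one of them is +oo the bound is trivial; otherwise
   [potential_bound] applies at each point of the disc. *)
case DE : (delta_integral nu) => [D| |//]; last first.
  by move=> _ _ l0; rewrite addye ?gt_eqF ?(lt_le_trans _ l0)// gt0_muley// leey.
case lE : (limf_esup _ _) => [l| |//]; last by move=> _ _ _; rewrite addey// gt0_muley// leey.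
move=> bound D0 l0; apply: ge_ereal_sup => _ [r /= r0 <-].
rewrite -EFinD -EFinM lee_pdivrMr// -EFinM /max_on_disc.
apply: ge_ereal_sup => _ [z /= zr <-].
apply: le_trans (bound z D l erefl erefl) _; rewrite lee_fin.
have Dl0 : 0 <= D + l by rewrite addr_ge0// -lee_fin.
move: (768 : R) (ler0n R 768) => K K_ge0; rewrite mulrAC.
by rewrite ler_wpM2l// mulr_ge0.
Qed.
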